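(* Let $\phi:\mathbb{R}^d\to\mathbb{R}$ be a positive definite function which is continuous and symmetric ($\phi(-x)=\phi(x)$ for all $x$), with $|\phi|_\infty:=\sup_{x\in[0,1]^d}\sum_{k\in\mathbb{Z}^d}|\phi(x-k)|<\infty$ and with cardinal symbol satisfying $\sigma_\phi(\zeta)>0$ for all $\zeta\in T^d$. Let $\mathcal{N}_\phi$ be the native space of $\phi$, with inner product $(\cdot,\cdot)_\phi$. (i) The Lagrange function $\chi=\sum_{k\in\mathbb{Z}^d}a_k\phi(\cdot-k)$ for cardinal interpolation with $\phi$ belongs to $\mathcal{N}_\phi$ and $$(f,\chi)_\phi=\sum_{k\in\mathbb{Z}^d}a_kf(k),\quad f\in\mathcal{N}_\phi.$$ Consequently, $\chi$ is the unique function of minimum norm in $\mathcal{N}_\phi$ that satisfies the interpolation conditions $\chi(j)=\delta_{j,0}$, $j\in\mathbb{Z}^d$. (ii) If $H$ is a half-space lattice, then, for each $j\in H$, the Lagrange function $\chi_j=\sum_{k\in H}a_{k,j}\phi(\cdot-k)$ for semi-cardinal interpolation on $H$ with $\phi$ belongs to $\mathcal{N}_\phi$ and $$(f,\chi_j)_\phi=\sum_{k\in H}a_{k,j}f(k),\quad f\in\mathcal{N}_\phi.$$ Hence, $\chi_j$ is the unique function of minimum norm in $\mathcal{N}_\phi$ that satisfies the interpolation conditions $\chi_j(l)=\delta_{j,l}$, $l\in H$.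
   Context: Notation: write $x=(x',x_d)$ with $x'\in\mathbb{R}^{d-1}$ for $d$-dimensional vectors. $T^d=\{\zeta\in\mathbb{C}^d:|\zeta_1|=\dots=|\zeta_d|=1\}$, $\zeta^k=\zeta_1^{k_1}\cdots\zeta_d^{k_d}$ for $k\in\mathbb{Z}^d$, $\zeta^{-1}=(\zeta_1^{-1},\dots,\zeta_d^{-1})$. $W=W(T^d)$ is the Wiener algebra of continuous functions $u$ on $T^d$ with absolutely summable Fourier coefficients $\{\widehat u_k\}_{k\in\mathbb{Z}^d}$, $\|u\|_W=\sum_k|\widehat u_k|$. $\mathbb{Z}_+=\{0,1,2,\dots\}$. Native space: the Fourier transform is $\widehat f(t)=\int_{\mathbb{R}^d}f(x)e^{-ixt}\,dx$ (extended to $L_2(\mathbb{R}^d)$). For $\phi$ positive definite as in the claim (in the sense of the scattered-data literature: $\sum_{m,n}c_mc_n\phi(x_m-x_n)>0$ for finitely many distinct points $x_m\in\mathbb{R}^d$ and real $c_m$ not all zero), $\widehat\phi$ is nonnegative and in $L_1(\mathbb{R}^d)$. $\mathcal{N}_\phi$ is the real Hilbert space of (real-valued) functions $f\in L_2(\mathbb{R}^d)\cap C(\mathbb{R}^d)$ for which there exists $\mathcal{Q}f\in L_2(\mathbb{R}^d)$ with $\widehat f=(\widehat\phi)^{1/2}\mathcal{Q}f$, equipped with the inner product $(f,g)_\phi=\frac{1}{(2\pi)^d}\int_{\mathrm{supp}\,\widehat\phi}\mathcal{Q}f(t)\overline{\mathcal{Q}g(t)}\,dt$, where $\mathrm{supp}\,\widehat\phi$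 is understood as $\{t:\widehat\phi(t)>0\}$. Its reproducing kernel is $(x,y)\mapsto\phi(x-y)$. Half-space lattice: a set $H\subset\mathbb{Z}^d$ that is either $H=\mathbb{Z}^{d-1}\times\mathbb{Z}_+$, or $H=\mathbb{Z}^d_{\preceq,+}:=\{j\in\mathbb{Z}^d:0\preceq j\}$, where $\preceq$ is a linear (total) order on $\mathbb{Z}^d$ compatible with addition ($j\preceq k$ implies $j+l\preceq k+l$). Cardinal symbol: $\sigma_\phi(\zeta)=\sum_{k\in\mathbb{Z}^d}\phi(k)\zeta^k$, $\zeta\in T^d$. Under the stated assumptions on $\phi$, $\omega:=1/\sigma_\phi\in W$ and $\log\omega\in W$; write $\omega(\zeta)=\sum_{k\in\mathbb{Z}^d}a_k\zeta^k$ and $\log\omega(\zeta)=\sum_{k\in\mathbb{Z}^d}\lambda_k\zeta^k$. The Lagrange function for cardinal interpolation is $\chi(x)=\sum_{k\in\mathbb{Z}^d}a_k\phi(x-k)$, $x\in\mathbb{R}^d$. Wiener-Hopf factor: if $H=\mathbb{Z}^{d-1}\times\mathbb{Z}_+$, let $\Lambda_+(\zeta)=\frac12\sum_{k'\in\mathbb{Z}^{d-1}}\lambda_{(k',0)}(\zeta')^{k'}+\sum_{k_d=1}^\infty\sum_{k'\in\mathbb{Z}^{d-1}}\lambda_k\zeta^k$; if $H=\mathbb{Z}^d_{\preceq,+}$, let $\Lambda_+(\zeta)=\frac12\lambda_0+\sum_{k\succ0}\lambda_k\zeta^k$. Set $\omega_+=\exp(\Lambda_+)$. Then $\omega(\zeta)=\omega_+(\zeta)\omega_+(\zeta^{-1})$,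 $\omega_+\in W$, and its Fourier coefficients are supported on $H$. Semi-cardinal symbols: let $P_+\{\sum_{k\in\mathbb{Z}^d}\widehat\psi_k\zeta^k\}=\sum_{k\in H}\widehat\psi_k\zeta^k$ for $\psi\in W$. For $j\in H$, $\omega_j(\zeta):=\omega_+(\zeta)\,P_+\{\zeta^j\omega_+(\zeta^{-1})\}$, which lies in $W$ with Fourier coefficients supported on $H$: $\omega_j(\zeta)=\sum_{k\in H}a_{k,j}\zeta^k$. Lagrange functions for semi-cardinal interpolation on $H$: $\chi_j(x)=\sum_{k\in H}a_{k,j}\phi(x-k)$, $x\in\mathbb{R}^d$, $j\in H$. *)

(* Defs.v *)
From HB Require Import structures.
From mathcomp Require Import all_boot all_order all_algebra.
From mathcomp Require Import complex.
From mathcomp Require Import all_classical all_reals all_analysis.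

Set Implicit Arguments.
Unset Strict Implicit.
Unset Printing Implicit Defensive.

Import Order.TTheory GRing.Theory Num.Theory.
Import numFieldNormedType.Exports.

Local Open Scope classical_set_scope.
Local Open Scope ring_scope.

(* The sigma-algebra on 'rV[R]_n is the one generated by the coordinates. *)

Definition measure_rV_display : measure_display.
Proof. exact: default_measure_display. Qed.

Section measurable_rV.
Context {R : realType} (n : nat).

Let coords : 'I_n -> 'rV[R]_n -> R := fun i x => x ord0 i.

Let rV_set0 : g_sigma_preimage coords set0.
Proof. exact: sigma_algebra0. Qed.

Let rV_setC A : g_sigma_preimage coords A -> g_sigma_preimage coords (~` A).
Proof. exact: sigma_algebraC. Qed.

Let rV_bigcup (F : _^nat) : (forall i, g_sigma_preimage coords (F i)) ->
  g_sigma_preimage coords (\bigcup_i (F i)).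
Proof. exact: sigma_algebra_bigcup. Qed.

HB.instance Definition _ := @isMeasurable.Build measure_rV_display
  'rV[R]_n (g_sigma_preimage coords) rV_set0 rV_setC rV_bigcup.

Lemma measurable_coord (i : 'I_n) :
  measurable_fun [set: 'rV[R]_n] (fun x : 'rV[R]_n => x ord0 i).
Proof.
move=> _ Y mY; rewrite setTI; apply: sub_sigma_algebra => /=.
rewrite -bigcup_seq/=; exists i => /=; first by rewrite mem_index_enum.
by exists Y => //; rewrite setTI.
Qed.

End measurable_rV.

Lemma measurable_fun_rVP (R : realType) n d (T : measurableType d)
    (f : T -> 'rV[R]_n) :
  (forall i, measurable_fun [set: T] (fun t => f t ord0 i)) ->
  measurable_fun [set: T] f.
Proof.
move=> mf _ A mA.
have sub : g_sigma_preimage (fun i => (fun x : 'rV[R]_n => x ord0 i) \o f)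
    `<=` measurable.
  apply: smallest_sub; first exact: sigma_algebra_measurable.
  case: n => [|m] in f mf A mA *; first by rewrite big_ord0.
  rewrite -bigcup_mkord_ord; apply: bigcup_sub => i Ii.
  by move=> B [D mD <-]; exact: mf.
by apply: sub; rewrite g_sigma_preimage_comp; exists A.
Qed.

Definition rV_cons (R : realType) (n : nat) (p : measurableTypeR R * 'rV[R]_n) : 'rV[R]_n.+1 :=
  row_mx p.1%:M p.2.

Section lebesgue_rV.
Context {R : realType}.

Lemma measurable_rV_cons n : measurable_fun [set: measurableTypeR R * 'rV[R]_n] (@rV_cons R n).
Proof.
apply: measurable_fun_rVP => i.
have [j ->|j ->] := split_ordP (i : 'I_(1 + n)).
  rewrite (_ : (fun _ => _) = fst); first exact: measurable_fst.
  by apply/funext => -[x y]; rewrite /rV_cons (row_mxEl x%:M) !ord1 mxE eqxx.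
rewrite (_ : (fun _ => _) = (fun x : 'rV[R]_n => x ord0 j) \o snd).
  by apply: measurableT_comp; [exact: measurable_coord|exact: measurable_snd].
by apply/funext => -[x y]; rewrite /rV_cons (row_mxEr x%:M).
Qed.

Section step.
Variables (n : nat) (m : {sigma_finite_measure set 'rV[R]_n -> \bar R}).

Definition lebesgue_rV_step : set 'rV[R]_n.+1 -> \bar R :=
  pushforward (@lebesgue_measure R \x m)%E (@rV_cons R n).

Let step0 : lebesgue_rV_step set0 = 0%E.
Proof. by rewrite /lebesgue_rV_step /pushforward preimage_set0 measure0. Qed.

Let step_ge0 A : (0 <= lebesgue_rV_step A)%E.
Proof. by rewrite /lebesgue_rV_step /pushforward; exact: measure_ge0. Qed.

Let step_sigma_additive : semi_sigma_additive lebesgue_rV_step.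
Proof.
move=> F mF tF mUF; rewrite /lebesgue_rV_step /pushforward preimage_bigcup.
have mc A : measurable A -> measurable ((@rV_cons R n) @^-1` A).
  by move=> mA; rewrite -[X in measurable X]setTI; exact: measurable_rV_cons.
apply: measure_semi_sigma_additive.
- by move=> k; exact: mc.
- apply/trivIsetP => /= i j _ _ ij; rewrite -preimage_setI.
  by move/trivIsetP : tF => /(_ _ _ _ _ ij) ->//; rewrite preimage_set0.
- by rewrite -preimage_bigcup; exact: mc.
Qed.

HB.instance Definition _ := isMeasure.Build _ _ _
  lebesgue_rV_step step0 step_ge0 step_sigma_additive.

Let step_sigma_finite : sigma_finite setT lebesgue_rV_step.
Proof.
have [F TF Foo] := @isSigmaFinite.sigma_finiteT _ _ _ _
  (lebesgue_integral_fubini.measure_function_Measure_isSigmaFinite__to__measure_function_isSigmaFinite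
    (@lebesgue_measure R) m).
pose u (x : 'rV[R]_n.+1) : measurableTypeR R * 'rV[R]_n :=
  (x ord0 ord0, @rsubmx _ 1 1 n x).
have mu_ : measurable_fun setT u.
  apply/measurable_fun_pair; first exact: measurable_coord.
  apply: measurable_fun_rVP => i.
  rewrite (_ : (fun _ => _) = (fun x : 'rV_n.+1 => x ord0 (rshift 1 i))).
    exact: measurable_coord.
  by apply/funext => x; rewrite mxE.
have uK p : u (rV_cons p) = p.
  case: p => x y; rewrite /u /rV_cons /= row_mxKr; congr pair.
  have -> : ord0 = lshift n (@ord0 0) by apply/val_inj.
  by rewrite (row_mxEl x%:M) mxE eqxx.
exists (fun k => u @^-1` F k).
  by rewrite -preimage_bigcup -TF preimage_setT.
move=> k; have [mF Fk] := Foo k; split.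
  by rewrite -[X in measurable X]setTI; exact: mu_.
rewrite /lebesgue_rV_step /pushforward.
rewrite (_ : _ @^-1` _ = F k) //.
by apply/seteqP; split => p /=; rewrite uK.
Qed.

HB.instance Definition _ := Measure_isSigmaFinite.Build _ _ _
  lebesgue_rV_step step_sigma_finite.

End step.

(* Lebesgue measure on R^n, as an iterated product measure. *)
Fixpoint lebesgue_rV (n : nat) :
    {sigma_finite_measure set 'rV[R]_n -> \bar R} :=
  match n with
  | 0 => \d_(0 : 'rV[R]_0)
  | n'.+1 => lebesgue_rV_step (lebesgue_rV n')
  end.

End lebesgue_rV.

Section complex_analysis.
Context {R : realType}.
Local Notation C := R[i].

Definition cis (t : R) : C := (cos t +i* sin t)%C.

Definition cexp (z : C) : C := (expR (complex.Re z))%:C%C * cis (complex.Im z).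

(* Unconditional sums; [has_csum] includes absolute convergence, whereas
   [csum] takes a junk value when the family is not absolutely summable. *)
Definition rsum (I : choiceType) (D : set I) (u : I -> R) : R :=
  fine (\esum_(i in D) (EFin \o u)^\+ i)%E -
  fine (\esum_(i in D) (EFin \o u)^\- i)%E.

Definition csum (I : choiceType) (D : set I) (u : I -> C) : C :=
  (rsum D (fun i => complex.Re (u i)) +i* rsum D (fun i => complex.Im (u i)))%C.

Definition has_csum (I : choiceType) (D : set I) (u : I -> C) (s : C) : Prop :=
  (\esum_(i in D) (ComplexField.Normc.normc (u i))%:E < +oo)%E /\ csum D u = s.

Section integral.
Variable n : nat.
Local Notation E := 'rV[R]_n.
Local Notation mu := (@lebesgue_rV R n).
Implicit Types (D : set E) (f g : E -> C).

Definition cmeasurable f : Prop :=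
  measurable_fun setT (fun x => complex.Re (f x)) /\
  measurable_fun setT (fun x => complex.Im (f x)).

Definition cintegral D f : C :=
  (Rintegral mu D (fun x => complex.Re (f x)) +i*
   Rintegral mu D (fun x => complex.Im (f x)))%C.

Definition sqnorm_L2 f : \bar R := (\int[mu]_x ((ComplexField.Normc.normc (f x)) ^+ 2)%:E)%E.

Definition in_L1 f : Prop :=
  cmeasurable f /\ (\int[mu]_x (ComplexField.Normc.normc (f x))%:E < +oo)%E.

Definition in_L2 f : Prop := cmeasurable f /\ (sqnorm_L2 f < +oo)%E.

Definition dot (x y : E) : R := \sum_i x ord0 i * y ord0 i.

Definition fourier f (t : E) : C :=
  cintegral setT (fun x => f x * cis (- dot x t)).

(* [g] is (a version of) the Fourier transform of [f] in L2, i.e. the value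
   at [f] of the L2-continuous extension of [fourier] from L1 /\ L2. *)
Definition fourier_L2 f g : Prop :=
  [/\ in_L2 f, in_L2 g &
   exists u : nat -> E -> C,
     [/\ forall m, in_L1 (u m) /\ in_L2 (u m),
         sqnorm_L2 (fun x => u m x - f x) @[m --> \oo] --> 0%E &
         sqnorm_L2 (fun t => fourier (u m) t - g t) @[m --> \oo] --> 0%E]].

End integral.

Section torus.
Variable n : nat.
Implicit Types (k : 'rV[int]_n) (z : 'rV[C]_n).

Definition zvec k : 'rV[R]_n := map_mx (fun a : int => a%:~R) k.

Definition unit_cube : set 'rV[R]_n := [set x | forall i, 0 <= x ord0 i <= 1].

Definition torus : set 'rV[C]_n := [set z | forall i, `|z ord0 i| = 1].

Definition torus_pt (x : 'rV[R]_n) : 'rV[C]_n :=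
  map_mx (fun a => cis (2 * pi * a)) x.

Definition zpow z k : C := \prod_i z ord0 i ^ k ord0 i.

Definition zinv z : 'rV[C]_n := map_mx (fun a => a^-1) z.

Definition fourier_coef (u : 'rV[C]_n -> C) k : C :=
  cintegral unit_cube
    (fun x => u (torus_pt x) * cis (- (2 * pi * dot (zvec k) x))).

End torus.

Section native_space.
Variables (n : nat) (phi : 'rV[R]_n -> R).
Local Notation E := 'rV[R]_n.
Implicit Types f g q : E -> C.

Definition positive_definite : Prop :=
  forall (m : nat) (x : 'I_m -> E) (c : 'I_m -> R),
    injective x -> (exists i, c i != 0) ->
    0 < \sum_i \sum_j c i * c j * phi (x i - x j).

Definition amalgam_norm : \bar R :=
  ereal_sup [set (\esum_(k in [set: 'rV[int]_n]) `|phi (x - zvec k)|%:E)%E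
            | x in @unit_cube n].

Definition phihat : E -> C := fourier (fun x => (phi x)%:C%C).

Definition is_native_quotient f q : Prop :=
  in_L2 q /\ fourier_L2 f (fun t => sqrtC (phihat t) * q t).

(* Elements are C-valued functions that are required to be real-valued. *)
Definition native : set (E -> C) := [set f |
  [/\ forall x, complex.Im (f x) = 0,
      continuous (fun x => complex.Re (f x)),
      in_L2 f &
      exists q, is_native_quotient f q]].

(* Determined up to a null set on {phihat > 0}. *)
Definition native_quotient f : E -> C :=
  xget (fun=> 0) [set q | is_native_quotient f q].

Definition native_ip f g : C :=
  ((2 * pi) ^- n)%:C%C *
  cintegral [set t | 0 < phihat t]
    (fun t => native_quotient f t * ((native_quotient g t)^*)%C).

Definition native_norm f : C := sqrtC (native_ip f f).

(* [g] is the unique element of minimal norm of the native space taking the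
   values delta_{j,l} at the points l of D. *)
Definition unique_min_norm_interpolant (D : set 'rV[int]_n) (j : 'rV[int]_n)
    g : Prop :=
  let interpolant f := native f /\ forall l, D l -> f (zvec l) = (j == l)%:R in
  interpolant g /\
  forall f, interpolant f ->
    native_norm g <= native_norm f /\
    (native_norm f = native_norm g -> f = g).

Definition symbol (z : 'rV[C]_n) : C :=
  csum setT (fun k => (phi (zvec k))%:C%C * zpow z k).

Definition omega (z : 'rV[C]_n) : C := (symbol z)^-1.

(* omega is real and positive on the torus, so [ln] applies to its real part. *)
Definition log_omega (z : 'rV[C]_n) : C := (ln (complex.Re (omega z)))%:C%C.

Definition cardinal_coef : 'rV[int]_n -> C := fourier_coef omega.

Definition log_coef : 'rV[int]_n -> C := fourier_coef log_omega.

Definition cardinal_lagrange (x : E) : C :=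
  csum setT (fun k => cardinal_coef k * (phi (x - zvec k))%:C%C).

End native_space.

Record lattice_order (n : nat) := LatticeOrder {
  lo_le :> rel 'rV[int]_n;
  lo_refl : reflexive lo_le;
  lo_anti : antisymmetric lo_le;
  lo_trans : transitive lo_le;
  lo_total : total lo_le;
  lo_add : forall j k l, lo_le j k -> lo_le (j + l) (k + l)
}.

(* The two kinds of half-space lattices in Z^(d+1); the last coordinate of k
   is [k ord0 ord_max]. *)
Inductive half_space (d : nat) :=
  | FlatHalfSpace
  | OrderHalfSpace of lattice_order d.+1.

Section semi_cardinal.
Variables (d : nat) (phi : 'rV[R]_d.+1 -> R) (H : half_space d).
Local Notation Zd := 'rV[int]_d.+1.
Implicit Types (z : 'rV[C]_d.+1) (k j : Zd).

Definition half_set : set Zd :=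
  match H with
  | FlatHalfSpace => [set k : Zd | (0 <= k ord0 ord_max)%R]
  | OrderHalfSpace le => [set k : Zd | le 0 k]
  end.

Definition Lambda_plus z : C :=
  let term k := log_coef phi k * zpow z k in
  match H with
  | FlatHalfSpace =>
      2^-1 * csum [set k : Zd | k ord0 ord_max = 0] term +
      csum [set k : Zd | 0 < k ord0 ord_max] term
  | OrderHalfSpace le =>
      2^-1 * log_coef phi 0 + csum [set k : Zd | le 0 k /\ k <> 0] term
  end.

Definition omega_plus z : C := cexp (Lambda_plus z).

Definition proj_plus (u : 'rV[C]_d.+1 -> C) z : C :=
  csum half_set (fun k => fourier_coef u k * zpow z k).

Definition semi_symbol j z : C :=
  omega_plus z * proj_plus (fun y => zpow y j * omega_plus (zinv y)) z.

Definition semi_coef j k : C := fourier_coef (semi_symbol j) k.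

Definition semi_lagrange j (x : 'rV[R]_d.+1) : C :=
  csum half_set (fun k => semi_coef j k * (phi (x - zvec k))%:C%C).

End semi_cardinal.

End complex_analysis.

Arguments FlatHalfSpace {d}.

(* Main.v *)
From HB Require Import structures.
Require Import Defs.
From mathcomp Require Import all_boot all_order all_algebra.
From mathcomp Require Import complex.
From mathcomp Require Import all_classical all_reals all_analysis.
From mathcomp Require Import measurable_realfun ring lra.

(* For an absolutely summable real family c supported on D, the function
   g = sum_k c_k phi(. - k) has quotient Q g = conj(A) phihat^(1/2) with
   A(t) = sum_k c_k e^(ikt), so Fourier inversion gives
   (f, g)_phi = sum_k c_k f(k) for every f in the native space.  If moreover
   g(l) = delta_{j,l} on D, then (f - g, g)_phi = 0 for every interpolant f,
   whence ||f||^2 = ||g||^2 + ||f - g||^2 and g is the unique interpolant of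
   minimal norm.

   It remains to see that the coefficients of the Lagrange functions are real,
   summable and interpolate.  Wiener's lemma (spectral radius at most sup norm)
   makes the Neumann series of 1/sigma and the series of log(1/sigma) converge
   in the Wiener algebra, after scaling sigma to lie in (0, 1).  In the
   semi-cardinal case write omega_-(z) = omega_+(1/z).  Then
   omega_j = omega_+ P_+(z^j omega_-), and since omega_+ omega_- sigma = 1,
   omega_j sigma = z^j - omega_-^(-1) (1 - P_+)(z^j omega_-), where the last
   product has no coefficient on H.

   The nonnegativity of phihat comes from averaging the positive definiteness
   inequality over independent random points with Gaussian density. *)

Set Implicit Arguments.
Unset Strict Implicit.
Unset Printing Implicit Defensive.

Import Order.TTheory GRing.Theory Num.Theory.
Import numFieldNormedType.Exports.

Local Open Scope classical_set_scope.
Local Open Scope ring_scope.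

(** * Real and complex integrals *)

(** Series and integrals are treated alike: a sum over Z^n or over [nat] is an integral for the
    counting measure, so that one Fubini theorem and one dominated convergence theorem serve both.
    Two features of the definitions shape the proof. [fourier_L2] is a relation through
    approximating sequences, so the L2 transform has to be shown unique up to null sets and
    pointwise inversion has to be derived from it; both rest on regularization by Gaussians, whose
    transforms come from a differential equation. And [native_quotient] is an arbitrary choice, so
    the inner product has to be shown independent of it. Inversion applies to the native space
    because phihat^(1/2) and Q f are both square integrable, hence have an integrable product; this
    needs phihat in L1, obtained from its nonnegativity and the boundedness of phi. For Wiener's
    lemma the symbol is truncated to a trigonometric polynomial: a power of the latter has
    polynomially many coefficients, each bounded by the supremum of its modulus, so passing from the
    sup norm to the l1 norm costs only a polynomial factor. *)

Local Notation Re := complex.Re.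
Local Notation Im := complex.Im.
Local Notation normc := ComplexField.Normc.normc.

Section complex_arith.
Context {R : realType}.
Implicit Types (x y z : R[i]) (a b : R).

Lemma ReD x y : Re (x + y) = Re x + Re y. Proof. by case: x; case: y. Qed.
Lemma ImD x y : Im (x + y) = Im x + Im y. Proof. by case: x; case: y. Qed.
Lemma ReN x : Re (- x) = - Re x. Proof. by case: x. Qed.
Lemma ImN x : Im (- x) = - Im x. Proof. by case: x. Qed.
Lemma ReM x y : Re (x * y) = Re x * Re y - Im x * Im y.
Proof. by case: x; case: y. Qed.
Lemma ImM x y : Im (x * y) = Re x * Im y + Im x * Re y.
Proof. by case: x; case: y. Qed.
Lemma ReJ x : Re (x^*)%C = Re x. Proof. by case: x. Qed.
Lemma ImJ x : Im (x^*)%C = - Im x. Proof. by case: x. Qed.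

Lemma complex_eqP x y : Re x = Re y -> Im x = Im y -> x = y.
Proof. by case: x; case: y => a b c e /= -> ->. Qed.

Lemma conjc_real a : ((a%:C)^*)%C = a%:C%C :> R[i].
Proof. by apply: complex_eqP => //=; rewrite oppr0. Qed.

Lemma real_complexM a b : (a * b)%:C%C = a%:C%C * b%:C%C :> R[i].
Proof. exact: rmorphM. Qed.
Lemma real_complexD a b : (a + b)%:C%C = a%:C%C + b%:C%C :> R[i].
Proof. exact: rmorphD. Qed.
Lemma conjcM x y : ((x * y)^*)%C = ((x^*)%C * (y^*)%C).
Proof. exact: rmorphM. Qed.

Lemma normcE x : normc x = Num.sqrt (Re x ^+ 2 + Im x ^+ 2).
Proof. by case: x. Qed.

Lemma normc_ge0 x : 0 <= normc x.
Proof. by rewrite normcE sqrtr_ge0. Qed.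

Lemma normc_sqr x : normc x ^+ 2 = Re x ^+ 2 + Im x ^+ 2.
Proof. by rewrite normcE sqr_sqrtr// addr_ge0// sqr_ge0. Qed.

Lemma Re_le_normc x : `|Re x| <= normc x.
Proof. by rewrite normcE -sqrtr_sqr ler_wsqrtr// lerDl sqr_ge0. Qed.

Lemma Im_le_normc x : `|Im x| <= normc x.
Proof. by rewrite normcE -sqrtr_sqr ler_wsqrtr// lerDr sqr_ge0. Qed.

Lemma normc_le x : normc x <= `|Re x| + `|Im x|.
Proof.
rewrite -(ler_pXn2r (n := 2)) ?nnegrE ?normc_ge0 ?addr_ge0//.
rewrite normc_sqr sqrrD !real_normK ?num_real// -addrA lerD2l lerDr.
by rewrite mulrn_wge0// mulr_ge0.
Qed.

Lemma normcM x y : normc (x * y) = normc x * normc y.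
Proof. exact: ComplexField.Normc.normcM. Qed.

Lemma normcD x y : normc (x + y) <= normc x + normc y.
Proof. exact: (@le_normcD R x y). Qed.

Lemma normcN x : normc (- x) = normc x.
Proof. exact: (@normcN R x). Qed.

Lemma normcB x y : normc (x - y) <= normc x + normc y.
Proof. by rewrite (le_trans (normcD _ _))// normcN. Qed.

Lemma normc_conj x : normc (x^*)%C = normc x.
Proof. by rewrite !normcE ReJ ImJ sqrrN. Qed.

Lemma normc_real a : normc a%:C%C = `|a|.
Proof. by rewrite normcE /= expr0n addr0 sqrtr_sqr. Qed.

Lemma normc0 : normc (0 : R[i]) = 0.
Proof. exact: ComplexField.Normc.normc0. Qed.

Lemma normc0_eq0 x : normc x = 0 -> x = 0.
Proof. exact: ComplexField.Normc.eq0_normc. Qed.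

Lemma mulc_conj x : x * (x^*)%C = (normc x ^+ 2)%:C%C.
Proof.
rewrite normc_sqr; apply: complex_eqP; rewrite ?ReM ?ImM ReJ ImJ/=; ring.
Qed.

End complex_arith.

Section real_integrals.
Context d (T : measurableType d) (R : realType) (mu : {measure set T -> \bar R}).
Implicit Types f g h : T -> R.

Definition rintegrable f : Prop := mu.-integrable setT (EFin \o f).

Lemma rintegrable_measurable f : rintegrable f -> measurable_fun setT f.
Proof. by move/measurable_int/measurable_EFinP. Qed.

Lemma eq_rintegrable f g : f =1 g -> rintegrable f -> rintegrable g.
Proof. by move=> /funext ->. Qed.

Lemma eq_Rint f g : f =1 g -> (\int[mu]_x f x = \int[mu]_x g x)%R.
Proof. by move=> /funext ->. Qed.

Lemma rintegrableP f : rintegrable f <->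
  measurable_fun setT f /\ (\int[mu]_x `|f x|%:E < +oo)%E.
Proof.
split=> [If|[mf lf]].
  split; first exact: rintegrable_measurable.
  by have /integrableP[_] := If.
by apply/integrableP; split => //; exact/measurable_EFinP.
Qed.

Lemma rintegrable_le f g : measurable_fun setT f ->
  (forall x, `|f x| <= g x) -> rintegrable g -> rintegrable f.
Proof.
move=> mf fg; apply: le_integrable => //; first exact/measurable_EFinP.
by move=> x _ /=; rewrite lee_fin (le_trans (fg x))// ler_norm.
Qed.

Lemma rintegrableD f g : rintegrable f -> rintegrable g ->
  rintegrable (fun x => f x + g x).
Proof. by move=> If Ig; have := integrableD measurableT If Ig. Qed.

Lemma rintegrableB f g : rintegrable f -> rintegrable g ->
  rintegrable (fun x => f x - g x).
Proof. by move=> If Ig; have := integrableB measurableT If Ig. Qed.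

Lemma rintegrableN f : rintegrable f -> rintegrable (fun x => - f x).
Proof. by move=> If; have := integrableN If. Qed.

Lemma rintegrableZl a f : rintegrable f -> rintegrable (fun x => a * f x).
Proof. by move=> If; have := integrableZl measurableT a If. Qed.

Lemma rintegrableZr a f : rintegrable f -> rintegrable (fun x => f x * a).
Proof. by move=> If; have := integrableZr measurableT a If. Qed.

Lemma rintegrable0 : rintegrable (fun=> 0).
Proof. exact: integrable0. Qed.

Lemma rintegrable_norm f : rintegrable f -> rintegrable (fun x => `|f x|).
Proof. by move=> If; exact: integrable_norm. Qed.

Lemma rintegrableMl B f h : rintegrable f -> measurable_fun setT h ->
  (forall x, `|h x| <= B) -> rintegrable (fun x => f x * h x).
Proof.
move=> If mh hB; apply: (@rintegrable_le _ (fun x => `|f x| * B)).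
- by apply: measurable_funM => //; exact: rintegrable_measurable.
- by move=> x; rewrite normrM ler_wpM2l.
- by apply: rintegrableZr; exact: rintegrable_norm.
Qed.

Lemma RintD f g : rintegrable f -> rintegrable g ->
  (\int[mu]_x (f x + g x) = \int[mu]_x f x + \int[mu]_x g x)%R.
Proof. exact: RintegralD. Qed.

Lemma RintB f g : rintegrable f -> rintegrable g ->
  (\int[mu]_x (f x - g x) = \int[mu]_x f x - \int[mu]_x g x)%R.
Proof. exact: RintegralB. Qed.

Lemma RintZl a f : rintegrable f ->
  (\int[mu]_x (a * f x) = a * \int[mu]_x f x)%R.
Proof. exact: RintegralZl. Qed.

Lemma RintZr a f : rintegrable f ->
  (\int[mu]_x (f x * a) = (\int[mu]_x f x) * a)%R.
Proof. exact: RintegralZr. Qed.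

Lemma RintN f : rintegrable f -> (\int[mu]_x (- f x) = - \int[mu]_x f x)%R.
Proof.
move=> If; rewrite -[RHS]mulN1r -RintZl//.
by apply: eq_Rintegral => x _; rewrite mulN1r.
Qed.

Lemma Rint_le f g : rintegrable f -> rintegrable g -> (forall x, f x <= g x) ->
  (\int[mu]_x f x <= \int[mu]_x g x)%R.
Proof. by move=> If Ig fg; apply: le_Rintegral. Qed.

Lemma Rint_norm f : rintegrable f ->
  (`|\int[mu]_x f x| <= \int[mu]_x `|f x|)%R.
Proof. exact: le_normr_Rintegral. Qed.

Lemma Rint_ge0 f : (forall x, 0 <= f x) -> (0 <= \int[mu]_x f x)%R.
Proof. by move=> f0; apply: Rintegral_ge0. Qed.

Lemma rintegrable_sum (I : Type) (s : seq I) (F : I -> T -> R) :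
  (forall i, rintegrable (F i)) -> rintegrable (fun x => \sum_(i <- s) F i x).
Proof.
move=> IF; elim: s => [|i s IH].
  by under [X in rintegrable X]funext do rewrite big_nil; exact: rintegrable0.
by under [X in rintegrable X]funext do rewrite big_cons; exact: rintegrableD.
Qed.

Lemma Rint_sum (I : Type) (s : seq I) (F : I -> T -> R) :
  (forall i, rintegrable (F i)) ->
  (\int[mu]_x (\sum_(i <- s) F i x) = \sum_(i <- s) \int[mu]_x F i x)%R.
Proof.
move=> IF; elim: s => [|i s IH].
  rewrite big_nil; under eq_Rintegral do rewrite big_nil.
  by rewrite Rintegral_cst// mul0r.
rewrite big_cons -IH -RintD//; last exact: rintegrable_sum.
by apply: eq_Rintegral => x _; rewrite big_cons.
Qed.

Lemma EFin_Rint f : rintegrable f ->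
  (\int[mu]_x f x)%R%:E = (\int[mu]_x (f x)%:E)%E.
Proof.
by move=> If; rewrite /Rintegral fineK//; exact: integrable_fin_num.
Qed.

Lemma Rint_dct (f_ : nat -> T -> R) f g :
  (forall n, measurable_fun setT (f_ n)) ->
  (forall x, f_ n x @[n --> \oo] --> f x) -> rintegrable g ->
  (forall n x, `|f_ n x| <= g x) ->
  rintegrable f /\ (\int[mu]_x f_ n x)%R @[n --> \oo] --> (\int[mu]_x f x)%R.
Proof.
move=> mf cf Ig bf.
have mff : measurable_fun setT f.
  by apply: (@measurable_fun_cvg _ _ _ _ f_) => // x _; exact: cf.
have [| | | | |If _ cvg] := @dominated_convergence _ _ _ mu setT measurableT
    (fun n => EFin \o f_ n) (EFin \o f) (EFin \o g).
- by move=> n; exact/measurable_EFinP.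
- exact/measurable_EFinP.
- by apply/aeW => x _; apply: cvg_EFin; [exact: nearW|exact: cf].
- exact: Ig.
- by apply/aeW => x n _; rewrite lee_fin.
by split=> //; apply: fine_cvg; rewrite EFin_Rint.
Qed.

End real_integrals.

Section complex_integrals.
Context d (T : measurableType d) (R : realType) (mu : {measure set T -> \bar R}).
Implicit Types f g h : T -> R[i].

Definition cmeas f : Prop :=
  measurable_fun setT (fun x => Re (f x)) /\
  measurable_fun setT (fun x => Im (f x)).

Definition cintegrable f : Prop :=
  rintegrable mu (fun x => Re (f x)) /\ rintegrable mu (fun x => Im (f x)).

Definition cint f : R[i] :=
  ((\int[mu]_x Re (f x))%R +i* (\int[mu]_x Im (f x))%R)%C.

Lemma eq_cmeas f g : f =1 g -> cmeas f -> cmeas g.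
Proof. by move=> /funext ->. Qed.

Lemma cmeas_normc f : cmeas f -> measurable_fun setT (fun x => normc (f x)).
Proof.
move=> [mr mi]; under [X in measurable_fun _ X]funext do rewrite normcE.
apply: (@measurableT_comp _ _ _ _ _ _ (@Num.sqrt R)).
  exact: (continuous_measurable_fun (@sqrt_continuous R)).
by apply: measurable_funD; exact: measurable_funX.
Qed.

Lemma cmeas_cst c : cmeas (fun=> c).
Proof. by split; exact: measurable_cst. Qed.

Lemma cmeasM f g : cmeas f -> cmeas g -> cmeas (fun x => f x * g x).
Proof.
move=> [mfr mfi] [mgr mgi]; split.
  under [X in measurable_fun _ X]funext do rewrite ReM.
  by apply: measurable_funB; exact: measurable_funM.
under [X in measurable_fun _ X]funext do rewrite ImM.
by apply: measurable_funD; exact: measurable_funM.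
Qed.

Lemma cmeasD f g : cmeas f -> cmeas g -> cmeas (fun x => f x + g x).
Proof.
move=> [mfr mfi] [mgr mgi]; split.
  by under [X in measurable_fun _ X]funext do rewrite ReD; exact: measurable_funD.
by under [X in measurable_fun _ X]funext do rewrite ImD; exact: measurable_funD.
Qed.

Lemma cmeasN f : cmeas f -> cmeas (fun x => - f x).
Proof.
move=> [mr mi]; split.
  under [X in measurable_fun _ X]funext do rewrite ReN.
  exact: measurableT_comp.
under [X in measurable_fun _ X]funext do rewrite ImN.
exact: measurableT_comp.
Qed.

Lemma cmeasB f g : cmeas f -> cmeas g -> cmeas (fun x => f x - g x).
Proof. by move=> mf mg; apply: cmeasD => //; exact: cmeasN. Qed.

Lemma cmeas_conj f : cmeas f -> cmeas (fun x => (f x)^*%C).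
Proof.
move=> [mr mi]; split; first by under [X in measurable_fun _ X]funext do rewrite ReJ.
under [X in measurable_fun _ X]funext do rewrite ImJ.
exact: measurableT_comp.
Qed.

Lemma cmeas_real (u : T -> R) : measurable_fun setT u -> cmeas (fun x => (u x)%:C%C).
Proof. by move=> mu'; split. Qed.

Lemma cmeas_comp d' (T' : measurableType d') (u : T' -> T) f : cmeas f ->
  measurable_fun setT u ->
  measurable_fun setT (fun x => Re (f (u x))) /\
  measurable_fun setT (fun x => Im (f (u x))).
Proof.
move=> [mr mi] mu'; split.
  exact: (measurableT_comp (f := fun x => Re (f x))).
exact: (measurableT_comp (f := fun x => Im (f x))).
Qed.

Lemma cintegrable_meas f : cintegrable f -> cmeas f.
Proof. by move=> [/rintegrable_measurable ? /rintegrable_measurable ?]. Qed.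

Lemma cintegrable_normc f : cintegrable f -> rintegrable mu (fun x => normc (f x)).
Proof.
move=> If; have [mr mi] := cintegrable_meas If.
case: If => /rintegrable_norm Ir /rintegrable_norm Ii.
apply: rintegrable_le (rintegrableD Ir Ii); first exact: cmeas_normc.
by move=> x; rewrite ger0_norm ?normc_ge0// normc_le.
Qed.

Lemma cintegrable_le f (u : T -> R) : cmeas f -> (forall x, normc (f x) <= u x) ->
  rintegrable mu u -> cintegrable f.
Proof.
move=> [mr mi] fu Iu; split; apply: rintegrable_le Iu => // x.
  exact: le_trans (Re_le_normc _) _.
exact: le_trans (Im_le_normc _) _.
Qed.

Lemma cintegrableP f : cmeas f -> (\int[mu]_x (normc (f x))%:E < +oo)%E -> cintegrable f.
Proof.
move=> mf lf; apply: (@cintegrable_le f (fun x => normc (f x))) => //.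
apply/rintegrableP; split; first exact: cmeas_normc.
by under eq_integral do rewrite ger0_norm ?normc_ge0//.
Qed.

Lemma cintegrable_lty f : cintegrable f -> (\int[mu]_x (normc (f x))%:E < +oo)%E.
Proof.
move/cintegrable_normc/rintegrableP => [_].
by under eq_integral do rewrite ger0_norm ?normc_ge0//.
Qed.

Lemma cintegrableMl B f h : cintegrable f -> cmeas h ->
  (forall x, normc (h x) <= B) -> cintegrable (fun x => f x * h x).
Proof.
move=> If mh hB; apply: (@cintegrable_le _ (fun x => normc (f x) * B)).
- by apply: cmeasM => //; exact: cintegrable_meas.
- by move=> x; rewrite normcM ler_wpM2l// normc_ge0.
- by apply: rintegrableZr; exact: cintegrable_normc.
Qed.

Lemma cintegrableMr B f h : cintegrable f -> cmeas h ->
  (forall x, normc (h x) <= B) -> cintegrable (fun x => h x * f x).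
Proof.
move=> If mh hB; under [X in cintegrable X]funext do rewrite mulrC.
exact: cintegrableMl If mh hB.
Qed.

Lemma cintegrableZ c f : cintegrable f -> cintegrable (fun x => c * f x).
Proof.
by move=> If; apply: (cintegrableMr If (cmeas_cst c)) => _.
Qed.

Lemma cintegrableD f g : cintegrable f -> cintegrable g -> cintegrable (fun x => f x + g x).
Proof.
move=> [fr fi] [gr gi]; split.
  by under [X in rintegrable _ X]funext do rewrite ReD; exact: rintegrableD.
by under [X in rintegrable _ X]funext do rewrite ImD; exact: rintegrableD.
Qed.

Lemma cintegrableB f g : cintegrable f -> cintegrable g -> cintegrable (fun x => f x - g x).
Proof.
move=> If Ig; apply: cintegrableD => //.
by under [X in cintegrable X]funext do rewrite -mulN1r; exact: cintegrableZ.
Qed.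

Lemma cintegrable_conj f : cintegrable f -> cintegrable (fun x => (f x)^*%C).
Proof.
move=> [fr fi]; split; first by under [X in rintegrable _ X]funext do rewrite ReJ.
by under [X in rintegrable _ X]funext do rewrite ImJ; exact: rintegrableN.
Qed.

Lemma cintegrable_real (u : T -> R) : rintegrable mu u -> cintegrable (fun x => (u x)%:C%C).
Proof. by move=> Iu; split => //=; exact: rintegrable0. Qed.

Lemma eq_cintegrable f g : f =1 g -> cintegrable f -> cintegrable g.
Proof. by move=> /funext ->. Qed.

Lemma eq_cint f g : f =1 g -> cint f = cint g.
Proof. by move=> /funext ->. Qed.

Lemma cintD f g : cintegrable f -> cintegrable g ->
  cint (fun x => f x + g x) = cint f + cint g.
Proof.
move=> [fr fi] [gr gi]; apply: complex_eqP; rewrite ?ReD ?ImD /= -RintD//;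
  by apply: eq_Rintegral => x _; rewrite ?ReD ?ImD.
Qed.

Lemma cintZ c f : cintegrable f -> cint (fun x => c * f x) = c * cint f.
Proof.
move=> [fr fi]; apply: complex_eqP.
  rewrite ReM /= -!RintZl// -RintB; [|exact: rintegrableZl..].
  by apply: eq_Rintegral => x _; rewrite ReM.
rewrite ImM /= -!RintZl// -RintD; [|exact: rintegrableZl..].
by apply: eq_Rintegral => x _; rewrite ImM.
Qed.

Lemma cintZr c f : cintegrable f -> cint (fun x => f x * c) = cint f * c.
Proof. by move=> If; rewrite mulrC -cintZ//; apply: eq_cint => x; rewrite mulrC. Qed.

Lemma cintB f g : cintegrable f -> cintegrable g ->
  cint (fun x => f x - g x) = cint f - cint g.
Proof.
move=> If Ig; rewrite -mulN1r -cintZ// -cintD//; last exact: cintegrableZ.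
by apply: eq_cint => x; rewrite mulN1r.
Qed.

Lemma cint_conj f : cintegrable f -> cint (fun x => (f x)^*%C) = ((cint f)^*)%C.
Proof.
move=> [fr fi]; apply: complex_eqP; rewrite ?ReJ ?ImJ/=.
  by apply: eq_Rintegral => x _; rewrite ReJ.
by rewrite -RintN//; apply: eq_Rintegral => x _; rewrite ImJ.
Qed.

Lemma cint_real (u : T -> R) : cint (fun x => (u x)%:C%C) = ((\int[mu]_x u x)%R)%:C%C.
Proof. by apply: complex_eqP => //=; rewrite Rintegral_cst// mul0r. Qed.

(** Multiplying [f] by the conjugate of its integral z turns |z|^2 into the real integral of
    Re(conj(z) f), which is at most |z| times the integral of |f|. The case z = 0 is apart because
    |z| is then cancelled. *)
Lemma normc_cint_le f : cintegrable f -> normc (cint f) <= (\int[mu]_x normc (f x))%R.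
Proof.
move=> If; set z := cint f.
have In := cintegrable_normc If.
have [->|z0] := eqVneq (normc z) 0; first by apply: Rint_ge0 => x; exact: normc_ge0.
have zp : 0 < normc z by rewrite lt_neqAle eq_sym z0 normc_ge0.
rewrite -(ler_pM2l zp) -RintZl// -expr2.
have -> : normc z ^+ 2 = Re (cint (fun x => (z^*)%C * f x)).
  by rewrite cintZ// mulrC mulc_conj.
have Iz : cintegrable (fun x => (z^*)%C * f x) by exact: cintegrableZ.
apply: Rint_le; [by case: Iz|exact: rintegrableZl|move=> x].
by rewrite (le_trans (ler_norm _))// (le_trans (Re_le_normc _))// normcM normc_conj.
Qed.

Lemma cint_dct (f_ : nat -> T -> R[i]) f (g : T -> R) :
  (forall n, cmeas (f_ n)) ->
  (forall x, Re (f_ n x) @[n --> \oo] --> Re (f x)) ->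
  (forall x, Im (f_ n x) @[n --> \oo] --> Im (f x)) ->
  rintegrable mu g -> (forall n x, normc (f_ n x) <= g x) ->
  [/\ cintegrable f, Re (cint (f_ n)) @[n --> \oo] --> Re (cint f) &
     Im (cint (f_ n)) @[n --> \oo] --> Im (cint f)].
Proof.
move=> mf cr ci Ig fg.
have [|Ir cIr] := Rint_dct (fun n => (mf n).1) cr Ig.
  by move=> n x; exact: le_trans (Re_le_normc _) _.
have [|Ii cIi] := Rint_dct (fun n => (mf n).2) ci Ig.
  by move=> n x; exact: le_trans (Im_le_normc _) _.
by [].
Qed.

End complex_integrals.

(** * Fubini's theorem for real and complex integrals *)

Section fubini.
Context d1 d2 (T1 : measurableType d1) (T2 : measurableType d2) (R : realType).
Variables (m1 : {sigma_finite_measure set T1 -> \bar R})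
  (m2 : {sigma_finite_measure set T2 -> \bar R}).

(** Since every section is integrable, and not only almost every one, the real inner integrals agree
    with the extended ones at each point, and Fubini's theorem transfers without exceptional
    sets. *)
Lemma Rint_fubini (f : T1 * T2 -> R) : measurable_fun setT f ->
  (\int[m1]_x \int[m2]_y `|f (x, y)|%:E < +oo)%E ->
  (forall x, rintegrable m2 (fun y => f (x, y))) ->
  (forall y, rintegrable m1 (fun x => f (x, y))) ->
  rintegrable m1 (fun x => \int[m2]_y f (x, y))%R /\
  (\int[m1]_x \int[m2]_y f (x, y) = \int[m2]_y \int[m1]_x f (x, y))%R.
Proof.
move=> mf lf If2 If1.
have If : (m1 \x m2)%E.-integrable setT (EFin \o f).
  by apply/integrable12ltyP => //; exact/measurable_EFinP.
have I1 := integrable_fubini_F If.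
have E1 : (fun x => (\int[m2]_y f (x, y))%R%:E) = (fun x => (\int[m2]_y (f (x, y))%:E)%E).
  by apply/funext => x; rewrite EFin_Rint.
have E2 : (fun y => (\int[m1]_x f (x, y))%R%:E) = (fun y => (\int[m1]_x (f (x, y))%:E)%E).
  by apply/funext => x; rewrite EFin_Rint.
split; first by rewrite /rintegrable /comp E1.
by congr fine; rewrite E1 E2; exact: (Fubini If).
Qed.

Lemma cint_fubini (f : T1 * T2 -> R[i]) : cmeas f ->
  (\int[m1]_x \int[m2]_y (normc (f (x, y)))%:E < +oo)%E ->
  (forall x, cintegrable m2 (fun y => f (x, y))) ->
  (forall y, cintegrable m1 (fun x => f (x, y))) ->
  cintegrable m1 (fun x => cint m2 (fun y => f (x, y))) /\
  cint m1 (fun x => cint m2 (fun y => f (x, y))) =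
  cint m2 (fun y => cint m1 (fun x => f (x, y))).
Proof.
move=> [mr mi] lf I2 I1.
have le (u : T1 * T2 -> R) : measurable_fun setT u -> (forall p, `|u p| <= normc (f p)) ->
    (\int[m1]_x \int[m2]_y `|u (x, y)|%:E < +oo)%E.
  move=> mu uf; apply: le_lt_trans lf; apply: ge0_le_integral => //.
  - by move=> x _; apply: integral_ge0.
  - apply: (@measurable_fun_fubini_tonelli_F _ _ _ _ _ m2 (fun p => `|u p|%:E)) => //.
    by apply/measurable_EFinP; exact: measurableT_comp.
  - apply: (@measurable_fun_fubini_tonelli_F _ _ _ _ _ m2 (fun p => (normc (f p))%:E)) => //.
      by apply/measurable_EFinP; apply: cmeas_normc.
    by move=> p; rewrite lee_fin normc_ge0.
  - move=> x _; apply: ge0_le_integral => //.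
    + apply/measurable_EFinP; apply: measurableT_comp => //.
      exact: measurableT_comp.
    + apply/measurable_EFinP; apply: cmeas_normc; exact: cintegrable_meas (I2 x).
    + by move=> y _; rewrite lee_fin.
have [Ir Er] := Rint_fubini mr (le _ mr (fun p => Re_le_normc _))
  (fun x => (I2 x).1) (fun x => (I1 x).1).
have [Ii Ei] := Rint_fubini mi (le _ mi (fun p => Im_le_normc _))
  (fun x => (I2 x).2) (fun x => (I1 x).2).
by split=> //; apply: complex_eqP.
Qed.

(** No integrability is assumed: Tonelli's theorem handles the positive and negative parts, and
    [fine] is measurable. *)
Lemma measurable_Rint (f : T1 * T2 -> R) : measurable_fun setT f ->
  measurable_fun setT (fun x => \int[m2]_y f (x, y))%R.
Proof.
move=> mf; apply: (@measurableT_comp _ _ _ _ _ _ (@fine R)) => //.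
under [X in measurable_fun _ X]funext do rewrite integralE.
have mfE : measurable_fun setT (EFin \o f) by exact/measurable_EFinP.
have mp := measurable_fun_fubini_tonelli_F (m2 := m2) _ (measurable_funepos mfE)
  (funepos_ge0 _).
have mn := measurable_fun_fubini_tonelli_F (m2 := m2) _ (measurable_funeneg mfE)
  (funeneg_ge0 _).
apply: emeasurable_funB; [apply: eq_measurable_fun mp|apply: eq_measurable_fun mn];
  by move=> x _; apply: eq_integral => y _; rewrite !(funeposE, funenegE).
Qed.

Lemma cmeas_cint (f : T1 * T2 -> R[i]) : cmeas f ->
  cmeas (fun x => cint m2 (fun y => f (x, y))).
Proof. by move=> [mr mi]; split; [exact: (measurable_Rint mr)|exact: (measurable_Rint mi)]. Qed.

(** The form of Fubini's theorem used for characters and kernels: one integrable density in each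
    variable and a bounded kernel, so that |w| B |k| dominates the integrand. *)
Lemma cint_exchange B (w : T1 -> R[i]) (k : T2 -> R[i]) (h : T1 * T2 -> R[i]) :
  cintegrable m1 w -> cintegrable m2 k -> cmeas h -> (forall p, normc (h p) <= B) ->
  cintegrable m1 (fun x => w x * cint m2 (fun y => h (x, y) * k y)) /\
  cint m1 (fun x => w x * cint m2 (fun y => h (x, y) * k y)) =
  cint m2 (fun y => cint m1 (fun x => w x * h (x, y)) * k y).
Proof.
move=> Iw Ik mh hB.
have mw := cintegrable_meas Iw; have mk := cintegrable_meas Ik.
have mh1 x : cmeas (fun y => h (x, y)) by apply: (cmeas_comp mh).
have mh2 y : cmeas (fun x => h (x, y)) by apply: (cmeas_comp mh).
have Ihk x : cintegrable m2 (fun y => h (x, y) * k y).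
  exact: (cintegrableMr (B := B)).
have Iwh y : cintegrable m1 (fun x => w x * h (x, y)).
  exact: (cintegrableMl (B := B)).
pose F p := w p.1 * (h p * k p.2).
have mF : cmeas F.
  apply: cmeasM; first exact: (cmeas_comp mw).
  by apply: cmeasM => //; exact: (cmeas_comp mk).
have -> : (fun x => w x * cint m2 (fun y => h (x, y) * k y)) =
    (fun x => cint m2 (fun y => F (x, y))).
  by apply/funext => x; rewrite -cintZ.
have -> : (fun y => cint m1 (fun x => w x * h (x, y)) * k y) =
    (fun y => cint m1 (fun x => F (x, y))).
  by apply/funext => y; rewrite -cintZr//; apply: eq_cint => x; rewrite /F/= mulrA.
have [nw nk] := (cintegrable_normc Iw, cintegrable_normc Ik).
apply: cint_fubini => //.
- apply: (@le_lt_trans _ _ (\int[m1]_x \int[m2]_y ((normc (w x))%:E * (B%:E * (normc (k y))%:E)))%E).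
    apply: ge0_le_integral => //.
    + by move=> x _; apply: integral_ge0 => y _; rewrite lee_fin normc_ge0.
    + apply: (@measurable_fun_fubini_tonelli_F _ _ _ _ _ m2 (fun p => (normc (F p))%:E)) => //.
        by apply/measurable_EFinP; apply: cmeas_normc.
      by move=> p; rewrite lee_fin normc_ge0.
    + apply: (@measurable_fun_fubini_tonelli_F _ _ _ _ _ m2
        (fun p => (normc (w p.1))%:E * (B%:E * (normc (k p.2))%:E))%E) => //.
        apply/measurable_EFinP; apply: measurable_funM.
          by apply: cmeas_normc; exact: (cmeas_comp mw).
        apply: measurable_funM => //.
        by apply: cmeas_normc; exact: (cmeas_comp mk).
      move=> p; rewrite -!EFinM lee_fin !mulr_ge0 ?normc_ge0// (le_trans _ (hB p)) ?normc_ge0//.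
    + move=> x _; apply: ge0_le_integral => //.
      * by move=> y _; rewrite lee_fin normc_ge0.
      * by apply/measurable_EFinP; apply: cmeas_normc; exact: (cmeas_comp mF).
      * apply/measurable_EFinP; apply: measurable_funM => //; apply: measurable_funM => //.
        exact: cmeas_normc.
      * move=> y _; rewrite -!EFinM lee_fin /F !normcM /= ler_wpM2l ?normc_ge0//.
        by rewrite ler_wpM2r ?normc_ge0.
  have I2 := rintegrableZl B nk.
  have E x : (\int[m2]_y ((normc (w x))%:E * (B%:E * (normc (k y))%:E)))%E =
      (normc (w x) * (\int[m2]_y (B * normc (k y)))%R)%:E.
    by rewrite -RintZl// EFin_Rint//; exact: rintegrableZl.
  under eq_integral do rewrite E.
  have I1 := rintegrableZr (\int[m2]_y (B * normc (k y)))%R nw.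
  by rewrite -EFin_Rint// ltry.
- by move=> x; rewrite /F /=; exact: cintegrableZ.
- move=> y; rewrite /F /=; under [X in cintegrable _ X]funext do rewrite mulrA.
  by under [X in cintegrable _ X]funext do rewrite mulrC; exact: cintegrableZ.
Qed.

End fubini.

(** * Sums as integrals for the counting measure *)

HB.instance Definition _ := Countable.on nat.

(* [T] with all its subsets measurable; sums over [T] become integrals. *)
Definition discrete (T : Type) := T.

HB.instance Definition _ (T : countNmodType) := Countable.on (discrete T).
HB.instance Definition _ (T : countNmodType) := isPointed.Build (discrete T) (0 : T).
HB.instance Definition _ (T : countNmodType) :=
  @isMeasurable.Build default_measure_display (discrete T) discrete_measurable
    discrete_measurable0 discrete_measurableC discrete_measurableU.

Section counting.
Context (T : countNmodType) (R : realType).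
Local Notation dT := (discrete T).

Let fiber n : set dT := [set k | pickle k = n].

Let fiberE n : fiber n = set0 \/ exists k, fiber n = [set k].
Proof.
have [[k kn]|nk] := pselect (exists k : dT, pickle k = n).
  right; exists k; apply/seteqP; split => [l ln|l /= ->//].
  by apply: (pcan_inj (@pickleK T)); rewrite kn.
by left; apply/seteqP; split => // k /= kn; apply: nk; exists k.
Qed.

Let bigcup_fiber : \bigcup_n fiber n = [set: dT].
Proof. by apply/seteqP; split => // k _; exists (pickle k). Qed.

Lemma measurable_fun_discrete d (Y : measurableType d) (f : dT -> Y) :
  measurable_fun setT f.
Proof. by []. Qed.

Lemma sigma_finite_counting_discrete : sigma_finite [set: dT] (@counting dT R).
Proof.
exists fiber => // n; split => //; have [->|[k ->]] := fiberE n.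
  by rewrite measure0.
by rewrite /counting asboolT// ltry.
Qed.

(** A new name for the counting measure, to carry the sigma-finite structure that Fubini's theorem
    requires of both factors. *)
Definition counting_discrete : set dT -> \bar R := @counting dT R.

HB.instance Definition _ := isMeasure.Build _ _ _ counting_discrete
  (measure0 (@counting dT R)) (measure_ge0 (@counting dT R))
  (@measure_semi_sigma_additive _ _ _ (@counting dT R)).

HB.instance Definition _ := @Measure_isSigmaFinite.Build _ _ _ counting_discrete
  sigma_finite_counting_discrete.

Definition cnt : {sigma_finite_measure set dT -> \bar R} := counting_discrete.

(** The fibers of [pickle] are empty or singletons and cover the type, so the integral becomes a
    series over codes in which each nonempty fiber contributes one value. *)
Lemma integral_cnt (f : dT -> \bar R) : (forall k, 0 <= f k)%E ->
  (\int[cnt]_k f k = \esum_(k in [set: T]) f k)%E.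
Proof.
move=> f0; rewrite -{1}bigcup_fiber ge0_integral_bigcup//; last first.
  by apply/trivIsetP => i j _ _ ij; apply/seteqP; split => // k [/= ki kj]; move: ij; rewrite -ki -kj eqxx.
have tF : trivIset setT fiber.
  by apply/trivIsetP => i j _ _ ij; apply/seteqP; split => // k [/= ki kj]; move: ij; rewrite -ki -kj eqxx.
rewrite -[X in \esum_(k in X) _]bigcup_fiber nneseries_sum_bigcup//.
apply: eq_eseriesr => n _; have [->|[k ->]] := fiberE n.
  by rewrite integral_set0 esum_set0.
rewrite esum_set1// (@eq_integral _ _ _ _ _ (cst (f k))); last first.
  by move=> x; rewrite inE /= => ->.
rewrite integral_cst//= /counting_discrete /counting asboolT// fset_set1 finmap.cardfs1 mule1//.
Qed.

(** The first factor is countable, so a preimage is a countable union of products of a point with a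
    measurable set. *)
Lemma cnt_fubini_measurable d (Y : measurableType d) d' (Z : measurableType d')
    (h : dT * Y -> Z) :
  (forall k, measurable_fun setT (fun y => h (k, y))) -> measurable_fun setT h.
Proof.
move=> mh _ B mB; rewrite setTI.
have -> : h @^-1` B = \bigcup_n (\bigcup_(k in fiber n) ([set k] `*` ((fun y => h (k, y)) @^-1` B))).
  apply/seteqP; split => [[k y] Bh|[k y] [n _ [l _ [/= -> //]]]].
  by exists (pickle k) => //; exists k.
apply: bigcup_measurable => n _; have [->|[k ->]] := fiberE n.
  by rewrite bigcup_set0.
rewrite bigcup_set1; apply: measurableX => //.
by have := mh k measurableT _ mB; rewrite setTI.
Qed.

Lemma cnt_fubini_measurable2 d (Y : measurableType d) d' (Z : measurableType d')
    (h : Y * dT -> Z) :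
  (forall k, measurable_fun setT (fun y => h (y, k))) -> measurable_fun setT h.
Proof.
move=> mh; pose g (p : dT * Y) := h (p.2, p.1).
have -> : h = g \o (fun p => (p.2, p.1)) by apply/funext => -[].
apply: measurableT_comp; first by apply: cnt_fubini_measurable.
by apply/measurable_fun_pair; [exact: measurable_snd|exact: measurable_fst].
Qed.

Lemma rintegrable_cntP (f : dT -> R) :
  rintegrable cnt f <-> (\esum_(k in [set: T]) `|f k|%:E < +oo)%E.
Proof.
by rewrite rintegrableP integral_cnt//; split => [[]|] //.
Qed.

Lemma Rint_cnt (f : dT -> R) : rintegrable cnt f ->
  (\int[cnt]_k f k)%R = rsum [set: T] f.
Proof.
move=> If; rewrite /Rintegral integralE fineB.
- by rewrite !integral_cnt.
- exact: integrable_pos_fin_num.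
- exact: integrable_neg_fin_num.
Qed.

Lemma rsum_mkcond (D : set T) (f : T -> R) :
  rsum D f = rsum [set: T] (fun k => if k \in D then f k else 0).
Proof.
rewrite /rsum !(esum_mkcond D); congr (fine _ - fine _); apply: eq_esum => k _.
  by rewrite !funeposE /=; case: ifP => //; rewrite maxxx.
by rewrite !funenegE /=; case: ifP => //; rewrite oppr0 maxxx.
Qed.

Lemma rsum_Rint (D : set T) (f : T -> R) :
  rintegrable cnt (fun k => if k \in D then f k else 0) ->
  rsum D f = (\int[cnt]_k (if k \in D then f k else 0))%R.
Proof. by move=> If; rewrite rsum_mkcond Rint_cnt. Qed.

Lemma csum_cint (D : set T) (f : T -> R[i]) :
  cintegrable cnt (fun k => if k \in D then f k else 0) ->
  csum D f = cint cnt (fun k => if k \in D then f k else 0).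
Proof.
have E (k : T) : (Re (if k \in D then f k else 0) = if k \in D then Re (f k) else 0) *
  (Im (if k \in D then f k else 0) = if k \in D then Im (f k) else 0) by case: ifP.
move=> [Ir Ii]; apply: complex_eqP => /=.
  rewrite rsum_Rint; first by apply: eq_Rintegral => k _; rewrite E.
  by under [X in rintegrable _ X]funext do rewrite -(E _).1.
rewrite rsum_Rint; first by apply: eq_Rintegral => k _; rewrite E.
by under [X in rintegrable _ X]funext do rewrite -(E _).2.
Qed.

(** The way back to the sums of the statement: integrability for the counting measure is the
    absolute convergence that [has_csum] asks for, and restricting [f] to [D] changes nothing. *)
Lemma has_csum_cint (D : set T) (f : T -> R[i]) (s : R[i]) :
  cintegrable cnt f -> (forall k, ~ D k -> f k = 0) -> cint cnt f = s ->
  has_csum D f s.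
Proof.
move=> If f0 <-.
have E : (fun k => if k \in D then f k else 0) = f.
  by apply/funext => k; case: ifPn => // /negP kD; rewrite f0// => /mem_set.
split; last by rewrite csum_cint E.
have := cintegrable_lty If; rewrite integral_cnt; last first.
  by move=> k; rewrite lee_fin normc_ge0.
apply: le_lt_trans; rewrite (esum_mkcond D); apply: le_esum => k _.
by case: ifP => // _; rewrite lee_fin normc_ge0.
Qed.

Lemma Rint_cnt_term (f : dT -> R) k : rintegrable cnt f ->
  `|f k| <= (\int[cnt]_k `|f k|)%R.
Proof.
move=> If; have In := rintegrable_norm If.
rewrite -lee_fin EFin_Rint// integral_cnt//.
by rewrite (esumID [set k])// setTI esum_set1// leeDl// esum_ge0.
Qed.

Lemma rintegrable_indic1 (k : dT) (a : R) :
  rintegrable cnt (fun l => if l == k then a else 0).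
Proof.
apply/rintegrable_cntP.
rewrite (esumID [set k])// setTI esum_set1// eqxx esum1 ?adde0 ?ltry//.
by move=> l [_ /= /eqP/negbTE ->]; rewrite normr0.
Qed.

Lemma Rint_indic1 (k : dT) (a : R) :
  (\int[cnt]_l (if l == k then a else 0))%R = a.
Proof.
have H (b : R) : 0 <= b -> (\int[cnt]_l (if l == k then b else 0))%R = b.
  move=> b0; have := rintegrable_indic1 k b; move=> If.
  apply: EFin_inj; rewrite EFin_Rint// integral_cnt; last first.
    by move=> l; case: ifP.
  rewrite (esumID [set k]); last by move=> l _; case: ifP.
  rewrite setTI esum_set1 eqxx// esum1 ?adde0// => l [_ /= /eqP/negbTE ->//].
have [a0|a0] := leP 0 a; first exact: H.
rewrite -[RHS]opprK -(H (- a)) ?oppr_ge0 ?ltW//.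
rewrite -RintN; last exact: rintegrable_indic1.
by apply: eq_Rintegral => l _; case: ifP; rewrite ?opprK ?oppr0.
Qed.

Lemma rintegrable_finsupp (s : seq T) (f : dT -> R) :
  (forall k, k \notin s -> f k = 0) -> rintegrable cnt f.
Proof.
elim: s f => [|k s IH] f fs.
  have -> : f = fun=> 0 by apply/funext => k; rewrite fs.
  exact: rintegrable0.
have -> : f = fun l => (if l == k then f k else 0) + (if l == k then 0 else f l).
  by apply/funext => l; case: eqP => [->|]; rewrite ?addr0 ?add0r.
apply: rintegrableD; first exact: rintegrable_indic1.
apply: IH => l ls; case: eqP => // /eqP lk.
by apply: fs; rewrite in_cons negb_or lk.
Qed.

Lemma Rint_finsupp (s : seq T) (f : dT -> R) : uniq s ->
  (forall k, k \notin s -> f k = 0) -> (\int[cnt]_k f k)%R = \sum_(k <- s) f k.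
Proof.
elim: s f => [|k s IH] f us fs.
  rewrite big_nil; under eq_Rintegral => l _ do rewrite fs//.
  by rewrite Rintegral_cst// mul0r.
have {1}-> : f = fun l => (if l == k then f k else 0) + (if l == k then 0 else f l).
  by apply/funext => l; case: eqP => [->|]; rewrite ?addr0 ?add0r.
move: us => /= /andP[ks us].
have fs' l : l \notin s -> (if l == k then 0 else f l) = 0.
  by move=> ls; case: eqP => // /eqP lk; apply: fs; rewrite in_cons negb_or lk.
rewrite RintD; [|exact: rintegrable_indic1|exact: rintegrable_finsupp fs'].
rewrite Rint_indic1 IH// big_cons; congr (_ + _).
by apply: eq_big_seq => l ls; case: eqP => // lk; rewrite -lk ls in ks.
Qed.

Lemma rintegrable_reindex (e : T -> T) (f : dT -> R) : bijective e ->
  rintegrable cnt f -> rintegrable cnt (fun k => f (e k)).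
Proof.
move=> be /rintegrable_cntP lf; apply/rintegrable_cntP.
rewrite -(@reindex_esum _ _ _ setT setT e (fun k => `|f k|%:E))//.
by rewrite setTT_bijective.
Qed.

Lemma Rint_reindex (e : T -> T) (f : dT -> R) : bijective e ->
  rintegrable cnt f -> (\int[cnt]_k f (e k) = \int[cnt]_k f k)%R.
Proof.
move=> be If; rewrite !Rint_cnt//; last exact: rintegrable_reindex.
have bs : set_bij setT setT e by rewrite setTT_bijective.
rewrite /rsum (@reindex_esum _ _ _ setT setT e (EFin \o f)^\+%E bs).
rewrite (@reindex_esum _ _ _ setT setT e (EFin \o f)^\-%E bs).
by congr (fine _ - fine _); apply: eq_esum => k _; rewrite ?funeposE ?funenegE.
Qed.

Lemma cintegrable_reindex (e : T -> T) (f : dT -> R[i]) : bijective e ->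
  cintegrable cnt f -> cintegrable cnt (fun k => f (e k)).
Proof.
move=> be [Ir Ii].
split; [exact: (rintegrable_reindex be Ir)|exact: (rintegrable_reindex be Ii)].
Qed.

Lemma cint_reindex (e : T -> T) (f : dT -> R[i]) : bijective e ->
  cintegrable cnt f -> cint cnt (fun k => f (e k)) = cint cnt f.
Proof.
move=> be [Ir Ii]; apply: complex_eqP;
  [exact: (Rint_reindex be Ir)|exact: (Rint_reindex be Ii)].
Qed.

End counting.

(** * Invariance of Lebesgue measure *)

Section measure_preserving.
Context d (T : measurableType d) (R : realType) (mu : {measure set T -> \bar R}).

(** Stated with integrals of nonnegative functions instead of preimages, because the induction on
    the dimension substitutes inside iterated integrals. *)
Definition measure_preserving (u : T -> T) : Prop :=
  measurable_fun setT u /\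
  forall F : T -> \bar R, measurable_fun setT F -> (forall x, 0 <= F x)%E ->
    (\int[mu]_x F (u x) = \int[mu]_x F x)%E.

Variables (u : T -> T) (pu : measure_preserving u).

Lemma rintegrable_preserving (f : T -> R) :
  rintegrable mu f -> rintegrable mu (fun x => f (u x)).
Proof.
move=> /rintegrableP[mf lf]; apply/rintegrableP; split.
  exact: (measurableT_comp mf pu.1).
rewrite (pu.2 (fun x => `|f x|%:E))//.
by apply/measurable_EFinP; exact: measurableT_comp.
Qed.

Lemma Rint_preserving (f : T -> R) : measurable_fun setT f ->
  (\int[mu]_x f (u x) = \int[mu]_x f x)%R.
Proof.
move=> mf; congr fine; rewrite integralE [RHS]integralE.
have mfE : measurable_fun setT (EFin \o f) by exact/measurable_EFinP.
have := pu.2 _ (measurable_funepos mfE) (funepos_ge0 _).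
have := pu.2 _ (measurable_funeneg mfE) (funeneg_ge0 _).
move=> <- <-; congr (_ - _)%E; apply: eq_integral => x _.
  by rewrite !funeposE.
by rewrite !funenegE.
Qed.

Lemma cint_preserving (f : T -> R[i]) : cmeas f ->
  cint mu (fun x => f (u x)) = cint mu f.
Proof.
by move=> [mr mi]; apply: complex_eqP; [exact: (Rint_preserving mr)|exact: (Rint_preserving mi)].
Qed.

End measure_preserving.

Section euclidean.
Context {R : realType}.
Local Notation leb := (@lebesgue_measure R).

(** The maps x -> s x + v with such [s] comprise the translations and the point reflections x -> v -
    x. *)
Definition is_sign (s : R) : Prop := s = 1 \/ s = -1.

(** The image of Lebesgue measure agrees with it on the intervals []a, b]], which determine it. For
    sign -1 the preimage is closed on the left instead of the right, and has the same length. *)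
Lemma lebesgue_preserving (s v : R) : is_sign s ->
  measure_preserving leb (fun x : measurableTypeR R => s * x + v).
Proof.
move=> hs; pose u (x : measurableTypeR R) : measurableTypeR R := s * x + v.
have mu' : measurable_fun setT u.
  by apply: measurable_funD => //; exact: measurable_funM.
split=> // F mF F0.
have H (A : set (measurableTypeR R)) : measurable A -> leb A = pushforward leb u A.
  apply: (@lebesgue_measure_unique R
    (measure_function_pushforward__canonical__measure_function_Measure leb mu')).
  move=> _ [[a b] _ <-] /=; rewrite /pushforward.
  case: hs => hs.
    have -> : u @^-1` `]a, b] = `](a - v), (b - v)]%classic.
      apply/seteqP; split => x; rewrite /u /= !in_itv/= hs mul1r; lra.
    rewrite !lebesgue_measure_itv/= !lte_fin ltrD2r.
    by case: ifP => // _; rewrite -!EFinB; congr EFin; lra.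
  have -> : u @^-1` `]a, b] = `[(v - b), (v - a)[%classic.
    apply/seteqP; split => x; rewrite /u /= !in_itv/= hs mulN1r; lra.
  rewrite !lebesgue_measure_itv/= !lte_fin ltrD2l ltrN2.
  by case: ifP => // _; rewrite -!EFinB; congr EFin; lra.
rewrite -(@ge0_integral_pushforward _ _ _ _ _ u mu' leb setT F)//.
apply/esym; apply: (eq_measure_integral
  (measure_function_pushforward__canonical__measure_function_Measure leb mu')).
by move=> A mA _; exact: H.
Qed.

Lemma rV_cons0 n (a : R) (y : 'rV[R]_n) : rV_cons (a, y) ord0 ord0 = a.
Proof.
have -> : ord0 = lshift n (@ord0 0) :> 'I_(1 + n) by apply/val_inj.
by rewrite /rV_cons (row_mxEl a%:M) mxE eqxx.
Qed.

Lemma rV_consS n (a : R) (y : 'rV[R]_n) i : rV_cons (a, y) ord0 (lift ord0 i) = y ord0 i.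
Proof.
have -> : lift ord0 i = rshift 1 i :> 'I_(1 + n) by apply/val_inj.
by rewrite /rV_cons (row_mxEr a%:M).
Qed.

Lemma rV_cons_affine n (s a : R) (y : 'rV[R]_n) (v : 'rV[R]_n.+1) :
  s *: rV_cons (a, y) + v =
  rV_cons (s * a + v ord0 ord0, s *: y + (\row_i v ord0 (lift ord0 i))).
Proof.
apply/rowP => i; case: (unliftP ord0 i) => [j ->|->].
  by rewrite [LHS]mxE [X in X + _]mxE !rV_consS !mxE.
by rewrite [LHS]mxE [X in X + _]mxE !rV_cons0.
Qed.

Lemma ge0_integral_rVS n (F : 'rV[R]_n.+1 -> \bar R) : measurable_fun setT F ->
  (forall x, 0 <= F x)%E ->
  (\int[lebesgue_rV n.+1]_x F x = \int[leb]_a \int[lebesgue_rV n]_y F (rV_cons (a, y)))%E.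
Proof.
move=> mF F0.
transitivity (\int[(leb \x lebesgue_rV n)%E]_p F (rV_cons p))%E.
  have := @ge0_integral_pushforward _ _ _ _ R (@rV_cons R n) (@measurable_rV_cons R n)
    (leb \x lebesgue_rV n)%E setT F measurableT mF (fun x _ => F0 x).
  by rewrite preimage_setT.
have mFc : measurable_fun setT (F \o @rV_cons R n).
  by apply: measurableT_comp => //; exact: measurable_rV_cons.
exact: (@fubini_tonelli1 _ _ _ _ _ leb (lebesgue_rV n) _ mFc (fun p => F0 _)).
Qed.

Lemma measurable_affine n (s : R) (v : 'rV[R]_n) :
  measurable_fun setT (fun x : 'rV[R]_n => s *: x + v).
Proof.
apply: measurable_fun_rVP => i.
under [X in measurable_fun _ X]funext do rewrite !mxE.
apply: measurable_funD => //; apply: measurable_funM => //.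
exact: measurable_coord.
Qed.

(** Induction on the dimension: for a fixed first coordinate the induction hypothesis removes the
    map from the inner integral, then the case of the line removes it from the outer one. *)
Lemma affine_preserving n (s : R) (v : 'rV[R]_n) : is_sign s ->
  measure_preserving (lebesgue_rV n) (fun x => s *: x + v).
Proof.
move=> hs; split; first exact: measurable_affine.
elim: n v => [|n IH] v F mF F0.
  by apply: eq_integral => x _; congr F; rewrite !thinmx0.
have mFc : measurable_fun setT (F \o @rV_cons R n).
  by apply: measurableT_comp => //; exact: measurable_rV_cons.
rewrite (ge0_integral_rVS mF F0).
rewrite (ge0_integral_rVS (measurableT_comp mF (measurable_affine s v)) (fun x => F0 _)) /=.
under eq_integral do under eq_integral do rewrite rV_cons_affine.
have IHa a := IH (\row_i v ord0 (lift ord0 i)) (fun y => F (rV_cons (a, y)))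
  (measurableT_comp mFc (pair1_measurable a)) (fun y => F0 _).
under eq_integral do rewrite IHa.
rewrite ((lebesgue_preserving (v ord0 ord0) hs).2
  (fun a => \int[lebesgue_rV n]_y F (rV_cons (a, y)))%E)//.
  exact: (measurable_fun_fubini_tonelli_F (m2 := lebesgue_rV n) _ mFc (fun p => F0 _)).
by move=> a; apply: integral_ge0.
Qed.

Lemma shift_preserving n (v : 'rV[R]_n) :
  measure_preserving (lebesgue_rV n) (fun x => x + v).
Proof.
have := @affine_preserving n 1 v (or_introl erefl).
by under [X in measure_preserving _ X]funext do rewrite scale1r.
Qed.

Lemma shiftB_preserving n (v : 'rV[R]_n) :
  measure_preserving (lebesgue_rV n) (fun x => x - v).
Proof. exact: shift_preserving. Qed.

Lemma opp_preserving n : measure_preserving (lebesgue_rV n) (fun x : 'rV[R]_n => - x).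
Proof.
have := @affine_preserving n (-1) 0 (or_intror erefl).
by under [X in measure_preserving _ X]funext do rewrite addr0 scaleN1r.
Qed.

Lemma measurable_rV_add d (T : measurableType d) n (u v : T -> 'rV[R]_n) :
  measurable_fun setT u -> measurable_fun setT v -> measurable_fun setT (fun t => u t + v t).
Proof.
move=> mu' mv; apply: measurable_fun_rVP => i.
under [X in measurable_fun _ X]funext do rewrite !mxE.
by apply: measurable_funD; apply: (measurableT_comp (measurable_coord i)).
Qed.

Lemma measurable_rV_sub d (T : measurableType d) n (u v : T -> 'rV[R]_n) :
  measurable_fun setT u -> measurable_fun setT v -> measurable_fun setT (fun t => u t - v t).
Proof.
move=> mu' mv; apply: measurable_fun_rVP => i.
under [X in measurable_fun _ X]funext do rewrite !mxE.
by apply: measurable_funB; apply: (measurableT_comp (measurable_coord i)).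
Qed.

Lemma measurable_dot d (T : measurableType d) n (u v : T -> 'rV[R]_n) :
  measurable_fun setT u -> measurable_fun setT v -> measurable_fun setT (fun t => dot (u t) (v t)).
Proof.
move=> mu' mv; apply: measurable_sum => i.
by apply: measurable_funM; apply: (measurableT_comp (measurable_coord i)).
Qed.

Lemma dotDl n (x y z : 'rV[R]_n) : dot (x + y) z = dot x z + dot y z.
Proof. by rewrite /dot -big_split; apply: eq_bigr => i _; rewrite mxE mulrDl. Qed.
Lemma dotC n (x y : 'rV[R]_n) : dot x y = dot y x.
Proof. by apply: eq_bigr => i _; rewrite mulrC. Qed.
Lemma dotZl n a (x y : 'rV[R]_n) : dot (a *: x) y = a * dot x y.
Proof. by rewrite /dot mulr_sumr; apply: eq_bigr => i _; rewrite mxE mulrA. Qed.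
Lemma dotNl n (x y : 'rV[R]_n) : dot (- x) y = - dot x y.
Proof. by rewrite -scaleN1r dotZl mulN1r. Qed.
Lemma dotBl n (x y z : 'rV[R]_n) : dot (x - y) z = dot x z - dot y z.
Proof. by rewrite dotDl dotNl. Qed.
Lemma dotDr n (x y z : 'rV[R]_n) : dot x (y + z) = dot x y + dot x z.
Proof. by rewrite dotC dotDl !(dotC x). Qed.
Lemma dotZr n a (x y : 'rV[R]_n) : dot x (a *: y) = a * dot x y.
Proof. by rewrite dotC dotZl dotC. Qed.
Lemma dotNr n (x y : 'rV[R]_n) : dot x (- y) = - dot x y.
Proof. by rewrite dotC dotNl dotC. Qed.
Lemma dotBr n (x y z : 'rV[R]_n) : dot x (y - z) = dot x y - dot x z.
Proof. by rewrite dotDr dotNr. Qed.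
Lemma dot0l n (x : 'rV[R]_n) : dot 0 x = 0.
Proof. by rewrite /dot big1// => i _; rewrite mxE mul0r. Qed.
Lemma dot_ge0 n (x : 'rV[R]_n) : 0 <= dot x x.
Proof. by apply: sumr_ge0 => i _; rewrite -expr2 sqr_ge0. Qed.

Lemma zvecD n (k l : 'rV[int]_n) : zvec (k + l) = zvec k + zvec l :> 'rV[R]_n.
Proof. by apply/rowP => i; rewrite !mxE rmorphD. Qed.
Lemma zvecN n (k : 'rV[int]_n) : zvec (- k) = - zvec k :> 'rV[R]_n.
Proof. by apply/rowP => i; rewrite !mxE rmorphN. Qed.
Lemma zvecB n (k l : 'rV[int]_n) : zvec (k - l) = zvec k - zvec l :> 'rV[R]_n.
Proof. by rewrite zvecD zvecN. Qed.
Lemma zvec0 n : zvec (0 : 'rV[int]_n) = 0 :> 'rV[R]_n.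
Proof. by apply/rowP => i; rewrite !mxE. Qed.

Definition grid n (m : nat) (x : 'rV[R]_n) : 'rV[int]_n :=
  map_mx (fun a => Num.floor (m.+1%:R * a)) x.

Lemma measurable_grid n m :
  measurable_fun setT (fun x : 'rV[R]_n => grid m x : discrete 'rV[int]_n).
Proof.
move=> _ B _; rewrite setTI.
have -> : (fun x : 'rV[R]_n => grid m x : discrete 'rV[int]_n) @^-1` B =
    \bigcup_p (if @unpickle 'rV[int]_n p is Some k then
      [set x : 'rV[R]_n | B k /\ grid m x = k] else set0).
  apply/seteqP; split => [x Bx|x [p _]].
    by exists (pickle (grid m x)) => //; rewrite pickleK.
  by case: unpickle => //= k [Bk gk]; rewrite /preimage /= gk.
apply: bigcup_measurable => p _; case: unpickle => // k.
have [Bk|Bk] := pselect (B k); last first.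
  rewrite (_ : [set _ | _] = set0)//; by apply/seteqP; split => x //= [].
have -> : [set x : 'rV[R]_n | B k /\ grid m x = k] =
    \bigcap_(i in [set: 'I_n]) ((fun x : 'rV[R]_n => m.+1%:R * x ord0 i) @^-1`
      `[(k ord0 i)%:~R, (k ord0 i + 1)%:~R[).
  apply/seteqP; split => [x /= [_ <-] i _|x xk].
    by rewrite /= in_itv/= mxE; exact: floor_itv.
  split=> //; apply/rowP => i; rewrite mxE; apply: floor_def.
  by have := xk i Logic.I; rewrite /= in_itv.
apply: fin_bigcap_measurable => // i _.
rewrite -[X in measurable X]setTI.
have : measurable_fun setT (fun x : 'rV[R]_n => m.+1%:R * x ord0 i).
  by apply: measurable_funM => //; exact: measurable_coord.
by apply.
Qed.

Lemma grid_close n m (x : 'rV[R]_n) i :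
  `|x ord0 i - (m.+1%:R^-1 *: zvec (grid m x)) ord0 i| <= m.+1%:R^-1.
Proof.
have m0 : 0 < m.+1%:R :> R by rewrite ltr0n.
rewrite !mxE; set a := x ord0 i.
have /andP[] := floor_itv (m.+1%:R * a); set z := (Num.floor _)%:~R => h1.
rewrite intrD -/z => h2.
have -> : a - m.+1%:R^-1 * z = m.+1%:R^-1 * (m.+1%:R * a - z).
  by rewrite mulrBr mulKf// gt_eqF.
by rewrite normrM gtr0_norm ?invr_gt0// ger_pMr ?invr_gt0// ler_norml; lra.
Qed.

(** The sigma-algebra is generated by the coordinates and not defined from open sets, so [f] is
    obtained as a pointwise limit: rounding the point down to a grid of mesh 1/(m+1) leaves a
    function of a countably valued measurable map. *)
Lemma continuous_measurable_rV n (f : 'rV[R]_n -> R) : continuous f -> measurable_fun setT f.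
Proof.
move=> cf.
apply: (@measurable_fun_cvg _ _ _ _ (fun m x => f (m.+1%:R^-1 *: zvec (grid m x)))).
  move=> m; apply: (@measurableT_comp _ _ _ _ _ _
    ((fun k : discrete 'rV[int]_n => f (m.+1%:R^-1 *: zvec k)))) => //.
  exact: measurable_grid.
move=> x _; apply/cvgrPdist_lt => e e0.
have /cvgrPdist_lt/(_ e e0)/nbhs_ballP[r /= r0 rP] := cf x.
near=> m; apply: rP; split=> // i j; rewrite ord1 /ball /=.
apply: le_lt_trans (grid_close _ _ _) _.
near: m; exact: (near_infty_natSinv_lt (PosNum r0)).
Unshelve. all: by end_near. Qed.

End euclidean.

(** * Gaussians *)

Section gaussian_line.
Context {R : realType}.
Local Notation leb := (@lebesgue_measure R).
Local Notation gauss := (@gauss_fun R).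

Lemma cvg_gauss_nat : gauss n%:R @[n --> \oo] --> (0 : R).
Proof. by apply: cvg_comp; [exact: cvgr_idn|exact: cvg_gauss_fun]. Qed.

(** The fundamental theorem of calculus on [-(n+1), n+1], then dominated convergence; only the
    limits of the primitive along the integers enter. *)
Lemma Rint_derive_eq0 (F f : R -> R) : (forall t, is_derive t (1 : R) F (f t)) ->
  continuous f -> rintegrable leb f ->
  F n%:R @[n --> \oo] --> (0 : R) -> F (- n%:R) @[n --> \oo] --> (0 : R) ->
  (\int[leb]_t f t = 0)%R.
Proof.
move=> dF cf If Fp Fn.
pose f_ (n : nat) (t : measurableTypeR R) := f t * \1_(`[(- n.+1%:R), n.+1%:R]%classic) t.
have mf : measurable_fun setT (f : measurableTypeR R -> R) by exact: continuous_measurable_fun.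
have f_E n : (\int[leb]_t f_ n t)%R = F n.+1%:R - F (- n.+1%:R).
  have n0 : (- n.+1%:R : R) < n.+1%:R.
    by apply: (@lt_trans _ _ 0); rewrite ?oppr_lt0 ltr0n.
  have dFx x : derivable F x 1 by case: (dF x).
  have cF : continuous F by move=> x; apply/differentiable_continuous/derivable1_diffP.
  have -> : (\int[leb]_t f_ n t)%R = (\int[leb]_(t in `[(- n.+1%:R), n.+1%:R]) f t)%R.
    rewrite [RHS]Rintegral_mkcond; apply: eq_Rintegral => t _.
    by rewrite /f_ patchE indicE; case: ifP => _ /=; rewrite ?mulr1 ?mulr0.
  rewrite /Rintegral (@continuous_FTC2 _ f F)//.
  - by apply: continuous_subspaceT.
  - split=> //; first exact/cvg_at_right_filter/cF.
    exact/cvg_at_left_filter/cF.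
  - by move=> x _; rewrite derive1E; apply: derive_val.
have [||||_ cI] := @Rint_dct _ _ R leb f_ f (fun t => `|f t|).
- move=> n; apply: measurable_funM => //.
- move=> t; apply: cvg_near_cst; near=> n.
  rewrite /f_ indicE mem_set ?mulr1//= in_itv/=.
  have : `|t| <= n.+1%:R.
    apply: (@le_trans _ _ n%:R); last by rewrite ler_nat.
    by near: n; exact: nbhs_infty_ger.
  by rewrite ler_norml.
- exact: rintegrable_norm.
- by move=> n t; rewrite /f_ indicE; case: (_ \in _); rewrite ?mulr1// mulr0 normr0.
rewrite (funext f_E) in cI.
have c0 : F n.+1%:R - F (- n.+1%:R) @[n --> \oo] --> (0 : R).
  rewrite -(subr0 0); apply: cvgB.
    by rewrite (cvg_shiftS (fun n => F n%:R)).
  by rewrite (cvg_shiftS (fun n => F (- n%:R))).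
exact: (cvg_unique _ cI c0).
Unshelve. all: by end_near. Qed.

Lemma lebesgue_scale (c : R) (F : measurableTypeR R -> \bar R) : 0 < c ->
  measurable_fun setT F -> (forall x, 0 <= F x)%E ->
  (\int[leb]_x F x = c%:E * \int[leb]_x F (c * x)%R)%E.
Proof.
move=> c0 mF F0; pose u (x : measurableTypeR R) : measurableTypeR R := c * x.
have mu' : measurable_fun setT u by exact: measurable_funM.
pose pm := measure_function_pushforward__canonical__measure_function_Measure leb mu'.
pose cn : {nonneg R} := NngNum (ltW c0).
have H (A : set (measurableTypeR R)) : measurable A -> leb A = mscale cn pm A.
  apply: (@lebesgue_measure_unique R (mscale cn pm)).
  move=> _ [[a b] _ <-] /=; rewrite /mscale /= /pushforward.
  have -> : u @^-1` `]a, b] = `](a / c), (b / c)]%classic.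
    apply/seteqP; split => x; rewrite /u /= !in_itv/= ltr_pdivrMr// ler_pdivlMr// mulrC//.
  rewrite !lebesgue_measure_itv/= !lte_fin ltr_pM2r ?invr_gt0//.
  case: ifP => _; last by rewrite mule0.
  by rewrite -!EFinB -EFinM -mulrBl mulrC divfK// gt_eqF.
rewrite (eq_measure_integral (mscale cn pm)); last by move=> A mA _; exact: H.
rewrite (ge0_integral_mscale pm measurableT cn)//=; congr (_ * _)%E.
by rewrite (@ge0_integral_pushforward _ _ _ _ _ u mu' leb setT F).
Qed.

Lemma rintegrable_scale (c : R) (f : measurableTypeR R -> R) : 0 < c ->
  rintegrable leb f -> rintegrable leb (fun x => f (c * x)).
Proof.
move=> c0 /rintegrableP[mf lf]; apply/rintegrableP; split.
  by apply: (measurableT_comp mf); exact: measurable_funM.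
rewrite -(@lte_pmul2l _ c%:E) ?lte_fin// -(@lebesgue_scale c (fun x => `|f x|%:E))//.
  by apply: lt_le_trans lf _; rewrite mulry gtr0_sg// mul1e.
by apply/measurable_EFinP; exact: measurableT_comp.
Qed.

Lemma Rint_scale (c : R) (f : measurableTypeR R -> R) : 0 < c -> rintegrable leb f ->
  (\int[leb]_x f (c * x) = c^-1 * \int[leb]_x f x)%R.
Proof.
move=> c0 If.
have H (g : measurableTypeR R -> R) : rintegrable leb g -> (forall x, 0 <= g x) ->
    (\int[leb]_x g (c * x) = c^-1 * \int[leb]_x g x)%R.
  move=> Ig g0; apply: EFin_inj; rewrite EFinM !EFin_Rint//; last exact: rintegrable_scale.
  rewrite (lebesgue_scale (F := EFin \o g) c0)//; last first.
    by apply/measurable_EFinP; exact: rintegrable_measurable Ig.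
  by rewrite muleA -EFinM mulVf ?gt_eqF// mul1e.
have In := rintegrable_norm If.
have IfD := rintegrableD If In.
(* Both f + |f| and |f| are nonnegative, so the signed case follows from [H] by difference. *)
have D : f = fun x => (f x + `|f x|) - `|f x| by apply/funext => x; rewrite addrK.
rewrite D [LHS]RintB; [|exact: (rintegrable_scale c0 IfD)|exact: (rintegrable_scale c0 In)].
rewrite [X in _ = _ * X]RintB// mulrBr (H _ In)// (H _ IfD)// => x.
by rewrite -lerBlDr sub0r lerNl (le_trans (ler_norm _))// normrN.
Qed.

Lemma rintegrable_gauss : rintegrable leb gauss.
Proof. exact: integrableT_gauss. Qed.

(* [|t| <= 1 + t^2/2 <= exp(t^2/2)] *)
Lemma rintegrable_id_gauss : rintegrable leb (fun t => `|t| * gauss t).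
Proof.
have cG : continuous (fun t : R => expR (- (t ^+ 2 / 2))).
  by move=> t; apply/differentiable_continuous/derivable1_diffP; exact: ex_derive.
apply: (@rintegrable_le _ _ _ _ _ (fun t : measurableTypeR R => expR (- (t ^+ 2 / 2)))).
- by apply: measurable_funM => //; exact: measurable_gauss_fun.
- move=> t; rewrite normrM normr_id ger0_norm ?gauss_fun_ge0// /gauss_fun.
  have -> : - (t ^+ 2 / 2) = t ^+ 2 / 2 + - t ^+ 2 by lra.
  rewrite expRD ler_wpM2r ?expR_ge0//; apply: le_trans (expR_ge1Dx _).
  have := sqr_ge0 (`|t| - 1); rewrite sqrrB1 real_normK ?num_real//; lra.
- have s0 : 0 < Num.sqrt (2^-1 : R) by rewrite sqrtr_gt0 invr_gt0.
  have := rintegrable_scale s0 rintegrable_gauss; rewrite /gauss_fun.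
  by under eq_fun do rewrite exprMn sqr_sqrtr// mulrC.
Qed.

Lemma is_derive_gauss_cos (y t : R) : is_derive y (1 : R)
  (fun y => gauss t * cos (y * t)) (- (gauss t * (t * sin (y * t)))).
Proof. by apply: is_derive_eq; rewrite /GRing.scale/=; ring. Qed.

Lemma is_derive_gauss_sin (y t : R) : is_derive t (1 : R)
  (fun t => gauss t * sin (y * t))
  (- 2 * (gauss t * (t * sin (y * t))) + y * (gauss t * cos (y * t))).
Proof. by rewrite /gauss_fun; apply: is_derive_eq; rewrite /GRing.scale/=; ring. Qed.

Lemma rintegrable_gaussM (h : R -> R) : measurable_fun setT h -> (forall t, `|h t| <= 1) ->
  rintegrable leb (fun t => gauss t * h t).
Proof. by move=> mh h1; apply: rintegrableMl rintegrable_gauss mh h1. Qed.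

Lemma measurable_cosM (y : R) : measurable_fun setT (fun t : measurableTypeR R => cos (y * t)).
Proof.
apply: continuous_measurable_fun => t.
by apply/differentiable_continuous/derivable1_diffP; exact: ex_derive.
Qed.

Lemma measurable_sinM (y : R) : measurable_fun setT (fun t : measurableTypeR R => sin (y * t)).
Proof.
apply: continuous_measurable_fun => t.
by apply/differentiable_continuous/derivable1_diffP; exact: ex_derive.
Qed.

Lemma cos_norm_le1 (x : R) : `|cos x| <= 1.
Proof. by rewrite ler_norml cos_geN1 cos_le1. Qed.
Lemma sin_norm_le1 (x : R) : `|sin x| <= 1.
Proof. by rewrite ler_norml sin_geN1 sin_le1. Qed.

Lemma rintegrable_gauss_cos (y : R) : rintegrable leb (fun t => gauss t * cos (y * t)).
Proof.
by apply: rintegrable_gaussM => [|t]; [exact: measurable_cosM|exact: cos_norm_le1].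
Qed.

Lemma rintegrable_gauss_tsin (y : R) :
  rintegrable leb (fun t => gauss t * (t * sin (y * t))).
Proof.
apply: rintegrable_le rintegrable_id_gauss.
  apply: measurable_funM; first exact: measurable_gauss_fun.
  by apply: measurable_funM => //; exact: measurable_sinM.
move=> t; rewrite !normrM mulrC ler_pM//; last by rewrite ger0_norm ?gauss_fun_ge0.
by rewrite ler_piMr ?sin_norm_le1.
Qed.

(** Integration by parts: the derivative of exp(-t^2) sin(y t) has integral 0. *)
Lemma gauss_by_parts (y : R) :
  (\int[leb]_t (gauss t * (t * sin (y * t))) = y / 2 * \int[leb]_t (gauss t * cos (y * t)))%R.
Proof.
have bnd (u : nat -> R) : (forall n, `|u n| <= gauss n%:R) -> u n @[n --> \oo] --> (0 : R).
  move=> ub; apply: norm_cvg0; apply: (@squeeze_cvgr _ _ _ _ (fun=> 0) (fun n => gauss n%:R)).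
  - by apply: nearW => n; rewrite normr_ge0 ub.
  - exact: cvg_cst.
  - exact: cvg_gauss_nat.
have [I1 I2] := (rintegrable_gauss_tsin y, rintegrable_gauss_cos y).
have := @Rint_derive_eq0 (fun t => gauss t * sin (y * t)) _ (is_derive_gauss_sin y).
rewrite RintD; [|exact: rintegrableZl..].
rewrite !RintZl// => H; suff : - 2 * (\int[leb]_t (gauss t * (t * sin (y * t))))%R +
  y * (\int[leb]_t (gauss t * cos (y * t)))%R = 0 by lra.
apply: H.
- move=> t; apply/differentiable_continuous/derivable1_diffP.
  by rewrite /gauss_fun; exact: ex_derive.
- by apply: rintegrableD; exact: rintegrableZl.
- apply: bnd => n; rewrite normrM ger0_norm ?gauss_fun_ge0//.
  by rewrite ler_piMr ?gauss_fun_ge0// sin_norm_le1.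
- apply: bnd => n; rewrite normrM ger0_norm ?gauss_fun_ge0//.
  rewrite {1}/gauss_fun sqrrN -/(gauss_fun _).
  by rewrite ler_piMr ?gauss_fun_ge0// sin_norm_le1.
Qed.

(** Differentiation under the integral sign, dominated by |t| exp(-t^2), followed by
    [gauss_by_parts]. The cosine transform H thus solves H' = -(y/2) H. *)
Lemma is_derive_gauss_int (y : R) :
  is_derive y (1 : R) (fun y => \int[leb]_t (gauss t * cos (y * t)))%R
    (- (y / 2 * \int[leb]_t (gauss t * cos (y * t))))%R.
Proof.
pose f (y t : R) := gauss t * cos (y * t).
have Ia : `]y - 1, y + 1[%classic y by rewrite /= in_itv/=; lra.
have p1 z t : partial1of2 f z t = - (gauss t * (t * sin (z * t))).
  rewrite partial1of2E.
  by have H := is_derive_gauss_cos z t; rewrite (@derive_val _ _ _ _ _ _ _ H).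
have If z : `]y - 1, y + 1[%classic z -> leb.-integrable setT (EFin \o f z).
  by move=> _; exact: rintegrable_gauss_cos.
have df z t : `]y - 1, y + 1[%classic z -> setT t -> derivable (f^~ t) z 1.
  by move=> _ _; case: (is_derive_gauss_cos z t).
have b1 z t : `]y - 1, y + 1[%classic z -> setT t -> `|partial1of2 f z t| <= `|t| * gauss t.
  move=> _ _; rewrite p1 normrN !normrM mulrC ler_pM//; last by rewrite ger0_norm ?gauss_fun_ge0.
  by rewrite ler_piMr ?sin_norm_le1.
have g0 (t : measurableTypeR R) : 0 <= `|t| * gauss t.
  by rewrite mulr_ge0// gauss_fun_ge0.
have Ig := rintegrable_id_gauss.
split; first exact: (derivable_under_integral measurableT Ia If df g0 Ig b1).
rewrite -derive1E (differentiation_under_integral measurableT Ia If df g0 Ig b1).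
rewrite -gauss_by_parts -RintN; last exact: rintegrable_gauss_tsin.
by apply: eq_Rintegral => t _; rewrite p1.
Qed.

Lemma Rint_gauss : (\int[leb]_t gauss t = Num.sqrt pi)%R.
Proof. by rewrite /Rintegral integralT_gauss. Qed.

(** By the differential equation H(y) exp(y^2/4) is constant, and its value at 0 is the Gaussian
    integral. *)
Lemma gauss_fourier (y : R) :
  (\int[leb]_t (gauss t * cos (y * t)) = Num.sqrt pi * expR (- (y ^+ 2 / 4)))%R.
Proof.
pose H (y : R) := (\int[leb]_t (gauss t * cos (y * t)))%R.
have dL z : is_derive z (1 : R) (fun y => H y * expR (y ^+ 2 / 4)) 0.
  have dH := is_derive_gauss_int z.
  by apply: is_derive_eq; rewrite /GRing.scale/= -/(H z); lra.
have := is_derive_0_is_cst y 0 dL.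
have -> : H 0 = Num.sqrt pi.
  by rewrite -Rint_gauss; apply: eq_Rintegral => t _; rewrite mul0r cos0 mulr1.
rewrite expr0n/= mul0r expR0 mulr1 => <-.
by rewrite -mulrA -expRD subrr expR0 mulr1.
Qed.

End gaussian_line.

Section tensor.
Context d1 d2 (T1 : measurableType d1) (T2 : measurableType d2) (R : realType).
Variables (m1 : {sigma_finite_measure set T1 -> \bar R})
  (m2 : {sigma_finite_measure set T2 -> \bar R}).

Lemma Rint_tensor (u : T1 -> R) (v : T2 -> R) : rintegrable m1 u -> rintegrable m2 v ->
  rintegrable (m1 \x m2)%E (fun p => u p.1 * v p.2) /\
  (\int[(m1 \x m2)%E]_p (u p.1 * v p.2) = (\int[m1]_x u x) * \int[m2]_y v y)%R.
Proof.
move=> Iu Iv.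
have mf : measurable_fun setT (fun p : T1 * T2 => u p.1 * v p.2).
  apply: measurable_funM; first exact: (measurableT_comp (rintegrable_measurable Iu) measurable_fst).
  exact: (measurableT_comp (rintegrable_measurable Iv) measurable_snd).
have If : rintegrable (m1 \x m2)%E (fun p => u p.1 * v p.2).
  apply/(@integrable12ltyP _ _ _ _ _ m1 m2 (EFin \o _)); first exact/measurable_EFinP.
  have E x : (\int[m2]_y `|((EFin \o (fun p : T1 * T2 => (u p.1 * v p.2)%R)) (x, y))|)%E =
      (`|u x| * \int[m2]_y `|v y|)%R%:E.
    rewrite -RintZl; last exact: rintegrable_norm.
    rewrite EFin_Rint; last by apply: rintegrableZl; exact: rintegrable_norm.
    by apply: eq_integral => y _; rewrite /= normrM.
  under eq_integral do rewrite E.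
  by rewrite -EFin_Rint ?ltry//; apply: rintegrableZr; exact: rintegrable_norm.
split=> //; apply: EFin_inj; rewrite EFin_Rint// -(integral12_prod_meas1 If).
rewrite -RintZr// EFin_Rint; last exact: rintegrableZr.
apply: eq_integral => x _; rewrite -RintZl// EFin_Rint//; exact: rintegrableZl.
Qed.

End tensor.

Section cis.
Context {R : realType}.
Implicit Types a b : R.

Lemma cis0 : cis 0 = 1 :> R[i].
Proof. by rewrite /cis cos0 sin0. Qed.

Lemma cisD a b : cis (a + b) = cis a * cis b.
Proof.
apply: complex_eqP; rewrite ?ReM ?ImM /= ?cosD ?sinD//.
by rewrite addrC.
Qed.

Lemma conj_cis a : ((cis a)^*)%C = cis (- a).
Proof. by rewrite /cis cosN sinN. Qed.

Lemma normc_cis a : normc (cis a) = 1.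
Proof. by rewrite normcE /= cos2Dsin2 sqrtr1. Qed.

Lemma cis_sum (I : Type) (s : seq I) (u : I -> R) :
  cis (\sum_(i <- s) u i) = \prod_(i <- s) cis (u i).
Proof. by elim/big_rec2: _ => [|i x y _ <-]; rewrite ?cis0// cisD. Qed.

Lemma cmeas_cis d (T : measurableType d) (u : T -> R) :
  measurable_fun setT u -> cmeas (fun x => cis (u x)).
Proof.
move=> mu'; split; apply: measurableT_comp mu'.
  by apply: continuous_measurable_fun; exact: continuous_cos.
by apply: continuous_measurable_fun; exact: continuous_sin.
Qed.

End cis.

Section product_integrals.
Context {R : realType}.
Local Notation leb := (@lebesgue_measure R).

Lemma Rint_rVS n (f : 'rV[R]_n.+1 -> R) : measurable_fun setT f ->
  rintegrable (leb \x lebesgue_rV n)%E (fun p => f (rV_cons p)) ->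
  rintegrable (lebesgue_rV n.+1) f /\
  (\int[lebesgue_rV n.+1]_x f x = \int[(leb \x lebesgue_rV n)%E]_p f (rV_cons p))%R.
Proof.
move=> mf If; have mfE : measurable_fun setT (EFin \o f) by exact/measurable_EFinP.
have If' : ((leb \x lebesgue_rV n)%E).-integrable (@rV_cons R n @^-1` setT) ((EFin \o f) \o @rV_cons R n).
  by rewrite preimage_setT.
split.
  exact: (integrable_pushforward (@measurable_rV_cons R n) mfE If').
congr fine; have := integral_pushforward (@measurable_rV_cons R n) mfE If' measurableT.
by rewrite preimage_setT.
Qed.

Lemma cint_rVS n (f : 'rV[R]_n.+1 -> R[i]) (w : measurableTypeR R -> R[i]) (k : 'rV[R]_n -> R[i]) :
  cmeas f -> (forall a y, f (rV_cons (a, y)) = w a * k y) ->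
  cintegrable leb w -> cintegrable (lebesgue_rV n) k ->
  cintegrable (lebesgue_rV n.+1) f /\
  cint (lebesgue_rV n.+1) f = cint leb w * cint (lebesgue_rV n) k.
Proof.
move=> [mr mi] fE [wr wi] [kr ki].
have [Irr Err] := Rint_tensor wr kr; have [Iii Eii] := Rint_tensor wi ki.
have [Iri Eri] := Rint_tensor wr ki; have [Iir Eir] := Rint_tensor wi kr.
have [|Ir Er] := Rint_rVS mr.
  have -> : (fun p => Re (f (rV_cons p))) = fun p => Re (w p.1) * Re (k p.2) - Im (w p.1) * Im (k p.2).
    by apply/funext => -[a y]; rewrite fE ReM.
  exact: (rintegrableB Irr Iii).
have [|Ii Ei] := Rint_rVS mi.
  have -> : (fun p => Im (f (rV_cons p))) = fun p => Re (w p.1) * Im (k p.2) + Im (w p.1) * Re (k p.2).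
    by apply/funext => -[a y]; rewrite fE ImM.
  exact: (rintegrableD Iri Iir).
split=> //; apply: complex_eqP.
  rewrite ReM -Err -Eii -RintB// [LHS]Er; apply: eq_Rintegral => -[a y] _.
  by rewrite fE ReM.
rewrite ImM -Eri -Eir -RintD// [LHS]Ei; apply: eq_Rintegral => -[a y] _.
by rewrite fE ImM.
Qed.

Lemma cmeas_prod d (T : measurableType d) (I : Type) (s : seq I) (f : I -> T -> R[i]) :
  (forall i, cmeas (f i)) -> cmeas (fun x => \prod_(i <- s) f i x).
Proof.
move=> mf; elim: s => [|i s IH].
  by under [X in cmeas X]funext do rewrite big_nil; exact: cmeas_cst.
by under [X in cmeas X]funext do rewrite big_cons; exact: cmeasM.
Qed.

Lemma cint_rV_prod n (h : 'I_n -> measurableTypeR R -> R[i]) :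
  (forall i, cintegrable leb (h i)) ->
  cintegrable (lebesgue_rV n) (fun x => \prod_i h i (x ord0 i)) /\
  cint (lebesgue_rV n) (fun x => \prod_i h i (x ord0 i)) = \prod_i cint leb (h i).
Proof.
elim: n h => [|n IH] h Ih.
  (* In dimension 0 the measure is the Dirac mass at the only vector, so integration is evaluation
     and the empty product gives 1. *)
  have E (f : 'rV[R]_0 -> R) : rintegrable (lebesgue_rV 0) f /\ (\int[lebesgue_rV 0]_x f x)%R = f 0.
    have mf : measurable_fun setT f by move=> _ B mB; rewrite setTI;
      have [f0|f0] := pselect (B (f 0));
      [rewrite (_ : _ @^-1` _ = setT)|rewrite (_ : _ @^-1` _ = set0)] => //;
      apply/seteqP; split => // x; rewrite /preimage /= (thinmx0 x).
    split.
      apply/rintegrableP; split=> //; rewrite [ltLHS]integral_dirac//; last first.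
        by apply/measurable_EFinP; exact: measurableT_comp.
      by rewrite diracE mem_set// mul1e ltry.
    rewrite /Rintegral [X in fine X]integral_dirac//; last exact/measurable_EFinP.
    by rewrite diracE mem_set// mul1e.
  split; first by split; exact: (E _).1.
  by rewrite big_ord0; apply: complex_eqP; rewrite [LHS](E _).2 big_ord0.
have [IH1 IH2] := IH (fun i => h (lift ord0 i)) (fun i => Ih _).
have := @cint_rVS n (fun x => \prod_i h i (x ord0 i)) (h ord0) _ _ _ (Ih ord0) IH1.
move=> H; rewrite [X in _ /\ _ = X]big_ord_recl -IH2; apply: H.
  apply: cmeas_prod => i; apply: (cmeas_comp (cintegrable_meas (Ih i))).
  exact: measurable_coord.
move=> a y; rewrite big_ord_recl rV_cons0; congr (_ * _); apply: eq_bigr => i _.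
by rewrite rV_consS.
Qed.

End product_integrals.

(** * Gaussians on R^n and the heat kernel *)

Section gaussian_space.
Context {R : realType}.
Local Notation leb := (@lebesgue_measure R).

Lemma gauss_line_fourier (e y : R) : 0 < e ->
  cintegrable leb (fun t : measurableTypeR R => (expR (- (e * t ^+ 2)))%:C%C * cis (- (y * t))) /\
  cint leb (fun t : measurableTypeR R => (expR (- (e * t ^+ 2)))%:C%C * cis (- (y * t))) =
  (Num.sqrt (pi / e) * expR (- (y ^+ 2 / (4 * e))))%:C%C.
Proof.
move=> e0; pose c := Num.sqrt e.
have c0 : 0 < c by rewrite sqrtr_gt0.
have ce : c ^+ 2 = e by rewrite sqr_sqrtr// ltW.
have E t : expR (- (e * t ^+ 2)) = gauss_fun (c * t) by rewrite /gauss_fun exprMn ce.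
have yE t : y * t = y / c * (c * t) by rewrite mulrA divfK// gt_eqF.
have Ic := rintegrable_scale c0 (rintegrable_gauss_cos (y / c)).
have Is : rintegrable leb (fun t => gauss_fun (c * t) * sin (y / c * (c * t))).
  apply: (rintegrable_scale c0 (f := fun t => gauss_fun t * sin (y / c * t))).
  by apply: rintegrable_gaussM => [|t]; [exact: measurable_sinM|exact: sin_norm_le1].
have Er t : Re ((expR (- (e * t ^+ 2)))%:C%C * cis (- (y * t))) =
    gauss_fun (c * t) * cos (y / c * (c * t)).
  by rewrite ReM /= mul0r subr0 cosN E yE.
have Ei t : Im ((expR (- (e * t ^+ 2)))%:C%C * cis (- (y * t))) =
    - (gauss_fun (c * t) * sin (y / c * (c * t))).
  by rewrite ImM /= mul0r addr0 sinN E yE mulrN.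
split.
  split; first by apply: eq_rintegrable Ic => t; rewrite Er.
  by apply: eq_rintegrable (rintegrableN Is) => t; rewrite Ei.
apply: complex_eqP => /=.
  transitivity (\int[leb]_t (gauss_fun (c * t) * cos (y / c * (c * t))))%R.
    by apply: eq_Rint => t; exact: Er.
  rewrite (Rint_scale c0 (rintegrable_gauss_cos (y / c))) gauss_fourier mulrA.
  congr (_ * expR (- _)); last by rewrite expr_div_n ce -mulrA -invfM (mulrC e).
  by rewrite mulrC sqrtrM ?pi_ge0// sqrtrV ?ltW.
transitivity (\int[leb]_t (- (gauss_fun (c * t) * sin (y / c * (c * t)))))%R.
  by apply: eq_Rint => t; exact: Ei.
(* The integrand is odd, so the substitution t -> -t yields J = -J. *)
set J := (X in X = 0); suff : J = - J by lra.
rewrite {1}/J RintN//.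
have hs : @is_sign R (-1) by right.
rewrite -[X in - X = _](Rint_preserving (lebesgue_preserving 0 hs)); last first.
  exact: rintegrable_measurable Is.
congr (- _); rewrite /J; apply: eq_Rintegral => t _.
by rewrite addr0 mulN1r !mulrN sinN mulrN /gauss_fun sqrrN.
Qed.

Definition gaussian n (e : R) (t : 'rV[R]_n) : R := expR (- (e * dot t t)).

(* The Fourier transform of [gaussian e]. *)
Definition heat_kernel n (e : R) (y : 'rV[R]_n) : R :=
  Num.sqrt (pi / e) ^+ n * gaussian ((4 * e)^-1) y.

Lemma gaussian_ge0 n (e : R) (t : 'rV[R]_n) : 0 <= gaussian e t.
Proof. exact: expR_ge0. Qed.

Lemma gaussian_le1 n (e : R) (t : 'rV[R]_n) : 0 <= e -> gaussian e t <= 1.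
Proof. by move=> e0; rewrite -expR0 ler_expR oppr_le0 mulr_ge0// dot_ge0. Qed.

Lemma gaussianN n (e : R) (t : 'rV[R]_n) : gaussian e (- t) = gaussian e t.
Proof. by rewrite /gaussian dotNl dotNr opprK. Qed.

Lemma heat_kernel_ge0 n (e : R) (y : 'rV[R]_n) : 0 <= heat_kernel e y.
Proof. by rewrite mulr_ge0// ?exprn_ge0 ?sqrtr_ge0// gaussian_ge0. Qed.

Lemma heat_kernelN n (e : R) (y : 'rV[R]_n) : heat_kernel e (- y) = heat_kernel e y.
Proof. by rewrite /heat_kernel gaussianN. Qed.

Lemma measurable_gaussian n (e : R) : measurable_fun setT (@gaussian n e).
Proof.
apply: (measurableT_comp (f := fun a : R => expR (- (e * a)))).
  by apply: measurableT_comp => //; apply: measurableT_comp => //; exact: measurable_funM.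
exact: measurable_dot.
Qed.

Lemma measurable_heat_kernel n (e : R) : measurable_fun setT (@heat_kernel n e).
Proof. by apply: measurable_funM => //; exact: measurable_gaussian. Qed.

Lemma gaussian_fourier n (e : R) (y : 'rV[R]_n) : 0 < e ->
  cintegrable (lebesgue_rV n) (fun t => (gaussian e t)%:C%C * cis (- dot y t)) /\
  cint (lebesgue_rV n) (fun t => (gaussian e t)%:C%C * cis (- dot y t)) =
  (heat_kernel e y)%:C%C.
Proof.
move=> e0.
have [I Ec] := cint_rV_prod (fun i : 'I_n => (gauss_line_fourier (y ord0 i) e0).1).
have E (t : 'rV[R]_n) : \prod_i ((expR (- (e * t ord0 i ^+ 2)))%:C%C * cis (- (y ord0 i * t ord0 i))) =
    (gaussian e t)%:C%C * cis (- dot y t).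
  rewrite big_split /= -cis_sum sumrN; congr (_ * _).
  rewrite /gaussian /dot mulr_sumr -sumrN expR_sum rmorph_prod.
  by apply: eq_bigr => i _; rewrite expr2.
split; first exact: eq_cintegrable E I.
rewrite -(eq_cint _ E) Ec; under eq_bigr do rewrite (gauss_line_fourier _ e0).2.
rewrite -rmorph_prod; congr (_%:C)%C.
rewrite big_split/= prodr_const card_ord /heat_kernel; congr (_ * _).
rewrite -expR_sum /gaussian /dot mulr_sumr -sumrN; congr expR.
by apply: eq_bigr => i _; rewrite expr2 [in RHS]mulrC.
Qed.

Lemma rintegrable_gaussian n (e : R) : 0 < e -> rintegrable (lebesgue_rV n) (gaussian e).
Proof.
move=> e0; have [[Ir _] _] := gaussian_fourier (0 : 'rV[R]_n) e0.
apply: eq_rintegrable Ir => t; by rewrite dot0l oppr0 cis0 mulr1.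
Qed.

Lemma Rint_gaussian n (e : R) : 0 < e ->
  (\int[lebesgue_rV n]_t gaussian e t = Num.sqrt (pi / e) ^+ n)%R.
Proof.
move=> e0; have [_ /(congr1 (@Re R)) /=] := gaussian_fourier (0 : 'rV[R]_n) e0.
rewrite /heat_kernel /gaussian dot0l mulr0 oppr0 expR0 mulr1 => <-.
by apply: eq_Rint => t; rewrite /= dot0l oppr0 cos0 mulr1 mul0r subr0.
Qed.

Lemma rintegrable_heat_kernel n (e : R) : 0 < e -> rintegrable (lebesgue_rV n) (heat_kernel e).
Proof.
move=> e0; apply: rintegrableZl; apply: rintegrable_gaussian.
by rewrite invr_gt0 mulr_gt0.
Qed.

(** The mass is independent of [e], since pi/e and 4 pi e multiply to (2 pi)^2 under the square
    root. As e tends to 0, the kernel is therefore an approximate identity up to the factor (2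
    pi)^n. *)
Lemma Rint_heat_kernel n (e : R) : 0 < e ->
  (\int[lebesgue_rV n]_t heat_kernel e t = (2 * pi) ^+ n)%R.
Proof.
move=> e0; have e4 : 0 < (4 * e)^-1 by rewrite invr_gt0 mulr_gt0.
rewrite RintZl; last exact: rintegrable_gaussian.
rewrite Rint_gaussian// -exprMn -sqrtrM ?divr_ge0 ?pi_ge0 ?ltW//; congr (_ ^+ n).
rewrite -[RHS]ger0_norm ?mulr_ge0 ?pi_ge0// -sqrtr_sqr; congr Num.sqrt.
by rewrite invrK; field; rewrite gt_eqF.
Qed.

Lemma gaussian_cvg1 n (t : 'rV[R]_n) :
  gaussian n0.+1%:R^-1 t @[n0 --> \oo] --> (1 : R).
Proof.
have h0 : harmonic n @[n --> \oo] --> (0 : R) := cvg_harmonic.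
have h1 : harmonic n * dot t t @[n --> \oo] --> (0 : R).
  by rewrite -[X in _ --> X](mul0r (dot t t)); apply: cvgM; [exact: h0|exact: cvg_cst].
have h2 : - (harmonic n * dot t t) @[n --> \oo] --> (0 : R).
  by rewrite -[X in _ --> X]oppr0; apply: cvgN; exact: h1.
rewrite -[X in _ --> X]expR0.
apply: (@cvg_comp _ _ _ (fun n => - (harmonic n * dot t t)) expR); first exact: h2.
exact: continuous_expR.
Qed.

(* Monotone convergence along the Gaussian regularizations. *)
Lemma gaussian_bound n (C : R) (f : 'rV[R]_n -> R) : measurable_fun setT f ->
  (forall x, 0 <= f x) ->
  (forall e : R, 0 < e -> (\int[lebesgue_rV n]_x (f x * gaussian e x)%:E <= C%:E)%E) ->
  (\int[lebesgue_rV n]_x (f x)%:E <= C%:E)%E.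
Proof.
move=> mf f0 fC.
pose f_ m (x : 'rV[R]_n) := (f x * gaussian m.+1%:R^-1 x)%:E.
have mf_ m : measurable_fun setT (f_ m).
  by apply/measurable_EFinP; apply: measurable_funM => //; exact: measurable_gaussian.
have f_0 m x : (0 <= f_ m x)%E by rewrite lee_fin mulr_ge0// gaussian_ge0.
have lf : (fun x => (f x)%:E) = (fun x => limn_einf (f_^~ x)).
  apply/funext => x.
  have cx : f_ m x @[m --> \oo] --> (f x)%:E.
    apply: cvg_EFin; first exact: nearW.
    rewrite -[X in _ --> X]mulr1; apply: cvgM; first exact: cvg_cst.
    exact: gaussian_cvg1.
  rewrite is_cvg_limn_einfE; first by apply/esym/cvg_lim.
  by apply/cvg_ex; exists (f x)%:E.
rewrite lf; apply: le_trans (fatou _ measurableT mf_ (fun m x _ => f_0 m x)) _.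
rewrite limn_einf_lim; apply: lime_le; first exact: is_cvg_einfs.
apply: nearW => m; apply: (@le_trans _ _ (\int[lebesgue_rV n]_x f_ m x)%E).
  by apply: ereal_inf_lbound; exists m => //=.
by apply: fC; rewrite invr_gt0 ltr0n.
Qed.

End gaussian_space.

(** * Plancherel inequality and Fourier inversion *)

Section cauchy_schwarz.
Context d (T : measurableType d) (R : realType) (mu : {measure set T -> \bar R}).

Lemma rintegrable_mul_sqr (a b : T -> R) : measurable_fun setT a -> measurable_fun setT b ->
  rintegrable mu (fun x => a x ^+ 2) -> rintegrable mu (fun x => b x ^+ 2) ->
  rintegrable mu (fun x => a x * b x).
Proof.
move=> ma mb Ia Ib; apply: rintegrable_le (rintegrableD Ia Ib); first exact: measurable_funM.
move=> x; have := sqr_ge0 (`|a x| - `|b x|); rewrite sqrrB !real_normK ?num_real// normrM => h.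
have : 0 <= `|a x| * `|b x| by exact: mulr_ge0.
lra.
Qed.

(* The discriminant argument at [s = B / (K + 1)], which also covers [K = 0]. *)
Lemma Rint_cauchy_schwarz (a b : T -> R) : measurable_fun setT a -> measurable_fun setT b ->
  rintegrable mu (fun x => a x ^+ 2) -> rintegrable mu (fun x => b x ^+ 2) ->
  (\int[mu]_x (a x * b x))%R ^+ 2 <=
  (\int[mu]_x (a x ^+ 2))%R * ((\int[mu]_x (b x ^+ 2))%R + 1).
Proof.
move=> ma mb Ia Ib; have Iab := rintegrable_mul_sqr ma mb Ia Ib.
set A := (\int[mu]_x (a x ^+ 2))%R; set K := (\int[mu]_x (b x ^+ 2))%R.
set B := (\int[mu]_x (a x * b x))%R.
have K0 : 0 <= K by apply: Rint_ge0 => x; exact: sqr_ge0.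
pose s := B / (K + 1).
have K1 : 0 < K + 1 by rewrite ltr_wpDl.
have H : 0 <= A - 2 * s * B + s ^+ 2 * K.
  have I2 := rintegrableZl (2 * s) Iab; have I3 := rintegrableZl (s ^+ 2) Ib.
  have <- : (\int[mu]_x (a x ^+ 2 - 2 * s * (a x * b x) + s ^+ 2 * b x ^+ 2))%R =
    A - 2 * s * B + s ^+ 2 * K.
    by rewrite RintD ?RintB ?RintZl//; exact: rintegrableB.
  apply: Rint_ge0 => x; have -> : a x ^+ 2 - 2 * s * (a x * b x) + s ^+ 2 * b x ^+ 2 =
    (a x - s * b x) ^+ 2 by ring.
  exact: sqr_ge0.
have Bs : B = s * (K + 1) by rewrite divfK// gt_eqF.
have : s ^+ 2 * (K + 2) <= A.
  by move: H; rewrite {1}Bs; lra.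
move=> H2; rewrite Bs exprMn; apply: le_trans (_ : s ^+ 2 * (K + 2) * (K + 1) <= _).
  rewrite -mulrA ler_wpM2l ?sqr_ge0//; nra.
by rewrite ler_wpM2r// ltW.
Qed.

Lemma ge0_fin_rintegrable (u : T -> R) : measurable_fun setT u -> (forall x, 0 <= u x) ->
  (\int[mu]_x (u x)%:E < +oo)%E -> rintegrable mu u.
Proof.
move=> mu' u0 lu; apply/rintegrableP; split => //.
by under eq_integral do rewrite ger0_norm//.
Qed.

End cauchy_schwarz.

Section fourier_transform.
Context {R : realType} (n : nat).
Local Notation E := 'rV[R]_n.
Local Notation mu := (@lebesgue_rV R n).
Implicit Types (f g w k : E -> R[i]).

Lemma in_L1_cintegrable f : in_L1 f -> cintegrable mu f.
Proof. by move=> [mf lf]; exact: cintegrableP. Qed.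

Lemma cintegrable_in_L1 f : cintegrable mu f -> in_L1 f.
Proof. by move=> If; split; [exact: cintegrable_meas If|exact: cintegrable_lty]. Qed.

Lemma in_L2P f : in_L2 f <-> cmeas f /\ rintegrable mu (fun x => normc (f x) ^+ 2).
Proof.
split=> [[mf lf]|[mf lf]]; split => //.
  apply: ge0_fin_rintegrable => //; last by move=> x; exact: sqr_ge0.
  by apply: measurable_funX; exact: cmeas_normc.
by rewrite /sqnorm_L2 -EFin_Rint// ltry.
Qed.

Lemma sqnorm_L2E f : in_L2 f -> sqnorm_L2 f = (\int[mu]_x (normc (f x) ^+ 2))%R%:E.
Proof. by move=> /in_L2P[mf If]; rewrite /sqnorm_L2 EFin_Rint. Qed.

Lemma in_L2D f g : in_L2 f -> in_L2 g -> in_L2 (fun x => f x + g x).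
Proof.
move=> /in_L2P[mf If] /in_L2P[mg Ig]; apply/in_L2P; split; first exact: cmeasD.
apply: rintegrable_le (rintegrableD (rintegrableZl 2 If) (rintegrableZl 2 Ig)).
  by apply: measurable_funX; apply: cmeas_normc; exact: cmeasD.
move=> x; rewrite ger0_norm ?sqr_ge0//.
have h1 := normcD (f x) (g x); have h2 := normc_ge0 (f x + g x).
have := sqr_ge0 (normc (f x) - normc (g x)); nra.
Qed.

Lemma in_L2N f : in_L2 f -> in_L2 (fun x => - f x).
Proof.
move=> /in_L2P[mf If]; apply/in_L2P; split; first exact: cmeasN.
by apply: eq_rintegrable If => x; rewrite normcN.
Qed.

Lemma in_L2B f g : in_L2 f -> in_L2 g -> in_L2 (fun x => f x - g x).
Proof. by move=> Lf Lg; apply: in_L2D => //; exact: in_L2N. Qed.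

Lemma in_L2_mul f g : in_L2 f -> in_L2 g -> cintegrable mu (fun x => f x * g x).
Proof.
move=> /in_L2P[mf If] /in_L2P[mg Ig].
apply: (@cintegrable_le _ _ _ _ _ (fun x => normc (f x) * normc (g x))).
- exact: cmeasM.
- by move=> x; rewrite normcM.
- by apply: rintegrable_mul_sqr => //; exact: cmeas_normc.
Qed.

Lemma cint_cauchy_schwarz f g : in_L2 f -> in_L2 g ->
  normc (cint mu (fun x => f x * g x)) ^+ 2 <=
  (\int[mu]_x (normc (f x) ^+ 2))%R * ((\int[mu]_x (normc (g x) ^+ 2))%R + 1).
Proof.
move=> Lf Lg; have /in_L2P[mf If] := Lf; have /in_L2P[mg Ig] := Lg.
apply: le_trans (Rint_cauchy_schwarz (cmeas_normc mf) (cmeas_normc mg) If Ig).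
rewrite ler_pXn2r// ?nnegrE ?normc_ge0//; last first.
  by apply: Rint_ge0 => x; rewrite mulr_ge0// normc_ge0.
apply: le_trans (normc_cint_le (in_L2_mul Lf Lg)) _.
by rewrite le_eqVlt; apply/orP; left; apply/eqP; apply: eq_Rint => x; rewrite normcM.
Qed.

(** Cauchy-Schwarz. It carries identities known along the approximating sequence of [fourier_L2] to
    the limit. *)
Lemma L2_pairing_cvg (v_ : nat -> E -> R[i]) v k : (forall m, in_L2 (v_ m)) ->
  in_L2 v -> in_L2 k -> sqnorm_L2 (fun x => v_ m x - v x) @[m --> \oo] --> 0%E ->
  normc (cint mu (fun x => v_ m x * k x) - cint mu (fun x => v x * k x)) @[m --> \oo] --> (0 : R).
Proof.
move=> Lv_ Lv Lk cv.
have Ld m : in_L2 (fun x => v_ m x - v x) by exact: in_L2B.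
have cv' : (\int[mu]_x (normc (v_ m x - v x) ^+ 2))%R @[m --> \oo] --> (0 : R).
  have -> : (fun m => (\int[mu]_x (normc (v_ m x - v x) ^+ 2))%R) =
      fine \o (fun m => sqnorm_L2 (fun x => v_ m x - v x)).
    by apply/funext => m; rewrite /= sqnorm_L2E.
  exact: fine_cvg cv.
set K := (\int[mu]_x (normc (k x) ^+ 2))%R + 1.
have b m : normc (cint mu (fun x => v_ m x * k x) - cint mu (fun x => v x * k x)) <=
    Num.sqrt ((\int[mu]_x (normc (v_ m x - v x) ^+ 2))%R * K).
  rewrite -cintB; [|exact: in_L2_mul..].
  rewrite -[leLHS]ger0_norm ?normc_ge0// -sqrtr_sqr ler_wsqrtr//.
  apply: le_trans (cint_cauchy_schwarz (Ld m) Lk).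
  rewrite le_eqVlt; apply/orP; left; apply/eqP; congr (normc _ ^+ 2).
  by apply: eq_cint => x; rewrite mulrBl.
apply: (@squeeze_cvgr _ _ _ _ (fun=> 0) (fun m => Num.sqrt ((\int[mu]_x (normc (v_ m x - v x) ^+ 2))%R * K))).
- by apply: nearW => m; rewrite normc_ge0 b.
- exact: cvg_cst.
- have c2 : (\int[mu]_x (normc (v_ m x - v x) ^+ 2))%R * K @[m --> \oo] --> (0 : R).
    by rewrite -[X in _ --> X](mul0r K); apply: cvgM => //; exact: cvg_cst.
  rewrite -[X in _ --> X]sqrtr0.
  by apply: (@cvg_comp _ _ _ (fun m => (\int[mu]_x (normc (v_ m x - v x) ^+ 2))%R * K) Num.sqrt);
    [exact: c2|exact: sqrt_continuous].
Qed.

Lemma cmeas_character : cmeas (fun p : E * E => cis (- dot p.1 p.2)).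
Proof.
by apply: cmeas_cis; apply: measurableT_comp => //; apply: measurable_dot.
Qed.

Lemma cmeas_character1 (s : E) : cmeas (fun x : E => cis (dot x s)).
Proof. by apply: cmeas_cis; apply: measurable_dot. Qed.

Lemma cintegrable_character w (u : E -> R) : cintegrable mu w -> measurable_fun setT u ->
  cintegrable mu (fun x => w x * cis (u x)).
Proof.
move=> Iw mu'; apply: (cintegrableMl (B := 1)) => //; first exact: cmeas_cis.
by move=> x; rewrite normc_cis.
Qed.

Lemma fourierE w t : fourier w t = cint mu (fun x => w x * cis (- dot x t)).
Proof. by []. Qed.

Lemma measurable_dotr (t : E) : measurable_fun setT (fun x : E => dot x t).
Proof. exact: measurable_dot. Qed.

Lemma measurable_Ndotr (t : E) : measurable_fun setT (fun x : E => - dot x t).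
Proof. by apply: measurableT_comp => //; exact: measurable_dotr. Qed.

Lemma fourier_integrand w t : cintegrable mu w ->
  cintegrable mu (fun x => w x * cis (- dot x t)).
Proof. by move=> Iw; apply: cintegrable_character => //; exact: measurable_Ndotr. Qed.

Lemma cmeas_fourier w : cmeas w -> cmeas (fourier w).
Proof.
move=> mw; have := @cmeas_cint _ _ _ _ R mu (fun p : E * E => w p.2 * cis (- dot p.2 p.1)) _.
apply; apply: cmeasM; first exact: (cmeas_comp mw measurable_snd).
apply: cmeas_cis; apply: measurableT_comp => //; apply: measurable_dot => //.
Qed.

Lemma normc_fourier w t : cintegrable mu w ->
  normc (fourier w t) <= (\int[mu]_x normc (w x))%R.
Proof.
move=> Iw; apply: le_trans (normc_cint_le (fourier_integrand t Iw)) _.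
rewrite le_eqVlt; apply/orP; left; apply/eqP; apply: eq_Rint => x.
by rewrite normcM normc_cis mulr1.
Qed.

(** The multiplication formula: the character is symmetric in its two variables, so exchanging the
    integrals moves the transform from one factor to the other. *)
Lemma fourier_exchange w k : cintegrable mu w -> cintegrable mu k ->
  cint mu (fun t => fourier w t * k t) = cint mu (fun x => w x * fourier k x).
Proof.
move=> Iw Ik.
have [|_ <-] := cint_exchange (B := 1) Iw Ik cmeas_character.
  by move=> p; rewrite normc_cis.
apply: eq_cint => x; congr (_ * _); apply: eq_cint => t.
by rewrite mulrC dotC.
Qed.

Lemma fourier_gaussian_shift e (x y : E) : 0 < e ->
  fourier (fun t => (gaussian e t)%:C%C * cis (dot t x)) y = (heat_kernel e (y - x))%:C%C.
Proof.
move=> e0; rewrite -(gaussian_fourier (y - x) e0).2; apply: eq_cint => t.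
by rewrite -mulrA -cisD dotBl opprB (dotC x t) (dotC y t).
Qed.

Lemma cintegrable_gaussian e : 0 < e -> cintegrable mu (fun t => (gaussian e t)%:C%C).
Proof. by move=> e0; apply: cintegrable_real; exact: rintegrable_gaussian. Qed.

Lemma cintegrable_gaussian_char e (x : E) : 0 < e ->
  cintegrable mu (fun t => (gaussian e t)%:C%C * cis (dot t x)).
Proof.
by move=> e0; apply: cintegrable_character; [exact: cintegrable_gaussian|exact: measurable_dotr].
Qed.

(** Regularized inversion. The Gaussian factor makes the frequency side integrable for every
    integrable [w], and its own transform is the heat kernel centered at [x]. *)
Lemma fourier_gaussian_exchange e w (x : E) : 0 < e -> cintegrable mu w ->
  cint mu (fun t => fourier w t * ((gaussian e t)%:C%C * cis (dot t x))) =
  cint mu (fun y => w y * (heat_kernel e (y - x))%:C%C).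
Proof.
move=> e0 Iw; rewrite fourier_exchange//; last exact: cintegrable_gaussian_char.
by apply: eq_cint => y; rewrite fourier_gaussian_shift.
Qed.

Lemma rintegrable_heat_shift e (x : E) : 0 < e ->
  rintegrable mu (fun y => heat_kernel e (y - x)).
Proof.
by move=> e0; apply: (rintegrable_preserving (shiftB_preserving x)); exact: rintegrable_heat_kernel.
Qed.

Lemma Rint_heat_shift e (x : E) : 0 < e ->
  (\int[mu]_y heat_kernel e (y - x) = (2 * pi) ^+ n)%R.
Proof.
move=> e0; rewrite (Rint_preserving (shiftB_preserving x)) ?Rint_heat_kernel//.
exact: measurable_heat_kernel.
Qed.

End fourier_transform.

(** * Plancherel's inequality and uniqueness of the L2 transform *)

Section plancherel.
Context {R : realType} (n : nat).
Local Notation E := 'rV[R]_n.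
Local Notation mu := (@lebesgue_rV R n).
Implicit Types (f g w k : E -> R[i]).

Lemma measurable_heat_diff e : measurable_fun setT (fun p : E * E => heat_kernel e (p.2 - p.1)).
Proof.
apply: (measurableT_comp (@measurable_heat_kernel R n e)).
exact: measurable_rV_sub.
Qed.

Lemma measurable_heat_shift e (x : E) :
  measurable_fun setT (fun y : E => heat_kernel e (y - x)).
Proof.
apply: (measurableT_comp (@measurable_heat_kernel R n e)).
exact: measurable_rV_sub.
Qed.

Lemma heat_product_ge0 e w (x y z : E) :
  0 <= normc (w x) * (normc (w y) * heat_kernel e z) :> R.
Proof. by rewrite mulr_ge0 ?normc_ge0// mulr_ge0 ?normc_ge0 ?heat_kernel_ge0. Qed.

(* Schur's test for the symmetric kernel [heat_kernel e (y - x)]. *)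
Lemma heat_schur e w : 0 < e -> in_L2 w ->
  (\int[mu]_x \int[mu]_y (normc (w x) * (normc (w y) * heat_kernel e (y - x)))%:E <=
   ((2 * pi) ^+ n * \int[mu]_x (normc (w x) ^+ 2))%R%:E)%E.
Proof.
move=> e0 /in_L2P[mw Iw].
have mn : measurable_fun setT (fun x => normc (w x)) by exact: cmeas_normc.
have mh := measurable_heat_diff e.
have m1 : measurable_fun setT (fun p : E * E => normc (w p.1)) by exact: (measurableT_comp mn).
have m2 : measurable_fun setT (fun p : E * E => normc (w p.2)) by exact: (measurableT_comp mn).
(* Pointwise a b <= (a^2 + b^2)/2, and the two squares lead to [F1] and [F2]. Their double integrals
   are equal by symmetry of the kernel, and that of [F1] is the mass of the kernel times the squared
   norm of [w]. *)
pose F1 (p : E * E) := (normc (w p.1) ^+ 2 * heat_kernel e (p.2 - p.1)).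
pose F2 (p : E * E) := (normc (w p.2) ^+ 2 * heat_kernel e (p.2 - p.1)).
have mF1 : measurable_fun setT F1 by apply: measurable_funM => //; exact: measurable_funX.
have mF2 : measurable_fun setT F2 by apply: measurable_funM => //; exact: measurable_funX.
have F10 p : (0 <= (F1 p)%:E)%E by rewrite lee_fin mulr_ge0 ?sqr_ge0 ?heat_kernel_ge0.
have F20 p : (0 <= (F2 p)%:E)%E by rewrite lee_fin mulr_ge0 ?sqr_ge0 ?heat_kernel_ge0.
set C := ((2 * pi) ^+ n * _)%R.
have E1 : (\int[mu]_x \int[mu]_y (F1 (x, y))%:E = C%:E)%E.
  have Ex x : (\int[mu]_y (F1 (x, y))%:E)%E = (normc (w x) ^+ 2 * (2 * pi) ^+ n)%:E.
    rewrite -(Rint_heat_shift x e0) -RintZl; last exact: rintegrable_heat_shift.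
    by rewrite EFin_Rint//; apply: rintegrableZl; exact: rintegrable_heat_shift.
  under eq_integral do rewrite Ex.
  by rewrite -EFin_Rint; [rewrite RintZr// mulrC|exact: rintegrableZr].
have E2 : (\int[mu]_x \int[mu]_y (F2 (x, y))%:E = C%:E)%E.
  transitivity (\int[mu]_y \int[mu]_x (F2 (x, y))%:E)%E.
    exact: (fubini_tonelli _ ((measurable_EFinP _ _).2 mF2) F20).
  rewrite -E1; apply: eq_integral => x _; apply: eq_integral => y _.
  by rewrite /F1 /F2 /= -opprB heat_kernelN.
have -> : C%:E = (\int[mu]_x \int[mu]_y (2^-1 * (F1 (x, y) + F2 (x, y)))%:E)%E.
  have -> : C%:E = ((2^-1)%:E * (C%:E + C%:E))%E by rewrite -EFinD -EFinM; congr EFin; lra.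
  have mG1 := measurable_fun_fubini_tonelli_F (m2 := mu) _ ((measurable_EFinP _ _).2 mF1) F10.
  have mG2 := measurable_fun_fubini_tonelli_F (m2 := mu) _ ((measurable_EFinP _ _).2 mF2) F20.
  have G10 x : (0 <= fubini_F mu (EFin \o F1) x)%E by apply: integral_ge0 => y _; exact: F10.
  have G20 x : (0 <= fubini_F mu (EFin \o F2) x)%E by apply: integral_ge0 => y _; exact: F20.
  have mG := emeasurable_funD mG1 mG2.
  rewrite -{1}E1 -E2 -[X in (_ * X)%E](ge0_integralD mu measurableT (fun x _ => G10 x) mG1 (fun x _ => G20 x) mG2).
  have G0 x : (0 <= (fubini_F mu (EFin \o F1) x + fubini_F mu (EFin \o F2) x))%E.
    exact: adde_ge0.
  rewrite -[LHS](ge0_integralZl mu measurableT mG (fun x _ => G0 x)) ?lee_fin//.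
  apply: eq_integral => x _.
  have mx1 : measurable_fun setT (fun y => (F1 (x, y))%:E).
    by apply/measurable_EFinP; exact: (measurableT_comp mF1).
  have mx2 : measurable_fun setT (fun y => (F2 (x, y))%:E).
    by apply/measurable_EFinP; exact: (measurableT_comp mF2).
  have mx := emeasurable_funD mx1 mx2.
  have x0 y : (0 <= ((F1 (x, y))%:E + (F2 (x, y))%:E))%E by exact: adde_ge0.
  rewrite -[X in (_ * X)%E](ge0_integralD mu measurableT (fun y _ => F10 (x, y)) mx1 (fun y _ => F20 (x, y)) mx2).
  by rewrite -[LHS](ge0_integralZl mu measurableT mx (fun y _ => x0 y)) ?lee_fin.
apply: ge0_le_integral => //.
- move=> x _; apply: integral_ge0 => y _.
  by rewrite lee_fin; apply: heat_product_ge0.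
- apply: (measurable_fun_fubini_tonelli_F (m2 := mu)
    (fun p : E * E => (normc (w p.1) * (normc (w p.2) * heat_kernel e (p.2 - p.1)))%:E)).
    by apply/measurable_EFinP; apply: measurable_funM => //; exact: measurable_funM.
  by move=> p; rewrite lee_fin; apply: heat_product_ge0.
- apply: (measurable_fun_fubini_tonelli_F (m2 := mu)
    (fun p : E * E => (2^-1 * (F1 p + F2 p))%:E)).
    by apply/measurable_EFinP; apply: measurable_funM => //; exact: measurable_funD.
  by move=> p; rewrite lee_fin mulr_ge0// addr_ge0// -lee_fin.
move=> x _; apply: ge0_le_integral => //.
- by move=> y _; rewrite lee_fin; apply: heat_product_ge0.
- apply/measurable_EFinP; apply: measurable_funM => //.
  by apply: measurable_funM => //; exact: measurable_heat_shift.
- apply/measurable_EFinP; apply: measurable_funM => //; apply: measurable_funD.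
    by rewrite /F1 /=; apply: measurable_funM => //; exact: measurable_heat_shift.
  rewrite /F2 /=; apply: measurable_funM; last exact: measurable_heat_shift.
  exact: (measurable_funX _ mn).
- move=> y _; rewrite lee_fin /F1 /F2 /= -mulrDl [leLHS]mulrA [leRHS]mulrA ler_wpM2r ?heat_kernel_ge0//.
  set a := normc (w x); set b := normc (w y).
  have := sqr_ge0 (a - b); rewrite sqrrB; lra.
Qed.

(** One of the two factors of |w^|^2 is kept with the Gaussian, and the multiplication formula moves
    the other transform onto it. The result is the double integral of w(x) conj(w(y)) against the
    heat kernel, which Schur's test bounds. *)
Lemma plancherel_gaussian e w : 0 < e -> in_L1 w -> in_L2 w ->
  (\int[mu]_t (normc (fourier w t) ^+ 2 * gaussian e t)%:E <=
   ((2 * pi) ^+ n * \int[mu]_x (normc (w x) ^+ 2))%R%:E)%E.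
Proof.
move=> e0 /in_L1_cintegrable Iw Lw; apply: le_trans (heat_schur e0 Lw).
have mw := cintegrable_meas Iw.
have mf := cmeas_fourier mw.
set M := (\int[mu]_x normc (w x))%R.
have fM t : normc (fourier w t) <= M by exact: normc_fourier.
pose k t : R[i] := ((fourier w t)^*)%C * (gaussian e t)%:C%C.
have Ik : cintegrable mu k.
  apply: (cintegrableMr (B := M)); first exact: cintegrable_gaussian.
    exact: cmeas_conj.
  by move=> t; rewrite normc_conj.
have kE x : fourier k x = ((cint mu (fun y => w y * (heat_kernel e (y - x))%:C%C))^*)%C.
  rewrite -fourier_gaussian_exchange// -cint_conj; last first.
    apply: (cintegrableMr (B := M)) => //; exact: cintegrable_gaussian_char.
  by apply: eq_cint => t; rewrite !conjcM conjc_real conj_cis mulrA.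
have Ig : rintegrable mu (fun t => normc (fourier w t) ^+ 2 * gaussian e t).
  apply: rintegrable_le (rintegrableZl (M ^+ 2) (rintegrable_gaussian n e0)).
    by apply: measurable_funM; [apply: measurable_funX; exact: cmeas_normc|exact: measurable_gaussian].
  move=> t; rewrite normrM (ger0_norm (gaussian_ge0 _ _)) ler_wpM2r ?gaussian_ge0//.
  rewrite ger0_norm ?sqr_ge0// ler_pXn2r// nnegrE ?normc_ge0//.
  exact: le_trans (normc_ge0 _) (fM t).
have Iwk : cintegrable mu (fun x => w x * fourier k x).
  apply: (cintegrableMl (B := (\int[mu]_x normc (k x))%R)) => //.
    exact: cmeas_fourier (cintegrable_meas Ik).
  by move=> x; exact: normc_fourier.
have Iwh x : cintegrable mu (fun y => w y * (heat_kernel e (y - x))%:C%C).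
  have hb y : `|heat_kernel e (y - x)| <= Num.sqrt (pi / e) ^+ n.
    rewrite ger0_norm ?heat_kernel_ge0// ler_piMr ?exprn_ge0 ?sqrtr_ge0//.
    by rewrite gaussian_le1// invr_ge0 mulr_ge0// ltW.
  apply: (cintegrableMl (B := Num.sqrt (pi / e) ^+ n)) => //.
    by apply: cmeas_real; exact: measurable_heat_shift.
  by move=> y; rewrite normc_real.
rewrite -EFin_Rint//.
have -> : (\int[mu]_t (normc (fourier w t) ^+ 2 * gaussian e t))%R =
    Re (cint mu (fun x => w x * fourier k x)).
  rewrite -fourier_exchange//; apply: eq_Rint => t.
  by rewrite mulrA mulc_conj -real_complexM.
apply: (@le_trans _ _ (\int[mu]_x normc (w x * fourier k x))%R%:E).
  rewrite lee_fin (le_trans (ler_norm _))// (le_trans (Re_le_normc _))//.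
  exact: normc_cint_le.
rewrite EFin_Rint; last exact: cintegrable_normc.
apply: ge0_le_integral => //.
- by move=> x _; rewrite lee_fin normc_ge0.
- by apply/measurable_EFinP; apply: cmeas_normc; exact: cintegrable_meas Iwk.
- apply: (measurable_fun_fubini_tonelli_F (m2 := mu)
    (fun p : E * E => (normc (w p.1) * (normc (w p.2) * heat_kernel e (p.2 - p.1)))%:E)).
    have mn := cmeas_normc mw.
    apply/measurable_EFinP; apply: measurable_funM; first exact: (measurableT_comp mn).
    by apply: measurable_funM; [exact: (measurableT_comp mn)|exact: measurable_heat_diff].
  by move=> p; rewrite lee_fin; apply: heat_product_ge0.
move=> x _; rewrite normcM kE normc_conj.
have nE y : normc (w y * (heat_kernel e (y - x))%:C%C) = normc (w y) * heat_kernel e (y - x).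
  by rewrite normcM normc_real ger0_norm ?heat_kernel_ge0.
have In : rintegrable mu (fun y => normc (w y) * heat_kernel e (y - x)).
  by apply: eq_rintegrable (cintegrable_normc (Iwh x)).
rewrite -EFin_Rint; last exact: rintegrableZl.
rewrite lee_fin RintZl// ler_wpM2l ?normc_ge0//.
apply: le_trans (normc_cint_le (Iwh x)) _.
by rewrite le_eqVlt (eq_Rint _ nE) eqxx.
Qed.

(** The regularized bound is uniform in [e], so the Gaussian can be removed by [gaussian_bound]. *)
Lemma plancherel_le w : in_L1 w -> in_L2 w ->
  (sqnorm_L2 (fourier w) <= ((2 * pi) ^+ n)%:E * sqnorm_L2 w)%E.
Proof.
move=> L1w L2w; rewrite (sqnorm_L2E L2w) -EFinM; apply: gaussian_bound.
- by apply: measurable_funX; apply: cmeas_normc; apply: cmeas_fourier; case: L1w.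
- by move=> x; exact: sqr_ge0.
- by move=> e e0; exact: plancherel_gaussian.
Qed.

Lemma in_L2_fourier w : in_L1 w -> in_L2 w -> in_L2 (fourier w).
Proof.
move=> L1w L2w; split; first by apply: cmeas_fourier; case: L1w.
apply: le_lt_trans (plancherel_le L1w L2w) _.
by rewrite (sqnorm_L2E L2w) -EFinM ltry.
Qed.

Lemma sqnorm_L2D f g : in_L2 f -> in_L2 g ->
  (sqnorm_L2 (fun x => f x + g x)%R <= 2%:E * (sqnorm_L2 f + sqnorm_L2 g))%E.
Proof.
move=> Lf Lg; rewrite (sqnorm_L2E (in_L2D Lf Lg)) (sqnorm_L2E Lf) (sqnorm_L2E Lg).
have /in_L2P[_ If] := Lf; have /in_L2P[_ Ig] := Lg.
have /in_L2P[_ Ifg] := in_L2D Lf Lg.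
rewrite -EFinD -EFinM lee_fin -RintD// -RintZl; last exact: rintegrableD.
apply: Rint_le => //; first by apply: rintegrableZl; exact: rintegrableD.
move=> x; have h1 := normcD (f x) (g x); have h2 := normc_ge0 (f x + g x).
have := sqr_ge0 (normc (f x) - normc (g x)); nra.
Qed.

Lemma fourierB f g t : in_L1 f -> in_L1 g ->
  fourier (fun x => f x - g x) t = fourier f t - fourier g t.
Proof.
move=> /in_L1_cintegrable If /in_L1_cintegrable Ig; rewrite !fourierE -cintB; [|exact: fourier_integrand..].
by apply: eq_cint => x; rewrite mulrBl.
Qed.

Lemma sqnorm_L2N f : sqnorm_L2 (fun x => - f x) = sqnorm_L2 f.
Proof. by apply: eq_integral => x _; rewrite normcN. Qed.

Lemma in_L1B f g : in_L1 f -> in_L1 g -> in_L1 (fun x => f x - g x).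
Proof.
move=> /in_L1_cintegrable If /in_L1_cintegrable Ig.
by apply: cintegrable_in_L1; exact: cintegrableB.
Qed.

(** g1 - g2 is split through the transforms of u_m and v_m, the two approximating sequences. The
    middle difference is the transform of u_m - v_m, which Plancherel's inequality controls by the
    distances of u_m and v_m to [f]; [B m] collects the constants. *)
Lemma fourier_L2_unique f g1 g2 : fourier_L2 f g1 -> fourier_L2 f g2 ->
  sqnorm_L2 (fun t => g1 t - g2 t) = 0%E.
Proof.
move=> [Lf Lg1 [u [Lu uf ug]]] [_ Lg2 [v [Lv vf vg]]].
have D := in_L2B Lg1 Lg2.
pose B m := (2%:E * (sqnorm_L2 (fun t => (fourier (u m) t - g1 t)%R) +
  2%:E * (((2 * pi) ^+ n)%:E * (2%:E * (sqnorm_L2 (fun x => (u m x - f x)%R) + sqnorm_L2 (fun x => (v m x - f x)%R))) +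
   sqnorm_L2 (fun t => (fourier (v m) t - g2 t)%R))))%E.
have b m : (sqnorm_L2 (fun t => (g1 t - g2 t)%R) <= B m)%E.
  have [L1u L2u] := Lu m; have [L1v L2v] := Lv m.
  have La := in_L2_fourier L1u L2u; have Lb := in_L2_fourier L1v L2v.
  have -> : sqnorm_L2 (fun t => g1 t - g2 t) = sqnorm_L2 (fun t =>
      - (fourier (u m) t - g1 t) + ((fourier (u m) t - fourier (v m) t) + (fourier (v m) t - g2 t))).
    by congr sqnorm_L2; apply/funext => t; ring.
  apply: le_trans (sqnorm_L2D (in_L2N (in_L2B La Lg1)) (in_L2D (in_L2B La Lb) (in_L2B Lb Lg2))) _.
  rewrite sqnorm_L2N /B; apply: lee_pmul => //.
  - by rewrite adde_ge0// integral_ge0// => x _; rewrite lee_fin sqr_ge0.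
  - apply: leeD => //.
  apply: le_trans (sqnorm_L2D (in_L2B La Lb) (in_L2B Lb Lg2)) _.
  apply: lee_pmul => //.
  - by rewrite adde_ge0// integral_ge0// => x _; rewrite lee_fin sqr_ge0.
  - apply: leeD => //.
  have -> : (fun t => fourier (u m) t - fourier (v m) t) = fourier (fun x => u m x - v m x).
    by apply/funext => t; rewrite fourierB.
  apply: le_trans (plancherel_le (in_L1B L1u L1v) (in_L2B L2u L2v)) _.
  apply: lee_pmul => //.
  - by rewrite lee_fin exprn_ge0// mulr_ge0// pi_ge0.
  - by rewrite integral_ge0// => x _; rewrite lee_fin sqr_ge0.
  have -> : sqnorm_L2 (fun x => u m x - v m x) = sqnorm_L2 (fun x => (u m x - f x) + - (v m x - f x)).
    by congr sqnorm_L2; apply/funext => x; ring.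
  apply: le_trans (sqnorm_L2D (in_L2B L2u Lf) (in_L2N (in_L2B L2v Lf))) _.
  by rewrite sqnorm_L2N.
have cB : B m @[m --> \oo] --> 0%E.
  have f0 : 0%E \is a @fin_num R by [].
  have cZ (c : R) (a : nat -> \bar R) : a m @[m --> \oo] --> 0%E -> (c%:E * a m)%E @[m --> \oo] --> 0%E.
    by move=> ca; rewrite -(mule0 c%:E); exact: cvgeZl.
  have cD (a a' : nat -> \bar R) : a m @[m --> \oo] --> 0%E -> a' m @[m --> \oo] --> 0%E ->
      (a m + a' m)%E @[m --> \oo] --> 0%E.
    by move=> ca ca'; rewrite -(adde0 0%E); apply: cvgeD.
  by apply/cZ/cD => //; apply/cZ/cD => //; apply/cZ/cZ/cD.
apply/eqP; rewrite eq_le; apply/andP; split.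
  have /cvg_lim <- // := cB; apply: lime_ge; first by apply/cvg_ex; exists 0%E.
  exact: nearW.
by apply: integral_ge0 => x _; rewrite lee_fin sqr_ge0.
Qed.

End plancherel.

(** * Pointwise Fourier inversion *)

Section inversion.
Context {R : realType} (n : nat).
Local Notation E := 'rV[R]_n.
Local Notation mu := (@lebesgue_rV R n).
Implicit Types (f g w k : E -> R[i]).

(* [exp (b M) >= (1 + b M / (n + 1)) ^ (n + 1)] beats [sqrt (a M) ^ n]. *)
Lemma pow_exp_cvg0 (a b : R) : 0 < a -> 0 < b ->
  Num.sqrt (a * m.+1%:R) ^+ n * expR (- (b * m.+1%:R)) @[m --> \oo] --> (0 : R).
Proof.
move=> a0 b0; pose b' := b / n.+1%:R; have b'0 : 0 < b' by rewrite divr_gt0.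
pose K := 1 + a / b'; have K0 : 0 < K by rewrite ltr_wpDr// divr_ge0 ?ltW.
apply: (@squeeze_cvgr _ _ _ _ (fun=> 0) (fun m => K ^+ n / b' * harmonic m)).
- apply: nearW => m; rewrite mulr_ge0 ?exprn_ge0 ?sqrtr_ge0 ?expR_ge0//=.
  set M : R := m.+1%:R; have M0 : 0 < M by rewrite ltr0n.
  have B0 : 0 < 1 + b' * M by rewrite ltr_wpDr// mulr_ge0 ?ltW.
  have s1 : Num.sqrt (a * M) <= K * (1 + b' * M).
    have aM : 0 <= a * M by rewrite mulr_ge0 ?ltW.
    have h : Num.sqrt (a * M) <= 1 + a * M.
      have := sqr_ge0 (Num.sqrt (a * M) - 1); rewrite sqrrB1 sqr_sqrtr//.
      have := sqrtr_ge0 (a * M); lra.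
    apply: le_trans h _; rewrite /K mulrDr mulr1 mulrDl.
    rewrite mul1r (mulrA (a / b')) divfK ?gt_eqF//.
    have : 0 <= a / b' by rewrite divr_ge0 ?ltW.
    have : 0 <= b' * M by rewrite mulr_ge0 ?ltW.
    lra.
  have s2 : expR (- (b * M)) <= (1 + b' * M) ^- n.+1.
    rewrite expRN lef_pV2 ?posrE ?expR_gt0 ?exprn_gt0//.
    have -> : b * M = n.+1%:R * (b' * M) by rewrite mulrA [n.+1%:R * b']mulrC divfK.
    rewrite expRM_natl ler_pXn2r// ?nnegrE ?expR_ge0 ?(ltW B0)//.
    exact: expR_ge1Dx.
  apply: (@le_trans _ _ ((K * (1 + b' * M)) ^+ n * (1 + b' * M) ^- n.+1)).
    apply: ler_pM => //; rewrite ?exprn_ge0 ?sqrtr_ge0 ?expR_ge0//.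
    by apply: lerXn2r s1; rewrite nnegrE ?sqrtr_ge0// mulr_ge0// ltW.
  have -> : (K * (1 + b' * M)) ^+ n * (1 + b' * M) ^- n.+1 = K ^+ n * (1 + b' * M)^-1.
    rewrite exprMn exprSr invfM -mulrA; congr (_ * _).
    by rewrite mulrA divff ?mul1r// expf_neq0// gt_eqF.
  rewrite -mulrA ler_wpM2l ?exprn_ge0 ?(ltW K0)//.
  rewrite -invfM lef_pV2 ?posrE ?mulr_gt0//; lra.
- exact: cvg_cst.
- have h0 : harmonic m @[m --> \oo] --> (0 : R) := cvg_harmonic.
  by rewrite -[X in _ --> X](mulr0 (K ^+ n / b')); apply: cvgM; [exact: cvg_cst|exact: h0].
Qed.

(** With e = 1/M and M = m + 1 the exponent M |v|^2 / 4 is cut into halves: one is at least M s / 8,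
    the other at least |v|^2 / 8 because M >= 1. The second keeps a fixed Gaussian for
    integrability, the first drives the bound to 0. *)
Lemma heat_kernel_far (m : nat) (s : R) (v : E) : s <= dot v v ->
  heat_kernel m.+1%:R^-1 v <=
  Num.sqrt (pi * m.+1%:R) ^+ n * expR (- (s / 8 * m.+1%:R)) * gaussian 8^-1 v.
Proof.
move=> sv; rewrite /heat_kernel invrK -mulrA ler_wpM2l ?exprn_ge0 ?sqrtr_ge0//.
rewrite /gaussian -expRD ler_expR invfM invrK -opprD lerN2.
have M1 : 1 <= m.+1%:R :> R by rewrite ler1n.
have d0 := dot_ge0 v; nra.
Qed.

Lemma in_L2_rintegrable_gaussian f (e : R) (x : E) : 0 < e -> in_L2 f ->
  rintegrable mu (fun y => normc (f y) * gaussian e (y - x)).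
Proof.
move=> e0 /in_L2P[mf If].
have Ig : rintegrable mu (fun y => gaussian e (y - x)).
  by apply: (rintegrable_preserving (shiftB_preserving x)); exact: rintegrable_gaussian.
have mg : measurable_fun setT (fun y : E => gaussian e (y - x)).
  exact: rintegrable_measurable Ig.
apply: rintegrable_mul_sqr => //; first exact: cmeas_normc.
apply: rintegrable_le Ig; first exact: measurable_funX.
move=> y; rewrite ger0_norm ?sqr_ge0// expr2 ler_piMr ?gaussian_ge0//.
by rewrite gaussian_le1// ltW.
Qed.

(** Approximate identity for a square integrable [f], possibly unbounded: near [x] continuity bounds
    the oscillation, and away from [x] the fixed Gaussian of [heat_kernel_far] makes |f|
    integrable. *)
Lemma heat_approximation f (x : E) : in_L2 f ->
  {for x, continuous (fun y => Re (f y))} -> {for x, continuous (fun y => Im (f y))} ->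
  normc (cint mu (fun y => f y * (heat_kernel m.+1%:R^-1 (y - x))%:C%C) -
         f x * ((2 * pi) ^+ n)%:C%C) @[m --> \oo] --> (0 : R).
Proof.
move=> Lf cr ci; have /in_L2P[mf If] := Lf.
have e0 m : 0 < m.+1%:R^-1 :> R by rewrite invr_gt0 ltr0n.
have Ih m := rintegrable_heat_shift x (e0 m).
have mg8 := rintegrable_gaussian n (_ : 0 < 8^-1 :> R).
have e8 : 0 < 8^-1 :> R by rewrite invr_gt0.
have Ig : rintegrable mu (fun y => gaussian 8^-1 (y - x)).
  by apply: (rintegrable_preserving (shiftB_preserving x)); exact: rintegrable_gaussian.
have Ifg := in_L2_rintegrable_gaussian x e8 Lf.
have IG : rintegrable mu (fun y => (normc (f y) + normc (f x)) * gaussian 8^-1 (y - x)).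
  have := rintegrableD Ifg (rintegrableZl (normc (f x)) Ig).
  by apply: eq_rintegrable => y; rewrite mulrDl.
(* [G] bounds the far part up to the factor [c] below, which alone depends on [m]. *)
set G := (\int[mu]_y ((normc (f y) + normc (f x)) * gaussian 8^-1 (y - x)))%R.
have G0 : 0 <= G.
  by apply: Rint_ge0 => y; rewrite mulr_ge0 ?gaussian_ge0// addr_ge0 ?normc_ge0.
have Ifh m : cintegrable mu (fun y => f y * (heat_kernel m.+1%:R^-1 (y - x))%:C%C).
  apply: in_L2_mul => //; apply/in_L2P; split.
    by apply: cmeas_real; exact: measurable_heat_shift.
  apply: rintegrable_le (rintegrableZl (Num.sqrt (pi / m.+1%:R^-1) ^+ n) (Ih m)).
    by apply: measurable_funX; apply: cmeas_normc; apply: cmeas_real; exact: measurable_heat_shift.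
  move=> y; rewrite ger0_norm ?sqr_ge0// normc_real ger0_norm ?heat_kernel_ge0//.
  rewrite expr2 ler_wpM2r ?heat_kernel_ge0// ler_piMr ?exprn_ge0 ?sqrtr_ge0//.
  by rewrite gaussian_le1// invr_ge0 mulr_ge0// ltW.
have Id m : cintegrable mu (fun y => (f y - f x) * (heat_kernel m.+1%:R^-1 (y - x))%:C%C).
  have := cintegrableB (Ifh m) (cintegrableZ (f x) (cintegrable_real (Ih m))).
  by apply: eq_cintegrable => y; rewrite mulrBl.
have dE m : cint mu (fun y => f y * (heat_kernel m.+1%:R^-1 (y - x))%:C%C) -
         f x * ((2 * pi) ^+ n)%:C%C = cint mu (fun y => (f y - f x) * (heat_kernel m.+1%:R^-1 (y - x))%:C%C).
  rewrite -(Rint_heat_shift x (e0 m)) -cint_real -cintZ; last exact: cintegrable_real.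
  rewrite -cintB//; last by apply: cintegrableZ; exact: cintegrable_real.
  by apply: eq_cint => y; rewrite mulrBl.
apply/cvgrPdist_le => eta eta0.
pose P : R := (2 * pi) ^+ n; have P0 : 0 < P by rewrite exprn_gt0// mulr_gt0// pi_gt0.
(* The kernel has mass [P], so an oscillation of at most [h] near [x] contributes at most eta/2. *)
pose h := eta / (2 * P); have h0 : 0 < h by rewrite divr_gt0// mulr_gt0.
have [r r0 near] : exists2 r : R, 0 < r & forall y : E, dot (y - x) (y - x) < r -> normc (f y - f x) <= h.
  have h2 : 0 < h / 2 by rewrite divr_gt0.
  move/cvgrPdist_lt/(_ _ h2)/nbhs_ballP : cr => [r1 /= r10 B1].
  move/cvgrPdist_lt/(_ _ h2)/nbhs_ballP : ci => [r2 /= r20 B2].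
  pose r := Num.min r1 r2; have r0 : 0 < r by rewrite lt_min r10.
  exists (r ^+ 2); first by rewrite exprn_gt0.
  move=> y dy; have ball_ i : `|x ord0 i - y ord0 i| < r.
    rewrite -(ltr_pXn2r (n := 2)) ?nnegrE ?(ltW r0)// real_normK ?num_real//.
    apply: le_lt_trans dy; rewrite /dot (bigD1 i)//= !mxE -expr2 -sqrrN opprB lerDl.
    by apply: sumr_ge0 => j _; rewrite -expr2 sqr_ge0.
  have b1 : ball x r1 y.
    split=> // i j; rewrite !ord1 /ball/=; apply: lt_le_trans (ball_ j) _.
    by rewrite ge_min lexx.
  have b2 : ball x r2 y.
    split=> // i j; rewrite !ord1 /ball/=; apply: lt_le_trans (ball_ j) _.
    by rewrite ge_min lexx orbT.
  apply: le_trans (normc_le _) _; rewrite ReD ImD ReN ImN.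
  have := B1 _ b1; have := B2 _ b2; rewrite /= distrC (distrC (Re _)); lra.
(* For large [m] the far factor is at most eta/(2(G + 1)), so that the far part is at most eta/2;
   the added 1 keeps this threshold positive when G = 0. *)
have := pow_exp_cvg0 (pi_gt0 R) (_ : 0 < r / 8).
rewrite divr_gt0// => /(_ isT) /cvgrPdist_le /(_ (eta / (2 * (G + 1)))) [].
  by rewrite divr_gt0// mulr_gt0// ltr_wpDl.
move=> N _ HN; exists N => // m Nm /=.
rewrite sub0r normrN ger0_norm ?normc_ge0// dE.
set c := Num.sqrt (pi * m.+1%:R) ^+ n * expR (- (r / 8 * m.+1%:R)).
have c0 : 0 <= c by rewrite mulr_ge0 ?exprn_ge0 ?sqrtr_ge0 ?expR_ge0.
have cG : c * G <= eta / 2.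
  have := HN m Nm; rewrite /= -/c sub0r normrN ger0_norm// => cb.
  apply: (@le_trans _ _ (eta / (2 * (G + 1)) * G)); first by rewrite ler_wpM2r.
  have G1 : 0 < G + 1 by rewrite ltr_wpDl.
  rewrite invfM (mulrA eta) -mulrA ler_piMr ?divr_ge0 ?(ltW eta0)//.
  by rewrite mulrC ler_pdivrMr// mul1r lerDl.
apply: le_trans (normc_cint_le (Id m)) _.
apply: (@le_trans _ _ (\int[mu]_y (h * heat_kernel m.+1%:R^-1 (y - x) +
    c * ((normc (f y) + normc (f x)) * gaussian 8^-1 (y - x))))%R).
  apply: Rint_le; first exact: cintegrable_normc.
    by apply: rintegrableD; [exact: rintegrableZl|exact: rintegrableZl].
  move=> y; rewrite normcM normc_real ger0_norm ?heat_kernel_ge0//.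
  have g0 := gaussian_ge0 8^-1 (y - x).
  have n0 : 0 <= normc (f y) + normc (f x) by rewrite addr_ge0 ?normc_ge0.
  have [dy|dy] := ltP (dot (y - x) (y - x)) r.
    apply: (@le_trans _ _ (h * heat_kernel m.+1%:R^-1 (y - x))).
      by rewrite ler_wpM2r ?heat_kernel_ge0// near.
    by rewrite lerDl !mulr_ge0.
  apply: (@le_trans _ _ (c * ((normc (f y) + normc (f x)) * gaussian 8^-1 (y - x)))).
    rewrite [leRHS]mulrCA; apply: ler_pM; rewrite ?normc_ge0 ?heat_kernel_ge0//.
      exact: normcB.
    exact: heat_kernel_far.
  by rewrite lerDr mulr_ge0 ?heat_kernel_ge0// ltW.
rewrite RintD; [|exact: rintegrableZl..].
rewrite (RintZl h (Ih m)) (RintZl c IG) (Rint_heat_shift x (e0 m)) -/G -/P.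
have -> : h * P = eta / 2 by rewrite /h invfM mulrA divfK// gt_eqF.
lra.
Unshelve. all: by []. Qed.

(** Each side pairs an L2 limit with a fixed L2 function, so the identity passes to the limit from
    the sequence u_m, for which it is [fourier_gaussian_exchange]. *)
Lemma fourier_L2_gaussian f g e (x : E) : 0 < e -> fourier_L2 f g ->
  cint mu (fun y => f y * (heat_kernel e (y - x))%:C%C) =
  cint mu (fun t => g t * ((gaussian e t)%:C%C * cis (dot t x))).
Proof.
move=> e0 [Lf Lg [u [Lu uf ug]]].
have Lk : in_L2 (fun t : E => (gaussian e t)%:C%C * cis (dot t x)).
  have Ik := cintegrable_gaussian_char x e0.
  apply/in_L2P; split; first exact: cintegrable_meas Ik.
  apply: rintegrable_le (cintegrable_normc Ik).
    by apply: measurable_funX; exact: cmeas_normc (cintegrable_meas Ik).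
  move=> t; rewrite ger0_norm ?sqr_ge0// expr2 ler_piMr ?normc_ge0//.
  by rewrite normcM normc_cis mulr1 normc_real ger0_norm ?gaussian_ge0// gaussian_le1// ltW.
have Lh : in_L2 (fun y : E => (heat_kernel e (y - x))%:C%C).
  apply/in_L2P; split; first by apply: cmeas_real; exact: measurable_heat_shift.
  apply: rintegrable_le (rintegrableZl (Num.sqrt (pi / e) ^+ n) (rintegrable_heat_shift x e0)).
    by apply: measurable_funX; apply: cmeas_normc; apply: cmeas_real; exact: measurable_heat_shift.
  move=> y; rewrite ger0_norm ?sqr_ge0// normc_real ger0_norm ?heat_kernel_ge0//.
  rewrite expr2 ler_wpM2r ?heat_kernel_ge0// ler_piMr ?exprn_ge0 ?sqrtr_ge0//.
  by rewrite gaussian_le1// invr_ge0 mulr_ge0// ltW.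
have c1 := L2_pairing_cvg (fun m => (Lu m).2) Lf Lh uf.
have c2 := L2_pairing_cvg (fun m => in_L2_fourier (Lu m).1 (Lu m).2) Lg Lk ug.
set A := cint mu _ in c1 *; set B := cint mu _ in c2 *.
apply/eqP; rewrite -subr_eq0; apply/eqP/normc0_eq0/eqP.
rewrite eq_le normc_ge0 andbT.
pose U m := cint mu (fun y => u m y * (heat_kernel e (y - x))%:C%C).
pose V m := cint mu (fun t => fourier (u m) t * ((gaussian e t)%:C%C * cis (dot t x))).
have UV m : V m = U m by apply: fourier_gaussian_exchange => //; exact: in_L1_cintegrable (Lu m).1.
have H m : normc (A - B) <= normc (U m - A) + normc (V m - B).
  have -> : A - B = (V m - B) - (U m - A) by rewrite UV; ring.
  by rewrite [leRHS]addrC; exact: normcB.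
have c3 : normc (U m - A) + normc (V m - B) @[m --> \oo] --> (0 : R).
  by rewrite -[X in _ --> X](addr0 0); apply: cvgD; [exact: c1|exact: c2].
have c3E : lim ((normc (U m - A) + normc (V m - B)) @[m --> \oo]) = 0.
  by apply/cvg_lim => //; exact: c3.
rewrite -[leRHS]c3E; apply: limr_ge; first by apply/cvg_ex; exists 0; exact: c3.
exact: nearW H.
Qed.

(** In the regularized identity with e = 1/(m+1), the space side tends to (2 pi)^n f(x) by
    continuity at [x], and the frequency side converges by domination by |g|. *)
Lemma fourier_inversion f g (x : E) : fourier_L2 f g -> cintegrable mu g ->
  {for x, continuous (fun y => Re (f y))} -> {for x, continuous (fun y => Im (f y))} ->
  f x * ((2 * pi) ^+ n)%:C%C = cint mu (fun t => g t * cis (dot t x)).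
Proof.
move=> fg Ig cr ci; have [Lf _ _] := fg.
have c1 := heat_approximation Lf cr ci.
have mg := cintegrable_meas Ig.
have e0 m : 0 < m.+1%:R^-1 :> R by rewrite invr_gt0 ltr0n.
pose F m (t : E) := g t * ((gaussian m.+1%:R^-1 t)%:C%C * cis (dot t x)).
have mF m : cmeas (F m).
  apply: cmeasM => //; apply: cmeasM; last exact: cmeas_character1.
  by apply: cmeas_real; exact: measurable_gaussian.
have FE m t : F m t = (gaussian m.+1%:R^-1 t)%:C%C * (g t * cis (dot t x)).
  by rewrite /F mulrCA.
have cFr t : Re (F m t) @[m --> \oo] --> Re (g t * cis (dot t x)).
  have -> : (fun m => Re (F m t)) = fun m => gaussian m.+1%:R^-1 t * Re (g t * cis (dot t x)).
    by apply/funext => m; rewrite FE ReM /= mul0r subr0.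
  by rewrite -[X in _ --> X]mul1r; apply: cvgM; [exact: gaussian_cvg1|exact: cvg_cst].
have cFi t : Im (F m t) @[m --> \oo] --> Im (g t * cis (dot t x)).
  have -> : (fun m => Im (F m t)) = fun m => gaussian m.+1%:R^-1 t * Im (g t * cis (dot t x)).
    by apply/funext => m; rewrite FE ImM /= mul0r addr0.
  by rewrite -[X in _ --> X]mul1r; apply: cvgM; [exact: gaussian_cvg1|exact: cvg_cst].
have bF m t : normc (F m t) <= normc (g t).
  rewrite FE !normcM normc_cis mulr1 normc_real ger0_norm ?gaussian_ge0//.
  by rewrite ler_piMl ?normc_ge0// gaussian_le1// ltW.
have [_ cr2 ci2] := cint_dct mF cFr cFi (cintegrable_normc Ig) bF.
set a := f x * _ in c1 *.
have H m : cint mu (F m) = cint mu (fun y => f y * (heat_kernel m.+1%:R^-1 (y - x))%:C%C).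
  by rewrite (fourier_L2_gaussian x (e0 m) fg).
have cRe : Re (cint mu (F m)) @[m --> \oo] --> Re a.
  apply/cvgrPdist_lt => eps eps0; move/cvgrPdist_lt/(_ _ eps0) : c1.
  apply: filterS => m hm; rewrite H distrC -ReN -ReD.
  apply: le_lt_trans (Re_le_normc _) _; move: hm.
  by rewrite sub0r normrN ger0_norm ?normc_ge0.
have cIm : Im (cint mu (F m)) @[m --> \oo] --> Im a.
  apply/cvgrPdist_lt => eps eps0; move/cvgrPdist_lt/(_ _ eps0) : c1.
  apply: filterS => m hm; rewrite H distrC -ImN -ImD.
  apply: le_lt_trans (Im_le_normc _) _; move: hm.
  by rewrite sub0r normrN ger0_norm ?normc_ge0.
by apply: complex_eqP; [exact: (cvg_unique _ cRe cr2)|exact: (cvg_unique _ cIm ci2)].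
Qed.

End inversion.

(** * Characters on the unit cube *)

Section unit_cube.
Context {R : realType}.
Local Notation leb := (@lebesgue_measure R).

Definition icube n (x : 'rV[R]_n) : R := \1_(@unit_cube R n) x.

Lemma icubeE n (x : 'rV[R]_n) : icube x = \prod_i \1_(`[0, 1]%classic) (x ord0 i) :> R.
Proof.
rewrite /icube indicE; have [xc|xc] := pselect (unit_cube x).
  rewrite mem_set// big1// => i _; rewrite indicE mem_set//=.
  by rewrite in_itv/=; exact: xc.
rewrite memNset//; move/existsNP : xc => [i xi].
rewrite (bigD1 i)//= indicE memNset ?mul0r//= in_itv/=; exact/negP.
Qed.

Lemma icube_itv n (x : 'rV[R]_n) : 0 <= icube x <= 1.
Proof. by rewrite /icube indicE; case: (_ \in _); rewrite ?lexx ler01. Qed.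

Lemma measurable_icube n : measurable_fun setT (@icube n).
Proof.
under [X in measurable_fun _ X]funext do rewrite icubeE.
apply: measurable_prod => i _.
apply: (@measurableT_comp _ _ _ _ _ _ (\1_(`[0, 1]%classic) : measurableTypeR R -> R)).
  exact: measurable_indic.
exact: measurable_coord.
Qed.

Lemma cis_2piz (k : int) : cis (2 * pi * k%:~R) = 1 :> R[i].
Proof.
have c1 : cis (2 * pi) = 1 :> R[i] by rewrite /cis mulr_natl cos2pi sin2pi.
have cn (m : nat) : cis (2 * pi * m%:R) = 1 :> R[i].
  elim: m => [|m IH]; first by rewrite mulr0 cis0.
  by rewrite -[m.+1%:R]natr1 [X in cis X]mulrDr cisD IH mulr1 c1 mulr1.
case: k => m; first by rewrite -pmulrn.
rewrite NegzE intrN mulrN -conj_cis -pmulrn cn.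
by apply: complex_eqP => //=; rewrite oppr0.
Qed.

Lemma cube_character_line (k : int) :
  cintegrable leb (fun a : measurableTypeR R => (\1_(`[0, 1]%classic) a : R)%:C%C * cis (2 * pi * k%:~R * a)) /\
  cint leb (fun a : measurableTypeR R => (\1_(`[0, 1]%classic) a : R)%:C%C * cis (2 * pi * k%:~R * a)) =
  (k == 0)%:R.
Proof.
set c : R := 2 * pi * k%:~R.
have Ii : rintegrable leb (\1_(`[0, 1]%classic) : measurableTypeR R -> R).
  exact: integrable_indic_itv.
have mc : measurable_fun setT (fun a : measurableTypeR R => c * a) by exact: measurable_funM.
have I : cintegrable leb (fun a : measurableTypeR R => (\1_(`[0, 1]%classic) a : R)%:C%C * cis (c * a)).
  apply: (cintegrableMl (B := 1)); [exact: cintegrable_real|exact: cmeas_cis|].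
  by move=> a; rewrite normc_cis.
split=> //.
have [k0|k0] := eqVneq k 0.
  transitivity (cint leb (fun a : measurableTypeR R => (\1_(`[0, 1]%classic) a : R)%:C%C)).
    by apply: eq_cint => a; rewrite /c k0 mulr0z mulr0 mul0r cis0 mulr1.
  rewrite cint_real /Rintegral integral_indic//= setIT lebesgue_measure_itv/= lte_fin ltr01.
  by rewrite sube0.
have c0 : c != 0 by rewrite !mulf_neq0 ?intr_eq0// gt_eqF// pi_gt0.
(* As [c] is a nonzero multiple of 2 pi, the primitives sin(c a)/c and -cos(c a)/c take equal values
   at 0 and 1. *)
have ftc (F f : R -> R) : (forall x, is_derive x (1 : R) F (f x)) -> continuous f ->
    F 1 = F 0 -> (\int[leb]_a ((\1_(`[0, 1]%classic) a : R) * f a) = 0)%R.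
  move=> dF cf F10.
  have dFx x : derivable F x 1 by case: (dF x).
  have cF : continuous F by move=> x; apply/differentiable_continuous/derivable1_diffP.
  have -> : (\int[leb]_a ((\1_(`[0, 1]%classic) a : R) * f a))%R = (\int[leb]_(a in `[0, 1]) f a)%R.
    rewrite [RHS]Rintegral_mkcond; apply: eq_Rintegral => t _.
    by rewrite patchE indicE; case: ifP => _ /=; rewrite ?mul1r ?mul0r.
  rewrite /Rintegral (@continuous_FTC2 _ f F)//.
  - by rewrite F10 -EFinB subrr.
  - by apply: continuous_subspaceT.
  - split=> //; first exact/cvg_at_right_filter/cF.
    exact/cvg_at_left_filter/cF.
  - by move=> x _; rewrite derive1E; apply: derive_val.
have /(congr1 (@complex.Re R)) /= cosk := cis_2piz k.
have /(congr1 (@complex.Im R)) /= sink := cis_2piz k.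
apply: complex_eqP.
  transitivity (\int[leb]_a ((\1_(`[0, 1]%classic) a : R) * cos (c * a)))%R.
    by apply: eq_Rint => a; rewrite ReM /= mul0r subr0.
  apply: (ftc (fun a => c^-1 * sin (c * a)) (fun a => cos (c * a))).
  - move=> x; apply: is_derive_eq; rewrite /GRing.scale/=; field; exact: c0.
  - by move=> t; apply/differentiable_continuous/derivable1_diffP; exact: ex_derive.
  - by rewrite mulr1 mulr0 sink sin0.
transitivity (\int[leb]_a ((\1_(`[0, 1]%classic) a : R) * sin (c * a)))%R.
  by apply: eq_Rint => a; rewrite ImM /= mul0r addr0.
apply: (ftc (fun a => - (c^-1 * cos (c * a))) (fun a => sin (c * a))).
- move=> x; apply: is_derive_eq; rewrite /GRing.scale/=; field; exact: c0.
- by move=> t; apply/differentiable_continuous/derivable1_diffP; exact: ex_derive.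
- by rewrite mulr1 mulr0 cosk cos0.
Qed.

Lemma cube_character n (k : 'rV[int]_n) :
  cintegrable (lebesgue_rV n) (fun x => (icube x)%:C%C * cis (2 * pi * dot (zvec k) x)) /\
  cint (lebesgue_rV n) (fun x => (icube x)%:C%C * cis (2 * pi * dot (zvec k) x)) = (k == 0)%:R.
Proof.
have [I Ec] := cint_rV_prod (fun i : 'I_n => (cube_character_line (k ord0 i)).1).
have E (x : 'rV[R]_n) : \prod_i ((\1_(`[0, 1]%classic) (x ord0 i) : R)%:C%C *
    cis (2 * pi * (k ord0 i)%:~R * x ord0 i)) = (icube x)%:C%C * cis (2 * pi * dot (zvec k) x).
  rewrite big_split /= -cis_sum icubeE rmorph_prod; congr (_ * cis _).
  by rewrite /dot mulr_sumr; apply: eq_bigr => i _; rewrite mxE mulrA.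
split; first exact: eq_cintegrable E I.
rewrite -(eq_cint _ E) Ec; under eq_bigr do rewrite (cube_character_line _).2.
have [->|k0] := eqVneq k 0; first by rewrite big1// => i _; rewrite mxE eqxx.
have [i ki] : exists i, k ord0 i != 0.
  apply/existsP; apply: contraT; rewrite negb_exists => /forallP k0'.
  move/eqP: k0; case; apply/rowP => i; rewrite mxE; apply/eqP.
  by have := k0' i; rewrite negbK.
by rewrite (bigD1 i)//= (negbTE ki) mul0r.
Qed.

Lemma rintegrable_icube n : rintegrable (lebesgue_rV n) (@icube n).
Proof.
have [[Ir _] _] := cube_character (0 : 'rV[int]_n).
by apply: eq_rintegrable Ir => x; rewrite zvec0 dot0l mulr0 cis0 mulr1.
Qed.

Lemma cube_fract n (y : 'rV[R]_n) : exists k : 'rV[int]_n, unit_cube (y + zvec k).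
Proof.
exists (map_mx (fun a => - Num.floor a) y) => i; rewrite !mxE intrN.
by have /andP[] := floor_itv (y ord0 i); rewrite intrD; lra.
Qed.

End unit_cube.

(** * Positivity of the Fourier transform of a positive definite function *)

Section psd_kernel.
Context d (T : measurableType d) (R : realType) (mu : {sigma_finite_measure set T -> \bar R}).
Variables (p : T -> R) (K : T * T -> R) (B : R).
Hypotheses (p0 : forall x, 0 <= p x) (Ip : rintegrable mu p)
  (p1 : (\int[mu]_x p x = 1)%R) (mK : measurable_fun setT K)
  (KB : forall z, `|K z| <= B) (Ksym : forall x y, K (x, y) = K (y, x))
  (Kpsd : forall s : seq T, 0 <= \sum_(x <- s) \sum_(y <- s) K (x, y)).

Let k1 x := (\int[mu]_y (K (x, y) * p y))%R.
Let kappa := (\int[mu]_y (K (y, y) * p y))%R.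
Let energy := (\int[mu]_x (k1 x * p x))%R.

Let mK1 x : measurable_fun setT (fun y => K (x, y)).
Proof. exact: (measurableT_comp mK (pair1_measurable x)). Qed.

Let IK x : rintegrable mu (fun y => K (x, y) * p y).
Proof.
apply: (eq_rintegrable (f := fun y => p y * K (x, y))); first by move=> y; rewrite mulrC.
exact: (rintegrableMl (B := B)).
Qed.

Let IKd : rintegrable mu (fun y => K (y, y) * p y).
Proof.
apply: (eq_rintegrable (f := fun y => p y * K (y, y))); first by move=> y; rewrite mulrC.
apply: (rintegrableMl (B := B)) => //.
by apply: (measurableT_comp mK); apply/measurable_fun_pair.
Qed.

Let Ik1 : rintegrable mu (fun x => k1 x * p x).
Proof.
apply: (eq_rintegrable (f := fun x => p x * k1 x)); first by move=> y; rewrite mulrC.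
apply: (rintegrableMl (B := B)) => //.
  apply: (@measurable_Rint _ _ _ _ R mu (fun z => K z * p z.2)).
  apply: measurable_funM => //.
  exact: (measurableT_comp (rintegrable_measurable Ip) measurable_snd).
move=> x; apply: le_trans (Rint_norm (IK x)) _.
have -> : B = (\int[mu]_y (B * p y))%R by rewrite RintZl// p1 mulr1.
apply: Rint_le; [exact: rintegrable_norm|exact: rintegrableZl|].
by move=> y; rewrite normrM (ger0_norm (p0 y)) ler_wpM2r.
Qed.

(* The expected energy of the points of [s] and of [m] independent points of
   density [p]. *)
Let V (s : seq T) (m : nat) := \sum_(x <- s) \sum_(y <- s) K (x, y) +
  2 * m%:R * (\sum_(x <- s) k1 x) + m%:R * kappa + m%:R * (m%:R - 1) * energy.

(** Averaging V (y :: s) m over y with density [p] gives V s (m + 1): the fixed point y becomes one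
    more random point. Induction on m thus starts from [Kpsd] with all points fixed. *)
Let V_ge0 m s : 0 <= V s m.
Proof.
elim: m s => [|m IH] s; first by rewrite /V !(mulr0, mul0r, addr0); exact: Kpsd.
have H : 0 <= (\int[mu]_y (V (y :: s) m * p y))%R.
  by apply: Rint_ge0 => y; rewrite mulr_ge0.
pose c := \sum_(x <- s) \sum_(y <- s) K (x, y) + 2 * m%:R * (\sum_(x <- s) k1 x) +
  m%:R * kappa + m%:R * (m%:R - 1) * energy.
have IS : rintegrable mu (fun y => \sum_(x <- s) (K (x, y) * p y)) by exact: rintegrable_sum.
have E y : V (y :: s) m * p y = c * p y + 2 * (\sum_(x <- s) (K (x, y) * p y)) +
    K (y, y) * p y + 2 * m%:R * (k1 y * p y).
  have Q1 : \sum_(x <- s) \sum_(z <- y :: s) K (x, z) =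
      \sum_(x <- s) K (x, y) + \sum_(x <- s) \sum_(z <- s) K (x, z).
    by rewrite -big_split; apply: eq_bigr => x _; rewrite big_cons.
  have Q2 : \sum_(z <- s) K (y, z) = \sum_(x <- s) K (x, y).
    by apply: eq_bigr => x _; exact: Ksym.
  by rewrite /V (big_cons _ _ y s) Q1 !big_cons Q2 -mulr_suml /c; ring.
rewrite (eq_Rint _ E) in H.
have I1 := rintegrableZl c Ip; have I2 := rintegrableZl 2 IS; have I4 := rintegrableZl (2 * m%:R) Ik1.
rewrite RintD // in H; last by apply: rintegrableD => //; exact: rintegrableD.
rewrite RintD // in H; last exact: rintegrableD.
rewrite RintD // (RintZl c Ip) (RintZl 2 IS) (RintZl (2 * m%:R) Ik1) p1 Rint_sum // in H.
apply: le_trans H _; rewrite le_eqVlt; apply/orP; left; apply/eqP.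
rewrite /V -/kappa -/energy /c -[m.+1%:R]natr1 -/(k1 _).
rewrite (eq_bigr k1 (r := s) (fun x _ => erefl)); ring.
Qed.

(** With random points only, m kappa + m (m - 1) energy >= 0 for every m. The diagonal term grows
    linearly and the energy term quadratically, so the energy cannot be negative. *)
Lemma psd_energy_ge0 : 0 <= (\int[mu]_x ((\int[mu]_y (K (x, y) * p y)) * p x))%R.
Proof.
rewrite -/energy leNgt; apply/negP => e0.
(* m - 1 is the truncation of kappa / (- energy) plus one, hence exceeds this quotient. *)
pose m := (Num.truncn (kappa / - energy)).+2.
have em : 0 < - energy by rewrite oppr_gt0.
have H : kappa < (m%:R - 1) * - energy.
  rewrite -ltr_pdivrMr//.
  have [k0|k0] := leP 0 kappa.
    have := truncnS_gt (kappa / - energy).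
    rewrite /m -[_.+2%:R]natr1 addrK; exact.
  apply: (@lt_le_trans _ _ 0); first by rewrite ltr_pdivrMr// mul0r.
  by rewrite subr_ge0 ler1n.
have := V_ge0 m [::]; rewrite /V !big_nil mulr0 !add0r.
have m0 : 0 < m%:R :> R by rewrite ltr0n.
by rewrite -mulrA -mulrDr pmulr_rge0// => h; move: H; lra.
Qed.

End psd_kernel.

Section Rint_exchange.
Context d1 d2 (T1 : measurableType d1) (T2 : measurableType d2) (R : realType).
Variables (m1 : {sigma_finite_measure set T1 -> \bar R})
  (m2 : {sigma_finite_measure set T2 -> \bar R}).

Lemma Rint_exchange B (w : T1 -> R) (k : T2 -> R) (h : T1 * T2 -> R) :
  rintegrable m1 w -> rintegrable m2 k -> measurable_fun setT h -> (forall p, `|h p| <= B) ->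
  (\int[m1]_x (w x * \int[m2]_y (h (x, y) * k y)) =
   \int[m2]_y ((\int[m1]_x (w x * h (x, y))) * k y))%R.
Proof.
move=> Iw Ik mh hB.
have [|_ H] := @cint_exchange _ _ _ _ R m1 m2 B (fun x => (w x)%:C%C) (fun y => (k y)%:C%C)
  (fun p => (h p)%:C%C) (cintegrable_real Iw) (cintegrable_real Ik) (cmeas_real mh).
  by move=> p; rewrite normc_real.
move/(congr1 (@complex.Re R)) : H.
have E1 x : cint m2 (fun y => (h (x, y))%:C%C * (k y)%:C%C) = ((\int[m2]_y (h (x, y) * k y))%R)%:C%C.
  by rewrite -cint_real; apply: eq_cint => y; rewrite real_complexM.
have E2 y : cint m1 (fun x => (w x)%:C%C * (h (x, y))%:C%C) = ((\int[m1]_x (w x * h (x, y)))%R)%:C%C.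
  by rewrite -cint_real; apply: eq_cint => x; rewrite real_complexM.
rewrite (eq_cint _ (fun x => congr1 (fun z => (w x)%:C%C * z) (E1 x))).
rewrite (eq_cint _ (fun y => congr1 (fun z => z * (k y)%:C%C) (E2 y))).
rewrite (eq_cint _ (fun x => esym (real_complexM _ _))).
by rewrite [X in _ = Re X -> _](eq_cint _ (fun x => esym (real_complexM _ _))) !cint_real.
Qed.

End Rint_exchange.

(** * Boundedness and integrability from the amalgam norm *)

Section amalgam.
Context {R : realType} (n : nat) (phi : 'rV[R]_n -> R).
Local Notation E := 'rV[R]_n.
Local Notation mu := (@lebesgue_rV R n).
Local Notation Zn := 'rV[int]_n.
Hypotheses (phi_cont : continuous phi) (phi_sym : forall x, phi (- x) = phi x)
  (phi_fin : (amalgam_norm phi < +oo)%E).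

Definition phi_bound : R := fine (amalgam_norm phi).

Lemma amalgam_ge0 : (0 <= amalgam_norm phi)%E.
Proof.
apply: le_trans (ereal_sup_ubound _); last by exists 0 => // i; rewrite mxE lexx ler01.
by apply: esum_ge0.
Qed.

Lemma phi_boundE : (phi_bound%:E = amalgam_norm phi)%E.
Proof. by rewrite /phi_bound fineK// ge0_fin_numE ?amalgam_ge0. Qed.

Lemma amalgam_sum_le x : unit_cube x ->
  (\esum_(k in [set: Zn]) `|phi (x - zvec k)|%:E <= phi_bound%:E)%E.
Proof. by move=> cx; rewrite phi_boundE; apply: ereal_sup_ubound; exists x. Qed.

Lemma phi_le y : `|phi y| <= phi_bound.
Proof.
have [k ck] := cube_fract y.
rewrite -lee_fin; apply: le_trans (amalgam_sum_le ck).
rewrite (esumID [set k])// setTI esum_set1// addrK.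
by rewrite leeDl// esum_ge0.
Qed.

Lemma measurable_phi : measurable_fun setT phi.
Proof. exact: continuous_measurable_rV. Qed.

Lemma summable_phi : rintegrable (cnt Zn R) (fun k => phi (zvec k)).
Proof.
apply/rintegrable_cntP.
have c0 : unit_cube (0 : E) by move=> i; rewrite mxE lexx ler01.
apply: le_lt_trans (ltry phi_bound); apply: le_trans (amalgam_sum_le c0).
by apply: le_esum => k _; rewrite sub0r phi_sym.
Qed.

(** The integer translates of the closed unit cube cover the space, with overlapping boundaries.
    Hence the integral of |phi| is at most the integral over the cube of sum_k |phi(x - k)|, whose
    integrand is at most [phi_bound]. *)
Lemma rintegrable_phi : rintegrable mu phi.
Proof.
apply/rintegrableP; split; first exact: measurable_phi.
have mn : measurable_fun setT (fun y => `|phi y|) by apply: measurableT_comp => //; exact: measurable_phi.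
pose f (z : E * discrete Zn) : \bar R := (`|phi z.1| * icube (z.1 + zvec z.2))%:E.
have mf : measurable_fun setT f.
  apply: cnt_fubini_measurable2 => k; apply/measurable_EFinP; apply: measurable_funM => //.
  apply: (measurableT_comp (@measurable_icube R n)).
  exact: (measurable_rV_add (@measurable_id _ _ _) (measurable_cst (zvec k))).
have f0 z : (0 <= f z)%E.
  by rewrite lee_fin mulr_ge0//; case/andP: (icube_itv (z.1 + zvec z.2)).
apply: (@le_lt_trans _ _ (\int[mu]_y \int[cnt Zn R]_k f (y, k))%E).
  apply: ge0_le_integral => //.
  - exact/measurable_EFinP.
  - exact: (measurable_fun_fubini_tonelli_F (m2 := cnt Zn R) f mf f0).
  move=> y _; have [k ck] := cube_fract y.
  rewrite integral_cnt; last by move=> l; exact: f0.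
  rewrite (esumID [set k]); last by move=> l _; exact: f0.
  rewrite setTI esum_set1; last exact: f0.
  have -> : f (y, k) = `|phi y|%:E by rewrite /f /icube /= indicE mem_set// mulr1.
  by rewrite leeDl// esum_ge0// => l _; exact: f0.
rewrite (fubini_tonelli (m1 := mu) (m2 := cnt Zn R) f mf f0).
pose g (z : discrete Zn * E) : \bar R := (`|phi (z.2 - zvec z.1)| * icube z.2)%:E.
have mphi k : measurable_fun setT (fun y : E => `|phi (y - zvec k)|).
  apply: measurableT_comp => //; apply: (measurableT_comp measurable_phi).
  exact: measurable_rV_sub.
have mg : measurable_fun setT g.
  apply: cnt_fubini_measurable => k; apply/measurable_EFinP.
  by apply: measurable_funM; [exact: (mphi k)|exact: measurable_icube].
have g0 z : (0 <= g z)%E.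
  by rewrite lee_fin mulr_ge0//; case/andP: (icube_itv z.2).
have -> : (\int[cnt Zn R]_k \int[mu]_y f (y, k) = \int[cnt Zn R]_k \int[mu]_y g (k, y))%E.
  apply: eq_integral => k _.
  rewrite -((shiftB_preserving (zvec k)).2 (fun y => f (y, k))).
  - by apply: eq_integral => y _; rewrite /f /g /= subrK.
  - exact: (measurableT_comp mf (pair2_measurable k)).
  - by move=> y; exact: f0.
rewrite (fubini_tonelli (m1 := cnt Zn R) (m2 := mu) g mg g0).
apply: (@le_lt_trans _ _ (\int[mu]_y (phi_bound * icube y)%:E)%E).
  apply: ge0_le_integral => //.
  - by move=> y _; apply: integral_ge0.
  - exact: (measurable_fun_fubini_tonelli_G (m1 := cnt Zn R) g mg g0).
  - apply/measurable_EFinP; apply: measurable_funM => //; exact: (@measurable_icube R n).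
  move=> y _; rewrite integral_cnt; last by move=> k; exact: g0.
  rewrite /g /=; have [cy|cy] := pselect (unit_cube y).
    rewrite /icube indicE mem_set// mulr1; under eq_esum do rewrite mulr1.
    exact: amalgam_sum_le.
  rewrite /icube indicE memNset// mulr0 esum1// => k _; by rewrite mulr0.
have I := rintegrableZl phi_bound (@rintegrable_icube R n).
by rewrite -EFin_Rint// ltry.
Qed.

End amalgam.

(** * Nonnegativity and integrability of phihat *)

Section phihat.
Context {R : realType} (n : nat) (phi : 'rV[R]_n -> R).
Local Notation E := 'rV[R]_n.
Local Notation mu := (@lebesgue_rV R n).
Hypotheses (phi_pd : positive_definite phi) (phi_cont : continuous phi)
  (phi_sym : forall x, phi (- x) = phi x) (phi_fin : (amalgam_norm phi < +oo)%E).

Let mphi := measurable_phi phi_cont.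
Let Iphi := rintegrable_phi phi_cont phi_fin.
Let phiB := phi_le phi_fin.

(** [positive_definite] speaks of distinct points, whereas the points averaged over may coincide:
    repetitions are merged by weighting [c] with the multiplicity. If all merged weights vanish, the
    sum is 0. *)
Lemma positive_definite_seq (s : seq E) (c : E -> R) :
  0 <= \sum_(x <- s) \sum_(y <- s) c x * c y * phi (x - y).
Proof.
have undupE (F : E -> R) : \sum_(x <- s) F x = \sum_(x <- undup s) (count_mem x s)%:R * F x.
  rewrite -big_undup_iterop_count; apply: eq_bigr => x _.
  by rewrite mulr_natl.
rewrite undupE; under eq_bigr do rewrite undupE.
pose u := undup s; pose C x := (count_mem x s)%:R * c x.
have -> : \sum_(x <- u) (count_mem x s)%:R * (\sum_(y <- u) (count_mem y s)%:R * (c x * c y * phi (x - y))) =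
    \sum_(i < size u) \sum_(j < size u) C (nth 0 u i) * C (nth 0 u j) * phi (nth 0 u i - nth 0 u j).
  rewrite (big_nth 0) big_mkord; apply: eq_bigr => i _.
  rewrite (big_nth 0) big_mkord mulr_sumr; apply: eq_bigr => j _.
  by rewrite /C; ring.
have [c0|c0] := pselect (exists i : 'I_(size u), C (nth 0 u i) != 0).
  apply: ltW; apply: (phi_pd (x := fun i : 'I_(size u) => nth 0 u i)) => //.
  move=> i j /eqP.
  by rewrite (nth_uniq 0 (ltn_ord i) (ltn_ord j) (undup_uniq s)) => /eqP/val_inj.
rewrite big1// => i _; rewrite big1// => j _.
have -> : C (nth 0 u i) = 0 by apply/eqP; apply: contra_notT c0 => ci; exists i.
by rewrite !mul0r.
Qed.

(** Its integral is phihat(t). The cosine preserves positive semidefiniteness of the kernel in x -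
    y, because the cosine of a difference splits into cos cos + sin sin. *)
Let psi (t x : E) : R := phi x * cos (dot x t).

Let mpsi t : measurable_fun setT (psi t).
Proof.
apply: measurable_funM => //; apply: (measurableT_comp (f := @cos R)).
  by apply: continuous_measurable_fun; exact: continuous_cos.
exact: measurable_dotr.
Qed.

Let psiB t x : `|psi t x| <= phi_bound phi.
Proof.
rewrite normrM; apply: le_trans (phiB x).
by rewrite ler_piMr// cos_norm_le1.
Qed.

Let Ipsi t : rintegrable mu (psi t).
Proof.
apply: rintegrable_le (rintegrable_norm Iphi) => // x.
by rewrite normrM ler_piMr// cos_norm_le1.
Qed.

Let psi_sym t x : psi t (- x) = psi t x.
Proof. by rewrite /psi phi_sym dotNl cosN. Qed.

Let psi_psd t (s : seq E) : 0 <= \sum_(x <- s) \sum_(y <- s) psi t (x - y).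
Proof.
have := positive_definite_seq s (fun x => cos (dot x t)).
have := positive_definite_seq s (fun x => sin (dot x t)).
move=> h1 h2; have := addr_ge0 h2 h1.
rewrite -big_split /=; under eq_bigr do rewrite -big_split /=.
congr (0 <= _); apply: eq_bigr => x _; apply: eq_bigr => y _.
by rewrite /psi dotBl cosB; ring.
Qed.

(* |y|^2 + |y - z|^2 = 2 |y - z/2|^2 + |z|^2 / 2 *)
Lemma gaussian_convolution e (y z : E) :
  gaussian e y * gaussian e (y - z) = gaussian (2 * e) (y - 2^-1 *: z) * gaussian (e / 2) z.
Proof.
rewrite /gaussian -!expRD; congr expR.
by rewrite !dotBl !dotBr !dotZl !dotZr (dotC z y); field.
Qed.

(** For random points with normalized Gaussian density [p] the energy is the integral of [psi t]
    against the autocorrelation of [p], which is a positive multiple of [gaussian (e / 2)]. *)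
Let psi_gaussian_ge0 t e : 0 < e -> 0 <= (\int[mu]_z (psi t z * gaussian (e / 2) z))%R.
Proof.
move=> e0; set c := (\int[mu]_x gaussian e x)%R.
have c0 : 0 < c.
  by rewrite /c Rint_gaussian// exprn_gt0// sqrtr_gt0 divr_gt0// pi_gt0.
pose p (x : E) := c^-1 * gaussian e x.
have p0 x : 0 <= p x by rewrite mulr_ge0 ?gaussian_ge0// invr_ge0 ltW.
have Ip : rintegrable mu p by apply: rintegrableZl; exact: rintegrable_gaussian.
have p1 : (\int[mu]_x p x = 1)%R.
  by rewrite RintZl ?mulVf ?gt_eqF//; exact: rintegrable_gaussian.
have pB x : `|p x| <= c^-1.
  by rewrite ger0_norm// ler_piMr ?invr_ge0 ?(ltW c0)// gaussian_le1// ltW.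
have mp : measurable_fun setT p by exact: rintegrable_measurable Ip.
have mK : measurable_fun setT (fun z : E * E => psi t (z.1 - z.2)).
  by apply: (measurableT_comp (mpsi t)); exact: measurable_rV_sub.
have := @psd_energy_ge0 _ _ R mu p (fun z => psi t (z.1 - z.2)) (phi_bound phi) p0 Ip p1 mK.
move=> /(_ (fun z => psiB t _)) /(_ _ (psi_psd t)) /=.
have Ksym (x y : E) : psi t (x - y) = psi t (y - x) by rewrite -(psi_sym t (y - x)) opprB.
move=> /(_ Ksym).
(* The reflection x -> y - x moves the difference of the two points from the kernel to the
   density. *)
have E1 (y : E) : (\int[mu]_x (psi t (y - x) * p x) = \int[mu]_z (p (y - z) * psi t z))%R.
  have := @Rint_preserving _ _ R mu _ (affine_preserving y (or_intror erefl : @is_sign R (-1)))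
    (fun x => psi t (y - x) * p x) _.
  move=> <-.
    apply: eq_Rint => z; rewrite scaleN1r mulrC; congr (p _ * psi t _).
      by rewrite addrC.
    by rewrite opprD opprK addrCA subrr addr0.
  apply: measurable_funM => //; apply: (measurableT_comp (mpsi t)).
  exact: measurable_rV_sub.
rewrite (eq_Rint _ (fun y => congr1 (fun a => a * p y) (E1 y))).
rewrite (eq_Rint _ (fun y => mulrC _ (p y))).
rewrite (Rint_exchange (B := c^-1) (h := fun z : E * E => p (z.1 - z.2)) Ip (Ipsi t)); last 2 first.
- by apply: (measurableT_comp mp); exact: measurable_rV_sub.
- by move=> z; exact: pB.
have e2 : 0 < 2 * e by rewrite mulr_gt0.
set c2 := (\int[mu]_x gaussian (2 * e) x)%R.
have c20 : 0 < c2.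
  by rewrite /c2 Rint_gaussian// exprn_gt0// sqrtr_gt0 divr_gt0// pi_gt0.
have E2 (z : E) : (\int[mu]_y (p y * p (y - z)))%R = c^-1 ^+ 2 * c2 * gaussian (e / 2) z.
  have Ig : rintegrable mu (fun y => gaussian (2 * e) (y - 2^-1 *: z)).
    by apply: (rintegrable_preserving (shiftB_preserving _)); exact: rintegrable_gaussian.
  transitivity (\int[mu]_y (c^-1 ^+ 2 * gaussian (e / 2) z * gaussian (2 * e) (y - 2^-1 *: z)))%R.
    by apply: eq_Rint => y; rewrite /p mulrACA gaussian_convolution; ring.
  rewrite RintZl// (Rint_preserving (shiftB_preserving _)) -/c2; first by ring.
  exact: measurable_gaussian.
have IPG : rintegrable mu (fun z => psi t z * gaussian (e / 2) z).
  apply: (rintegrableMl (B := 1)) => //; first exact: measurable_gaussian.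
  by move=> z; rewrite ger0_norm ?gaussian_ge0// gaussian_le1// divr_ge0// ltW.
have E3 (z : E) : (\int[mu]_y (p y * p (y - z)))%R * psi t z = c^-1 ^+ 2 * c2 * (psi t z * gaussian (e / 2) z).
  by rewrite E2; ring.
rewrite (eq_Rint _ E3) RintZl// pmulr_rge0//.
by rewrite mulr_gt0// exprn_gt0// invr_gt0.
Qed.

Let psi_ge0 t : 0 <= (\int[mu]_z psi t z)%R.
Proof.
have [||||_ cI] := @Rint_dct _ _ R mu (fun m z => psi t z * gaussian m.+1%:R^-1 z) (psi t) (fun z => `|psi t z|).
- by move=> m; apply: measurable_funM => //; exact: measurable_gaussian.
- move=> z; rewrite -[X in _ --> X]mulr1; apply: cvgM; first exact: cvg_cst.
  exact: gaussian_cvg1.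
- exact: rintegrable_norm.
- move=> m z; rewrite normrM ler_piMr// ger0_norm ?gaussian_ge0// gaussian_le1//.
have /cvg_lim <- // := cI; apply: limr_ge; first by apply/cvg_ex; eexists; exact: cI.
apply: nearW => m; have := @psi_gaussian_ge0 t (2 * m.+1%:R^-1).
by rewrite mulr_gt0 ?invr_gt0 ?ltr0n// mulrC mulKf//; apply.
Qed.

(** [phihat] as a real function; the sine part of the transform vanishes by symmetry of phi. *)
Definition spectrum (t : E) : R := (\int[mu]_z (phi z * cos (dot z t)))%R.

Lemma spectrum_ge0 t : 0 <= spectrum t.
Proof. exact: psi_ge0. Qed.

Lemma phihatE t : phihat phi t = (spectrum t)%:C%C.
Proof.
rewrite /phihat fourierE; apply: complex_eqP.
  by apply: eq_Rint => z; rewrite ReM /= mul0r subr0 cosN.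
have Is : rintegrable mu (fun z => phi z * sin (dot z t)).
  apply: (rintegrableMl (B := 1)) => //; last by move=> z; exact: sin_norm_le1.
  apply: (measurableT_comp (f := @sin R)); last exact: measurable_dotr.
  by apply: continuous_measurable_fun; exact: continuous_sin.
transitivity (\int[mu]_z (- (phi z * sin (dot z t))))%R.
  by apply: eq_Rint => z; rewrite ImM /= mul0r addr0 sinN mulrN.
rewrite /=; set J := (X in X = 0); suff : J = - J by lra.
rewrite {1}/J RintN// -[X in - X = _](Rint_preserving (@opp_preserving R n)); last first.
  exact: rintegrable_measurable Is.
congr (- _); rewrite /J; apply: eq_Rint => z.
by rewrite phi_sym dotNl sinN mulrN.
Qed.

Lemma cintegrable_phi : cintegrable mu (fun x => (phi x)%:C%C).
Proof. exact: cintegrable_real. Qed.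

Lemma measurable_spectrum : measurable_fun setT spectrum.
Proof.
have [mr _] := cmeas_fourier (cintegrable_meas cintegrable_phi).
move: mr; congr (measurable_fun _ _); apply/funext => t.
by rewrite -/(phihat phi t) phihatE.
Qed.

Lemma spectrum_le t : spectrum t <= (\int[mu]_x `|phi x|)%R.
Proof.
rewrite -[leLHS]ger0_norm ?spectrum_ge0//; apply: le_trans (Rint_norm (Ipsi t)) _.
apply: Rint_le; [exact: rintegrable_norm|exact: rintegrable_norm|move=> z].
by rewrite normrM ler_piMr// cos_norm_le1.
Qed.

(** Regularized inversion at x = 0: the integral of phihat against a Gaussian equals that of phi
    against the heat kernel, hence is at most [phi_bound] times (2 pi)^n, uniformly in [e]. Since
    phihat >= 0 the Gaussian can be removed. *)
Lemma rintegrable_spectrum : rintegrable mu spectrum.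
Proof.
have ms := measurable_spectrum.
apply: (ge0_fin_rintegrable ms spectrum_ge0).
apply: (@le_lt_trans _ _ (phi_bound phi * (2 * pi) ^+ n)%:E); last by rewrite ltry.
apply: (gaussian_bound ms spectrum_ge0) => e e0.
have Isg : rintegrable mu (fun t => spectrum t * gaussian e t).
  apply: (eq_rintegrable (f := fun t => gaussian e t * spectrum t)); first by move=> t; rewrite mulrC.
  apply: (rintegrableMl (B := (\int[mu]_x `|phi x|)%R)) => //; first exact: rintegrable_gaussian.
  by move=> t; rewrite ger0_norm ?spectrum_ge0// spectrum_le.
rewrite -EFin_Rint// lee_fin.
have := fourier_gaussian_exchange (0 : E) e0 cintegrable_phi.
move/(congr1 (@complex.Re R)).
have EL t : fourier (fun x => (phi x)%:C%C) t * ((gaussian e t)%:C%C * cis (dot t 0)) =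
    (spectrum t * gaussian e t)%:C%C.
  by rewrite dotC dot0l cis0 mulr1 -/(phihat phi t) phihatE -real_complexM.
have ER y : (phi y)%:C%C * (heat_kernel e (y - 0))%:C%C = (phi y * heat_kernel e y)%:C%C.
  by rewrite subr0 -real_complexM.
rewrite (eq_cint _ EL) (eq_cint _ ER) !cint_real /= => ->.
have Ih := rintegrable_heat_kernel n e0.
have Iph : rintegrable mu (fun y => phi y * heat_kernel e y).
  apply: (eq_rintegrable (f := fun y => heat_kernel e y * phi y)); first by move=> t; rewrite mulrC.
  exact: (rintegrableMl (B := phi_bound phi)).
rewrite -(Rint_heat_kernel n e0) -RintZl//; apply: Rint_le => //; first exact: rintegrableZl.
by move=> y; rewrite ler_wpM2r ?heat_kernel_ge0// (le_trans (ler_norm _)).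
Qed.

End phihat.

(** * Series of shifts in the native space *)

Section vanishing.
Context d (T : measurableType d) (R : realType) (mu : {measure set T -> \bar R}).

(** [h] vanishes almost everywhere, and [k] vanishes wherever [h] does. *)
Lemma cint_eq0_of_sqnorm (h k : T -> R[i]) : cmeas h -> cmeas k ->
  (\int[mu]_x (normc (h x) ^+ 2)%:E = 0)%E -> (forall x, h x = 0 -> k x = 0) ->
  cint mu k = 0.
Proof.
move=> mh mk h0 hk.
have mn : measurable_fun setT (fun x => (normc (h x) ^+ 2)%:E).
  by apply/measurable_EFinP; apply: measurable_funX; exact: cmeas_normc.
have ae : ae_eq mu setT (fun x => (normc (h x) ^+ 2)%:E) (cst 0%E).
  apply/(ae_eq_integral_abs mu measurableT mn); rewrite -[RHS]h0.
  by apply: eq_integral => x _; rewrite gee0_abs// lee_fin sqr_ge0.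
have R0 (u : T -> R) : measurable_fun setT u -> (forall x, k x = 0 -> u x = 0) ->
    (\int[mu]_x u x)%R = 0.
  move=> mu' ku; rewrite /Rintegral (@ae_eq_integral _ _ _ mu setT (cst 0%E))//.
  - by rewrite integral0.
  - exact/measurable_EFinP.
  - apply: filterS ae => x + _ => /(_ Logic.I) [] /eqP; rewrite sqrf_eq0 => /eqP/normc0_eq0.
    by move=> /hk/ku /= ->.
have [mkr mki] := mk.
by apply: complex_eqP; rewrite /cint/= R0// => x ->.
Qed.

End vanishing.

Section sequential.
Context {R : realType} (n : nat).

(** Dominated convergence speaks of sequences; this converts it into continuity. If continuity
    failed, the balls of radius 1/(m+1) would supply an offending sequence. *)
Lemma sequential_continuous_rV (f : 'rV[R]_n -> R) (x : 'rV[R]_n) :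
  (forall u : nat -> 'rV[R]_n, u m @[m --> \oo] --> x -> f (u m) @[m --> \oo] --> f x) ->
  {for x, continuous f}.
Proof.
move=> H; suff P e : 0 < e -> \forall y \near nbhs x, `|f x - f y| < e.
  by rewrite /prop_for /continuous_at; apply/(@cvgrPdist_lt _ _ _ (nbhs x)).
move=> e0; apply: contrapT => nH.
have /choice[u uP] : forall m : nat, exists y, ball x m.+1%:R^-1 y /\ ~ (`|f x - f y| < e).
  move=> m; apply: contrapT => nE; apply: nH; apply/nbhs_ballP; exists m.+1%:R^-1 => /=.
    by rewrite invr_gt0.
  by move=> y yb; apply: contrapT => ny; apply: nE; exists y.
have cu : u m @[m --> \oo] --> x.
  apply/cvg_ballP => r r0; near=> m; apply: le_ball (uP m).1; apply: ltW.
  near: m; exact: (near_infty_natSinv_lt (PosNum r0)).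
move/cvgrPdist_lt/(_ _ e0) : (H u cu) => [N _ HN].
by case: (uP N) => _; apply; apply: HN => /=.
Unshelve. all: by end_near. Qed.

End sequential.

Section complex_order.
Context {R : realType}.

Lemma complexr_le (a b : R) : (a%:C%C <= b%:C%C :> R[i]) = (a <= b).
Proof. by rewrite lecE /= eqxx. Qed.

Lemma complexr_lt (a b : R) : (a%:C%C < b%:C%C :> R[i]) = (a < b).
Proof. by rewrite ltcE /= eqxx. Qed.

Lemma sqrtC_real (a : R) : 0 <= a -> sqrtC (a%:C%C : R[i]) = (Num.sqrt a)%:C%C.
Proof.
move=> a0; rewrite -[in LHS](sqr_sqrtr a0) expr2 real_complexM -expr2 sqrCK//.
by rewrite -[0]/((0 : R)%:C%C) complexr_le sqrtr_ge0.
Qed.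

End complex_order.

Section native_series.
Context {R : realType} (n : nat) (phi : 'rV[R]_n -> R).
Local Notation E := 'rV[R]_n.
Local Notation mu := (@lebesgue_rV R n).
Local Notation Zn := 'rV[int]_n.
Hypotheses (phi_pd : positive_definite phi) (phi_cont : continuous phi)
  (phi_sym : forall x, phi (- x) = phi x) (phi_fin : (amalgam_norm phi < +oo)%E).
Variables (c : Zn -> R) (Ic : rintegrable (cnt Zn R) c).

Let mphi := measurable_phi phi_cont.
Let Iphi := rintegrable_phi phi_cont phi_fin.
Let phiB := phi_le phi_fin.
Let sg := spectrum phi.
Let sg0 : forall t, 0 <= sg t := spectrum_ge0 phi_pd phi_cont phi_sym phi_fin.
Let msg : measurable_fun setT sg := measurable_spectrum phi_cont phi_sym phi_fin.
Let Isg : rintegrable mu sg := rintegrable_spectrum phi_pd phi_cont phi_sym phi_fin.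
Let phE t : phihat phi t = (sg t)%:C%C := phihatE phi_cont phi_sym phi_fin t.
Let c1 : R := (\int[cnt Zn R]_k `|c k|)%R.

Let sqE t : sqrtC (phihat phi t) = (Num.sqrt (sg t))%:C%C.
Proof. by rewrite phE sqrtC_real. Qed.

Let msq : cmeas (fun t => sqrtC (phihat phi t)).
Proof.
apply: (eq_cmeas (fun t => esym (sqE t))); apply: cmeas_real.
exact: (measurableT_comp (continuous_measurable_fun (@sqrt_continuous R)) msg).
Qed.

Lemma in_L2_sqrt_phihat : in_L2 (fun t => sqrtC (phihat phi t)).
Proof.
apply/in_L2P; split => //; apply: eq_rintegrable Isg => t.
by rewrite sqE normc_real ger0_norm ?sqrtr_ge0// sqr_sqrtr.
Qed.

Definition series_real (x : E) : R := (\int[cnt Zn R]_k (c k * phi (x - zvec k)))%R.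

Definition shift_series (x : E) : R[i] := (series_real x)%:C%C.

Definition series_symbol (t : E) : R[i] :=
  cint (cnt Zn R) (fun k => (c k)%:C%C * cis (dot (zvec k) t)).

Lemma series_integrand x : rintegrable (cnt Zn R) (fun k => c k * phi (x - zvec k)).
Proof. by apply: (rintegrableMl (B := phi_bound phi)). Qed.

Lemma seriesE x : shift_series x = cint (cnt Zn R) (fun k => (c k)%:C%C * (phi (x - zvec k))%:C%C).
Proof.
by rewrite /shift_series /series_real -cint_real; apply: eq_cint => k; rewrite real_complexM.
Qed.

Lemma series_csum (D : set Zn) x : (forall k, ~ D k -> c k = 0) ->
  csum D (fun k => (c k)%:C%C * (phi (x - zvec k))%:C%C) = shift_series x.
Proof.
move=> cD.
have I : cintegrable (cnt Zn R) (fun k => (c k)%:C%C * (phi (x - zvec k))%:C%C).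
  apply: (eq_cintegrable (f := fun k : discrete Zn => (c k * phi (x - zvec k))%:C%C)).
    by move=> k; rewrite real_complexM.
  by apply: cintegrable_real; exact: series_integrand.
have Z k : ~ D k -> (c k)%:C%C * (phi (x - zvec k))%:C%C = 0 by move=> kD; rewrite cD// mul0r.
by have [] := has_csum_cint I Z (esym (seriesE x)).
Qed.

Lemma continuous_series : continuous series_real.
Proof.
move=> x; apply: sequential_continuous_rV => u ux.
have [||||//] := @Rint_dct _ _ R (cnt Zn R) (fun m k => c k * phi (u m - zvec k))
  (fun k => c k * phi (x - zvec k)) (fun k => `|c k| * phi_bound phi).
- by move=> m.
- move=> k; apply: cvgM; first exact: cvg_cst.
  apply: (@cvg_comp _ _ _ (fun m => u m - zvec k) phi); last exact: phi_cont.
  by apply: cvgB => //; exact: cvg_cst.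
- by apply: rintegrableZr; exact: rintegrable_norm.
- by move=> m k; rewrite normrM ler_wpM2l.
Qed.

Let mpz k : measurable_fun setT (fun x : E => phi (x - zvec k)).
Proof.
apply: (measurableT_comp mphi).
exact: (measurable_rV_sub (@measurable_id _ _ _) (measurable_cst (zvec k))).
Qed.

Let Ipz k : rintegrable mu (fun x : E => phi (x - zvec k)).
Proof. exact: (rintegrable_preserving (shiftB_preserving (zvec k)) Iphi). Qed.

(** Termwise transformation: the double integral is bounded by the l1 norm of [c] times the L1 norm
    of phi, and a shift by k multiplies the transform by exp(-i k.t), whence the conjugate of
    [series_symbol]. *)
Lemma series_fourier t : cintegrable mu shift_series /\
  fourier shift_series t = ((series_symbol t)^*)%C * phihat phi t.
Proof.
pose f (s : E) (z : E * discrete Zn) : R[i] :=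
  ((c z.2)%:C%C * (phi (z.1 - zvec z.2))%:C%C) * cis (- dot z.1 s).
have mf s : cmeas (f s).
  have H k : cmeas (fun y => f s (y, k)).
    rewrite /f /=; apply: cmeasM; last by apply: cmeas_cis; exact: measurable_Ndotr.
    apply: cmeasM; first exact: cmeas_cst.
    by apply: cmeas_real; exact: mpz.
  split; apply: cnt_fubini_measurable2 => k.
    exact: (H k).1.
  exact: (H k).2.
have nf s x k : normc (f s (x, k)) = `|c k| * `|phi (x - zvec k)|.
  by rewrite /f !normcM normc_cis mulr1 !normc_real.
set F := (\int[mu]_x `|phi x|)%R.
have nI k : (\int[mu]_x (`|c k| * `|phi (x - zvec k)|)%:E)%E = (`|c k| * F)%:E.
  rewrite -EFin_Rint; last by apply: rintegrableZl; exact: rintegrable_norm.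
  rewrite RintZl; last exact: rintegrable_norm.
  by rewrite (Rint_preserving (shiftB_preserving (zvec k)) (f := fun x => `|phi x|))//; exact: measurableT_comp.
have fin s : (\int[mu]_x \int[cnt Zn R]_k (normc (f s (x, k)))%:E < +oo)%E.
  have mn : measurable_fun setT (fun z => (normc (f s z))%:E).
    by apply/measurable_EFinP; exact: cmeas_normc.
  rewrite (fubini_tonelli (m1 := mu) (m2 := cnt Zn R) _ mn) => [|z]; last by rewrite lee_fin normc_ge0.
  rewrite (@eq_integral _ _ _ _ _ (fun k : discrete Zn => (`|c k| * F)%:E)); last first.
    by move=> k _; rewrite -nI; apply: eq_integral => x _; rewrite nf.
  have Icn := rintegrable_norm Ic.
  by rewrite -EFin_Rint ?ltry//; exact: rintegrableZr.
have sec2 s x : cintegrable (cnt Zn R) (fun k => f s (x, k)).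
  apply: (cintegrable_le (u := fun k : discrete Zn => `|c k| * phi_bound phi)).
  - by split.
  - by move=> k; rewrite nf ler_wpM2l.
  - by apply: rintegrableZr; exact: rintegrable_norm.
have sec1 s k : cintegrable mu (fun x => f s (x, k)).
  rewrite /f /=; apply: cintegrable_character; last exact: measurable_Ndotr.
  by apply: cintegrableZ; apply: cintegrable_real.
have EI s x : cint (cnt Zn R) (fun k => f s (x, k)) = shift_series x * cis (- dot x s).
  rewrite seriesE -cintZr//.
  apply: (eq_cintegrable (f := fun k : discrete Zn => (c k * phi (x - zvec k))%:C%C)).
    by move=> k; rewrite real_complexM.
  by apply: cintegrable_real; exact: series_integrand.
(* At frequency 0 the character is 1, so Fubini's theorem yields integrability of the series
   itself. *)
have Iser : cintegrable mu shift_series.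
  have [I _] := cint_fubini (mf 0) (fin 0) (sec2 0) (sec1 0).
  apply: eq_cintegrable I => x.
  by rewrite EI dotC dot0l oppr0 cis0 mulr1.
split=> //.
have [_ H] := cint_fubini (mf t) (fin t) (sec2 t) (sec1 t).
rewrite fourierE -(eq_cint _ (EI t)) H /series_symbol -cint_conj -?cintZr.
- apply: eq_cint => k; rewrite conjcM conjc_real conj_cis.
  have -> : cint mu (fun x => f t (x, k)) =
      cint mu (fun x => (c k)%:C%C * ((phi (x - zvec k))%:C%C * cis (- dot x t))).
    by apply: eq_cint => x; rewrite /f mulrA.
  rewrite cintZ; last first.
    by apply: cintegrable_character; [exact: cintegrable_real|exact: measurable_Ndotr].
  rewrite -mulrA; congr (_ * _).
  have -> : phihat phi t = cint mu (fun x => (phi (x - zvec k))%:C%C * cis (- dot (x - zvec k) t)).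
    rewrite (cint_preserving (shiftB_preserving (zvec k)) (f := fun x => (phi x)%:C%C * cis (- dot x t)))//.
    by apply: cmeasM; [exact: cmeas_real|apply: cmeas_cis; exact: measurable_Ndotr].
  rewrite -cintZ; last first.
    apply: cintegrable_character; first exact: cintegrable_real.
    apply: measurableT_comp => //; apply: measurable_dot => //.
    exact: measurable_rV_sub.
  apply: eq_cint => x; rewrite mulrCA -cisD; congr (_ * cis _).
  by rewrite dotBl; ring.
- apply: cintegrable_conj; apply: (cintegrable_le (u := fun k : discrete Zn => `|c k|)).
  + by split.
  + by move=> k; rewrite normcM normc_cis mulr1 normc_real.
  + exact: rintegrable_norm.
- apply: (cintegrable_le (u := fun k : discrete Zn => `|c k|)).
  + by split.
  + by move=> k; rewrite normcM normc_cis mulr1 normc_real.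
  + exact: rintegrable_norm.
Qed.

End native_series.

(** * Inner products with series of shifts and minimal norm *)

Section native_elements.
Context {R : realType} (n : nat) (phi : 'rV[R]_n -> R).
Local Notation E := 'rV[R]_n.
Local Notation mu := (@lebesgue_rV R n).
Local Notation Zn := 'rV[int]_n.
Hypotheses (phi_pd : positive_definite phi) (phi_cont : continuous phi)
  (phi_sym : forall x, phi (- x) = phi x) (phi_fin : (amalgam_norm phi < +oo)%E).
Implicit Types f g : E -> R[i].

Let sg := spectrum phi.
Let sg0 : forall t, 0 <= sg t := spectrum_ge0 phi_pd phi_cont phi_sym phi_fin.
Let msg : measurable_fun setT sg := measurable_spectrum phi_cont phi_sym phi_fin.
Let Isg : rintegrable mu sg := rintegrable_spectrum phi_pd phi_cont phi_sym phi_fin.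
Let phE t : phihat phi t = (sg t)%:C%C := phihatE phi_cont phi_sym phi_fin t.
Let Lsq : in_L2 (fun t => sqrtC (phihat phi t)) :=
  in_L2_sqrt_phihat phi_pd phi_cont phi_sym phi_fin.
Let P : R := (2 * pi) ^+ n.
Let P0 : 0 < P. Proof. by rewrite exprn_gt0// mulr_gt0// pi_gt0. Qed.

Let sq0 t : sg t = 0 -> sqrtC (phihat phi t) = 0.
Proof. by move=> s0; rewrite phE s0 sqrtC0. Qed.

Let sq_neq0 t : 0 < sg t -> sqrtC (phihat phi t) != 0.
Proof. by move=> s0; rewrite phE sqrtC_eq0 -[0]/((0 : R)%:C%C) eq_sym lt_eqF// complexr_lt. Qed.

(** The indicator of {phihat > 0} as a complex factor, so that [native_ip] becomes an integral over
    the whole space. *)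
Let pos (t : E) : R[i] := (if 0 < sg t then 1 else 0 : R)%:C%C.

Let mpos : cmeas pos.
Proof.
apply: cmeas_real.
have -> : (fun t => if 0 < sg t then 1 else 0 : R) = fun t => \1_(`]0, +oo[%classic) (sg t).
  by apply/funext => t; rewrite indicE /= mem_setE in_itv/= andbT; case: ifP.
by apply: (measurableT_comp (f := \1_(`]0, +oo[%classic) : R -> R)) => //; exact: measurable_indic.
Qed.

Let pos_le1 t : normc (pos t) <= 1.
Proof. by rewrite normc_real /pos; case: ifP; rewrite ?normr1 ?normr0. Qed.

Lemma cintegral_positive (h : E -> R[i]) :
  cintegral [set t | 0 < phihat phi t] h = cint mu (fun t => pos t * h t).
Proof.
have E1 t (u : R) : ((fun t => u) \_ [set t | 0 < phihat phi t]) t = if 0 < sg t then u else 0.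
  rewrite patchE; congr (if _ then _ else _).
  by rewrite -(complexr_lt 0) -phE; apply/idP/idP; rewrite inE.
apply: complex_eqP; rewrite /cintegral /cint /= Rintegral_mkcond; apply: eq_Rint => t.
  transitivity (if 0 < sg t then Re (h t) else 0); last first.
    by rewrite ReM /pos /=; case: ifP; rewrite ?mul1r ?mul0r subr0.
  by rewrite -E1 !patchE.
transitivity (if 0 < sg t then Im (h t) else 0); last first.
  by rewrite ImM /pos /=; case: ifP; rewrite ?mul1r ?mul0r addr0.
by rewrite -E1 !patchE.
Qed.

Lemma quotient_cintegrable f q : is_native_quotient phi f q ->
  cintegrable mu (fun t => sqrtC (phihat phi t) * q t).
Proof. by move=> [Lq _]; exact: in_L2_mul. Qed.

Lemma native_quotientP f : native phi f -> is_native_quotient phi f (native_quotient phi f).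
Proof. by move=> [_ _ _ ex]; exact: xgetPex. Qed.

(** Inversion holds at every point, since [f] is continuous and its transform is a product of two L2
    functions, hence integrable. *)
Lemma native_inversion f q x : native phi f -> is_native_quotient phi f q ->
  f x * P%:C%C = cint mu (fun t => (sqrtC (phihat phi t) * q t) * cis (dot t x)).
Proof.
move=> [f_real f_cont _ _] fq.
apply: fourier_inversion; [exact: fq.2|exact: quotient_cintegrable fq|exact: f_cont|].
have -> : (fun y => Im (f y)) = fun=> 0 by apply/funext.
exact: cst_continuous.
Qed.

(** This makes sum_k c_k f(k) absolutely convergent. *)
Lemma native_bounded f : native phi f -> exists B, forall x, normc (f x) <= B.
Proof.
move=> nf; have fq := native_quotientP nf.
have Ig := quotient_cintegrable fq.
exists (P^-1 * (\int[mu]_t normc (sqrtC (phihat phi t) * native_quotient phi f t))%R) => x.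
rewrite ler_pdivlMl// mulrC -[X in _ * X <= _]gtr0_norm// -normc_real -normcM.
rewrite (native_inversion x nf fq).
apply: le_trans (normc_cint_le (cintegrable_character Ig (measurable_dotr x))) _.
rewrite le_eqVlt; apply/orP; left; apply/eqP; apply: eq_Rint => t.
by rewrite normcM normc_cis mulr1.
Qed.

Let Lpos f : in_L2 f -> in_L2 (fun t => pos t * f t).
Proof.
move=> /in_L2P[mf If]; apply/in_L2P; split; first exact: cmeasM.
apply: rintegrable_le If; first by apply: measurable_funX; apply: cmeas_normc; exact: cmeasM.
move=> t; rewrite ger0_norm ?sqr_ge0// ler_pXn2r// ?nnegrE ?normc_ge0//.
by rewrite normcM ler_piMl ?normc_ge0.
Qed.

Let Lconj f : in_L2 f -> in_L2 (fun t => (f t)^*%C).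
Proof.
move=> /in_L2P[mf If]; apply/in_L2P; split; first exact: cmeas_conj.
by apply: eq_rintegrable If => t; rewrite normc_conj.
Qed.

(* Two quotients of the same function agree almost everywhere on [{phihat > 0}]. *)
Lemma pairing_quotient_unique f q1 q2 h : is_native_quotient phi f q1 ->
  is_native_quotient phi f q2 -> in_L2 h ->
  cint mu (fun t => pos t * (h t * (q1 t)^*%C)) = cint mu (fun t => pos t * (h t * (q2 t)^*%C)).
Proof.
move=> [L1 F1] [L2 F2] Lh.
have I1 : cintegrable mu (fun t => pos t * (h t * (q1 t)^*%C)).
  apply: (eq_cintegrable (f := fun t => (pos t * h t) * (q1 t)^*%C)); first by move=> t; rewrite mulrA.
  by apply: in_L2_mul; [exact: Lpos|exact: Lconj].
have I2 : cintegrable mu (fun t => pos t * (h t * (q2 t)^*%C)).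
  apply: (eq_cintegrable (f := fun t => (pos t * h t) * (q2 t)^*%C)); first by move=> t; rewrite mulrA.
  by apply: in_L2_mul; [exact: Lpos|exact: Lconj].
apply/eqP; rewrite -subr_eq0 -cintB//; apply/eqP.
have U := fourier_L2_unique F1 F2; rewrite /sqnorm_L2 in U.
apply: (cint_eq0_of_sqnorm _ _ U).
- by apply: cmeasB; apply: cintegrable_meas; apply: in_L2_mul.
- by apply: cmeasB; [exact: cintegrable_meas I1|exact: cintegrable_meas I2].
move=> t; rewrite -mulrBr => /eqP; rewrite mulf_eq0 => /orP[s0|].
  have -> : pos t = 0.
    rewrite /pos; case: ifPn => // st; by rewrite (negbTE (sq_neq0 st)) in s0.
  by rewrite !mul0r subr0.
by rewrite subr_eq0 => /eqP ->; rewrite subrr.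
Qed.

(** [native_ip] is computed with the quotients that [xget] selects. [pairing_quotient_unique]
    replaces the second of them, and conjugate symmetry of the pairing carries the replacement over
    to the first. *)
Lemma native_ip_quotients f g qf qg : native phi f -> native phi g ->
  is_native_quotient phi f qf -> is_native_quotient phi g qg ->
  native_ip phi f g = (P^-1)%:C%C * cint mu (fun t => pos t * (qf t * (qg t)^*%C)).
Proof.
move=> nf ng fq gq; have fQ := native_quotientP nf; have gQ := native_quotientP ng.
rewrite /native_ip cintegral_positive; congr (_ * _).
rewrite (pairing_quotient_unique gQ gq fQ.1).
have C (a b : E -> R[i]) : in_L2 a -> in_L2 b ->
    cint mu (fun t => pos t * (a t * (b t)^*%C)) = ((cint mu (fun t => pos t * (b t * (a t)^*%C)))^*)%C.
  move=> La Lb; rewrite -cint_conj.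
    apply: eq_cint => t; rewrite !conjcM conjc_real conjcK; congr (_ * _).
    by rewrite mulrC.
  apply: (eq_cintegrable (f := fun t => (pos t * b t) * (a t)^*%C)); first by move=> t; rewrite mulrA.
  by apply: in_L2_mul; [exact: Lpos|exact: Lconj].
rewrite C ?(pairing_quotient_unique fQ fq gq.1) -?C//; [exact: fq.1|exact: gq.1|exact: fQ.1|exact: gq.1].
Qed.

Lemma native_ip_self f q : native phi f -> is_native_quotient phi f q ->
  native_ip phi f f =
  (P^-1 * \int[mu]_t (normc (pos t * q t) ^+ 2))%R%:C%C.
Proof.
move=> nf fq; rewrite (native_ip_quotients nf nf fq fq) real_complexM; congr (_ * _).
rewrite -cint_real; apply: eq_cint => t; rewrite -!mulc_conj conjcM conjc_real.
have pp : pos t * pos t = pos t by rewrite /pos -real_complexM; case: ifP; rewrite ?mulr1 ?mulr0.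
by rewrite -{1}pp -!mulrA; congr (_ * _); rewrite mulrCA.
Qed.

(** By inversion both functions are recovered from their quotients, and where phihat = 0 the factor
    phihat^(1/2) removes them from the integral. Equality therefore holds at every point. *)
Lemma native_eq_of_quotients f g qf qg : native phi f -> native phi g ->
  is_native_quotient phi f qf -> is_native_quotient phi g qg ->
  (\int[mu]_t (normc (pos t * (qf t - qg t)) ^+ 2) = 0)%R -> f = g.
Proof.
move=> nf ng fq gq h0; apply/funext => x.
have Ld : in_L2 (fun t => pos t * (qf t - qg t)) by apply: Lpos; exact: in_L2B fq.1 gq.1.
have /in_L2P[md Id] := Ld.
have If := cintegrable_character (quotient_cintegrable fq) (measurable_dotr x).
have Ig := cintegrable_character (quotient_cintegrable gq) (measurable_dotr x).
have : f x * P%:C%C = g x * P%:C%C.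
  rewrite (native_inversion x nf fq) (native_inversion x ng gq).
  apply/eqP; rewrite -subr_eq0 -cintB//; apply/eqP.
  apply: (cint_eq0_of_sqnorm md); first by apply: cmeasB; [exact: cintegrable_meas If|exact: cintegrable_meas Ig].
    by rewrite -EFin_Rint// h0.
  move=> t /eqP; rewrite mulf_eq0 => /orP[|].
    rewrite /pos; case: ifPn => [_ /eqP/(congr1 (@complex.Re R))/= /eqP|st _].
      by rewrite oner_eq0.
    have s0 : sg t = 0 by apply/eqP; rewrite eq_le sg0 leNgt st.
    by rewrite (sq0 s0) !mul0r subr0.
  by rewrite subr_eq0 => /eqP ->; rewrite subrr.
apply: mulIf; rewrite -[0]/((0 : R)%:C%C); apply/negP => /eqP/(congr1 (@complex.Re R))/= Pe.
by move: P0; rewrite Pe ltxx.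
Qed.

Variables (c : Zn -> R) (Ic : rintegrable (cnt Zn R) c).
Local Notation chi := (shift_series phi c).
Let A := series_symbol c.
Let c1 : R := (\int[cnt Zn R]_k `|c k|)%R.
Let qchi (t : E) : R[i] := ((A t)^*)%C * sqrtC (phihat phi t).

Let IA t : cintegrable (cnt Zn R) (fun k => (c k)%:C%C * cis (dot (zvec k) t)).
Proof.
apply: (cintegrable_le (u := fun k : discrete Zn => `|c k|)).
- by split.
- by move=> k; rewrite normcM normc_cis mulr1 normc_real.
- exact: rintegrable_norm.
Qed.

Let mA : cmeas A.
Proof.
apply: (@cmeas_cint _ _ _ _ R (cnt Zn R) (fun z => (c z.2)%:C%C * cis (dot (zvec z.2) z.1))).
have H k : cmeas (fun t : E => (c k)%:C%C * cis (dot (zvec k) t)).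
  by apply: cmeasM; [exact: cmeas_cst|apply: cmeas_cis; exact: measurable_dot].
split; apply: cnt_fubini_measurable2 => k; [exact: (H k).1|exact: (H k).2].
Qed.

Let A_le t : normc (A t) <= c1.
Proof.
apply: le_trans (normc_cint_le (IA t)) _.
rewrite le_eqVlt; apply/orP; left; apply/eqP; apply: eq_Rint => k.
by rewrite normcM normc_cis mulr1 normc_real.
Qed.

Let Lq : in_L2 qchi.
Proof.
have /in_L2P[ms Is] := Lsq; apply/in_L2P; split.
  by apply: cmeasM => //; exact: cmeas_conj.
apply: rintegrable_le (rintegrableZl (c1 ^+ 2) Is).
  by apply: measurable_funX; apply: cmeas_normc; apply: cmeasM => //; exact: cmeas_conj.
move=> t; rewrite ger0_norm ?sqr_ge0// normcM normc_conj exprMn ler_wpM2r ?sqr_ge0//.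
by rewrite ler_pXn2r// ?nnegrE ?normc_ge0// (le_trans _ (A_le t)) ?normc_ge0.
Qed.

Lemma in_L1_series : in_L1 chi.
Proof. by apply: cintegrable_in_L1; exact: (series_fourier phi_cont phi_fin Ic 0).1. Qed.

Lemma in_L2_series : in_L2 chi.
Proof.
have [I _] := series_fourier phi_cont phi_fin Ic 0; have mc := cintegrable_meas I.
have B x : normc (chi x) <= c1 * phi_bound phi.
  rewrite normc_real; apply: le_trans (Rint_norm (series_integrand phi_fin Ic x)) _.
  rewrite -RintZr; last exact: rintegrable_norm.
  apply: Rint_le; [|by apply: rintegrableZr; exact: rintegrable_norm|].
    by apply: rintegrable_norm; exact: (series_integrand phi_fin Ic x).
  by move=> k; rewrite normrM ler_wpM2l// phi_le.
apply/in_L2P; split => //.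
apply: rintegrable_le (rintegrableZl (c1 * phi_bound phi) (cintegrable_normc I)).
  by apply: measurable_funX; exact: cmeas_normc.
by move=> x; rewrite ger0_norm ?sqr_ge0// expr2 ler_wpM2r ?normc_ge0.
Qed.

Lemma series_quotient : is_native_quotient phi chi qchi.
Proof.
split=> //; have FE : (fun t => sqrtC (phihat phi t) * qchi t) = fourier chi.
  apply/funext => t; rewrite (series_fourier phi_cont phi_fin Ic t).2 /qchi mulrCA; congr (_ * _).
  by rewrite -expr2 sqrtCK.
rewrite FE; split; [exact: in_L2_series|exact: in_L2_fourier in_L1_series in_L2_series|].
have Z (h : E -> R[i]) : sqnorm_L2 (fun x => h x - h x) = 0%E.
  rewrite /sqnorm_L2; under eq_integral do rewrite subrr normc0 expr0n.
  by rewrite integral0.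
(* The series is both integrable and square integrable, so it approximates itself and its ordinary
   transform is its L2 transform. *)
exists (fun=> chi); split.
- by move=> _; split; [exact: in_L1_series|exact: in_L2_series].
- by rewrite Z; exact: cvg_cst.
- by rewrite Z; exact: cvg_cst.
Qed.

Lemma native_series : native phi chi.
Proof.
split; [by []| |exact: in_L2_series|by exists qchi; exact: series_quotient].
exact: (continuous_series phi_cont phi_fin Ic).
Qed.

Lemma series_pairing_integrable f : native phi f ->
  cintegrable (cnt Zn R) (fun k => (c k)%:C%C * f (zvec k)).
Proof.
move=> nf; have [B fB] := native_bounded nf.
apply: (cintegrable_le (u := fun k : discrete Zn => `|c k| * B)).
- by split.
- by move=> k; rewrite normcM normc_real ler_wpM2l.
- by apply: rintegrableZr; exact: rintegrable_norm.
Qed.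

Lemma native_ip_series f : native phi f ->
  native_ip phi f chi = cint (cnt Zn R) (fun k => (c k)%:C%C * f (zvec k)).
Proof.
move=> nf; have fq := native_quotientP nf; set q := native_quotient phi f in fq.
rewrite (native_ip_quotients nf native_series fq series_quotient).
pose g t := sqrtC (phihat phi t) * q t.
have Ig : cintegrable mu g by exact: quotient_cintegrable fq.
have -> : cint mu (fun t => pos t * (q t * (qchi t)^*%C)) = cint mu (fun t => A t * g t).
  apply: eq_cint => t; rewrite /qchi conjcM conjcK /g.
  have -> : ((sqrtC (phihat phi t))^*)%C = sqrtC (phihat phi t).
    by rewrite phE sqrtC_real// conjc_real.
  rewrite /pos; case: ifPn => [_|st]; first by rewrite mul1r; ring.
  have s0 : sg t = 0 by apply/eqP; rewrite eq_le sg0 leNgt st.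
  by rewrite (sq0 s0) !(mul0r, mulr0).
have mh : cmeas (fun z : discrete Zn * E => cis (dot (zvec z.1) z.2)).
  have H k : cmeas (fun t : E => cis (dot (zvec k) t)) by apply: cmeas_cis; exact: measurable_dot.
  split; apply: cnt_fubini_measurable => k; [exact: (H k).1|exact: (H k).2].
have [|_ H] := cint_exchange (B := 1) (cintegrable_real Ic) Ig mh.
  by move=> z; rewrite normc_cis.
rewrite -H -cintZ; last first.
  have [I _] : cintegrable (cnt Zn R) (fun k => (c k)%:C%C * cint mu (fun t => cis (dot (zvec k) t) * g t)) /\ True.
    split=> //; apply: (eq_cintegrable (f := fun k : discrete Zn => P%:C%C * ((c k)%:C%C * f (zvec k)))).
      move=> k; rewrite mulrCA [P%:C%C * _]mulrC (native_inversion _ nf fq); congr (_ * _).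
      by apply: eq_cint => t; rewrite mulrC dotC.
    by apply: cintegrableZ; exact: series_pairing_integrable.
  exact: I.
apply: eq_cint => k; rewrite mulrCA; congr (_ * _).
have -> : cint mu (fun t => cis (dot (zvec k) t) * g t) = f (zvec k) * P%:C%C.
  by rewrite (native_inversion _ nf fq); apply: eq_cint => t; rewrite mulrC dotC.
by rewrite mulrCA -real_complexM mulVf ?mulr1// gt_eqF.
Qed.

Lemma has_csum_series (D : set Zn) f : (forall k, ~ D k -> c k = 0) -> native phi f ->
  has_csum D (fun k => (c k)%:C%C * f (zvec k)) (native_ip phi f chi).
Proof.
move=> cD nf; apply: has_csum_cint; first exact: series_pairing_integrable.
  by move=> k kD; rewrite cD// mul0r.
by rewrite native_ip_series.
Qed.

Lemma series_min_norm (D : set Zn) (j : Zn) : D j -> (forall k, ~ D k -> c k = 0) ->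
  (forall l, D l -> series_real phi c (zvec l) = (j == l)%:R) ->
  unique_min_norm_interpolant phi D j chi.
Proof.
move=> Dj cD chiD.
have chi_int l : D l -> chi (zvec l) = (j == l)%:R.
  by move=> Dl; rewrite /shift_series chiD//; case: (j == l).
split; first by split; [exact: native_series|exact: chi_int].
move=> f [nf fD].
(* Every interpolant has the same pairing with [chi]: only the term k = j survives, since [c]
   vanishes off [D] and the interpolant vanishes at the other points of [D]. *)
have ipE g : native phi g -> (forall l, D l -> g (zvec l) = (j == l)%:R) ->
    native_ip phi g chi = (c j)%:C%C.
  move=> ng gD; rewrite (native_ip_series ng).
  transitivity (cint (cnt Zn R) (fun k => (if k == j then c j else 0)%:C%C)); last first.
    by rewrite cint_real Rint_indic1.
  apply: eq_cint => k; have [->|kj] := eqVneq k j; first by rewrite gD// eqxx mulr1.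
  have [Dk|Dk] := pselect (D k); first by rewrite gD// eq_sym (negbTE kj) mulr0.
  by rewrite cD// mul0r.
have fq := native_quotientP nf; set q := native_quotient phi f in fq.
set Nf := (\int[mu]_t (normc (pos t * q t) ^+ 2))%R.
set Nc := (\int[mu]_t (normc (pos t * qchi t) ^+ 2))%R.
set Nd := (\int[mu]_t (normc (pos t * (q t - qchi t)) ^+ 2))%R.
have ff : native_ip phi f f = (P^-1 * Nf)%:C%C := native_ip_self nf fq.
have cc : native_ip phi chi chi = (P^-1 * Nc)%:C%C := native_ip_self native_series series_quotient.
have Nf0 : 0 <= Nf by apply: Rint_ge0 => t; exact: sqr_ge0.
have Nc0 : 0 <= Nc by apply: Rint_ge0 => t; exact: sqr_ge0.
have Nd0 : 0 <= Nd by apply: Rint_ge0 => t; exact: sqr_ge0.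
have Pi0 : 0 < P^-1 by rewrite invr_gt0.
have pythagoras : Nf = Nc + Nd.
  have /in_L2P[mf If] := Lpos fq.1; have /in_L2P[mc Icc] := Lpos Lq.
  have /in_L2P[md Id] := Lpos (in_L2B fq.1 Lq).
  have Ifc : cintegrable mu (fun t => pos t * (q t * (qchi t)^*%C)).
    apply: (eq_cintegrable (f := fun t => (pos t * q t) * (qchi t)^*%C)); first by move=> t; rewrite mulrA.
    by apply: in_L2_mul; [exact: Lpos fq.1|exact: Lconj].
  (* [ipE] for [f] and for [chi] itself gives (f, chi) = (chi, chi). *)
  have cross : Re (cint mu (fun t => pos t * (q t * (qchi t)^*%C))) = Nc.
    have := ipE _ nf fD; rewrite -(ipE _ native_series chi_int) cc.
    rewrite (native_ip_quotients nf native_series fq series_quotient).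
    move/(congr1 (@complex.Re R)); rewrite ReM /= mul0r subr0.
    by apply: mulfI; rewrite gt_eqF.
  have dE t : normc (pos t * (q t - qchi t)) ^+ 2 = normc (pos t * q t) ^+ 2 +
      normc (pos t * qchi t) ^+ 2 - 2 * Re (pos t * (q t * (qchi t)^*%C)).
    rewrite !normc_sqr !(ReM, ImM, ReD, ImD, ReN, ImN, ReJ, ImJ) /pos /=.
    by case: ifP => _; ring.
  rewrite /Nd (eq_Rint _ dE) RintB; [|exact: rintegrableD|by apply: rintegrableZl; case: Ifc].
  rewrite RintD// RintZl; last by case: Ifc.
  rewrite -/Nf -/Nc; have -> : (\int[mu]_t Re (pos t * (q t * (qchi t)^*%C)))%R = Nc by exact: cross.
  by ring.
have normE a : 0 <= a -> sqrtC ((P^-1 * a)%:C%C : R[i]) = (Num.sqrt (P^-1 * a))%:C%C.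
  by move=> a0; rewrite sqrtC_real// mulr_ge0// ltW.
rewrite /native_norm ff cc !normE//; split.
  by rewrite complexr_le ler_wsqrtr// ler_pM2l// pythagoras lerDl.
move/(congr1 (@complex.Re R)) => /= /eqP.
rewrite eqr_sqrt ?mulr_ge0 ?(ltW Pi0)// => /eqP/(mulfI (lt0r_neq0 Pi0)) NN.
apply: (native_eq_of_quotients nf native_series fq series_quotient).
by rewrite -/Nd; move: pythagoras; rewrite NN; lra.
Qed.

End native_elements.

(** * Absolutely convergent Fourier series *)

Section trigonometric_series.
Context {R : realType} (n : nat).
Local Notation E := 'rV[R]_n.
Local Notation mu := (@lebesgue_rV R n).
Local Notation Zn := 'rV[int]_n.
Local Notation sumZ := (cnt Zn R).
Implicit Types (a b c : discrete Zn -> R) (k l m : Zn) (x : E).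

Definition l1 a : Prop := rintegrable sumZ a.
Definition l1norm a : R := (\int[sumZ]_k `|a k|)%R.
(** Functions on the torus are handled through their pullback along [torus_pt]; the coefficient
    sequences are real throughout. *)
Definition trig a x : R[i] := cint sumZ (fun k => (a k)%:C%C * cis (2 * pi * dot (zvec k) x)).
Definition conv a b k : R := (\int[sumZ]_l (a l * b (k - l)))%R.
Definition refl a k : R := a (- k).
Definition delta (j : Zn) k : R := if k == j then 1 else 0.

Lemma l1norm_ge0 a : 0 <= l1norm a.
Proof. exact: Rint_ge0. Qed.

Lemma l1_term a k : l1 a -> `|a k| <= l1norm a.
Proof. exact: Rint_cnt_term. Qed.

Lemma l1_delta j : l1 (delta j).
Proof. exact: rintegrable_indic1. Qed.

Lemma l1norm_delta j : l1norm (delta j) = 1.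
Proof.
rewrite -[RHS](Rint_indic1 (j : discrete Zn) 1); apply: eq_Rint => l.
by rewrite /delta; case: ifP; rewrite ?normr1 ?normr0.
Qed.

Lemma l1D a b : l1 a -> l1 b -> l1 (fun k => a k + b k).
Proof. exact: rintegrableD. Qed.

Lemma l1B a b : l1 a -> l1 b -> l1 (fun k => a k - b k).
Proof. exact: rintegrableB. Qed.

Lemma l1Z s a : l1 a -> l1 (fun k => s * a k).
Proof. exact: rintegrableZl. Qed.

Lemma l1normD a b : l1 a -> l1 b -> l1norm (fun k => a k + b k) <= l1norm a + l1norm b.
Proof.
move=> Ia Ib; have na := rintegrable_norm Ia; have nb := rintegrable_norm Ib.
rewrite /l1norm -RintD//; apply: Rint_le => //.
- by apply: rintegrable_norm; exact: rintegrableD.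
- exact: rintegrableD.
- by move=> k; exact: ler_normD.
Qed.

Lemma l1normZ s a : l1 a -> l1norm (fun k => s * a k) = `|s| * l1norm a.
Proof.
move=> Ia; rewrite /l1norm -RintZl; last exact: rintegrable_norm.
by apply: eq_Rint => k; rewrite normrM.
Qed.

Lemma l1_le a b : l1 b -> (forall k, `|a k| <= `|b k|) -> l1 a.
Proof. by move=> Ib ab; apply: rintegrable_le (rintegrable_norm Ib). Qed.

Lemma Re_mulr_real (z : R[i]) (s : R) : Re (z * s%:C%C) = Re z * s.
Proof. by rewrite ReM mulr0 subr0. Qed.

Lemma Im_mulr_real (z : R[i]) (s : R) : Im (z * s%:C%C) = Im z * s.
Proof. by rewrite ImM mulr0 add0r. Qed.

Lemma neg_bij : bijective (fun k : Zn => - k).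
Proof. by exists (fun k => - k) => k; rewrite opprK. Qed.

Lemma l1_refl a : l1 a -> l1 (refl a).
Proof. by move=> Ia; exact: (rintegrable_reindex neg_bij Ia). Qed.

Lemma subl_bij j : bijective (fun k : Zn => j - k).
Proof. by exists (fun k => j - k) => k; rewrite subKr. Qed.

Lemma subr_bij j : bijective (fun k : Zn => k - j).
Proof. by exists (fun k => k + j) => k; rewrite ?addrK ?subrK. Qed.

Lemma trig_integrand a x : l1 a ->
  cintegrable sumZ (fun k => (a k)%:C%C * cis (2 * pi * dot (zvec k) x)).
Proof.
move=> Ia; apply: (cintegrable_le (u := fun k : discrete Zn => `|a k|)).
- by split.
- by move=> k; rewrite normcM normc_cis mulr1 normc_real.
- exact: rintegrable_norm.
Qed.

Lemma normc_trig a x : l1 a -> normc (trig a x) <= l1norm a.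
Proof.
move=> Ia; apply: le_trans (normc_cint_le (trig_integrand x Ia)) _.
rewrite le_eqVlt; apply/orP; left; apply/eqP; apply: eq_Rint => k.
by rewrite normcM normc_cis mulr1 normc_real.
Qed.

Lemma eq_trig a b x : a =1 b -> trig a x = trig b x.
Proof. by move=> /funext ->. Qed.

Lemma trigD a b x : l1 a -> l1 b -> trig (fun k => a k + b k) x = trig a x + trig b x.
Proof.
move=> Ia Ib; rewrite /trig -cintD; [|exact: trig_integrand..].
by apply: eq_cint => k; rewrite real_complexD mulrDl.
Qed.

Lemma trigZ s a x : l1 a -> trig (fun k => s * a k) x = s%:C%C * trig a x.
Proof.
move=> Ia; rewrite /trig -cintZ; last exact: trig_integrand.
by apply: eq_cint => k; rewrite real_complexM mulrA.
Qed.

Lemma trigB a b x : l1 a -> l1 b -> trig (fun k => a k - b k) x = trig a x - trig b x.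
Proof.
move=> Ia Ib; rewrite /trig -cintB; [|exact: trig_integrand..].
by apply: eq_cint => k; rewrite rmorphB mulrBl.
Qed.

Lemma trig_delta j x : trig (delta j) x = cis (2 * pi * dot (zvec j) x).
Proof.
set z := cis _.
transitivity (cint sumZ (fun k => z * (delta j k)%:C%C)).
  by apply: eq_cint => k; rewrite /delta; case: eqP => [->|_]; rewrite ?mul1r ?mulr1 ?mul0r ?mulr0.
rewrite cintZ; last by apply: cintegrable_real; exact: l1_delta.
by rewrite cint_real [X in X%:C%C]Rint_indic1 mulr1.
Qed.

Lemma trig_delta0 x : trig (delta 0) x = 1.
Proof. by rewrite trig_delta zvec0 dot0l mulr0 cis0. Qed.

Lemma trig_refl a x : l1 a -> trig (refl a) x = trig a (- x).
Proof.
move=> Ia; rewrite /trig -(cint_reindex neg_bij (trig_integrand (- x) Ia)).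
by apply: eq_cint => k; rewrite /refl zvecN dotNl dotNr opprK.
Qed.

Lemma conj_trig a x : l1 a -> ((trig a x)^*)%C = trig a (- x).
Proof.
move=> Ia; rewrite /trig -cint_conj; last exact: trig_integrand.
by apply: eq_cint => k; rewrite conjcM conjc_real conj_cis dotNr mulrN.
Qed.

Lemma trig_periodic a x k : trig a (x + zvec k) = trig a x.
Proof.
apply: eq_cint => l; rewrite dotDr mulrDr cisD.
have -> : dot (zvec l) (zvec k) = (\sum_i l ord0 i * k ord0 i)%:~R :> R.
  by rewrite /dot rmorph_sum; apply: eq_bigr => i _; rewrite !mxE rmorphM.
by rewrite cis_2piz mulr1.
Qed.

Lemma cmeas_trig a : cmeas (trig a).
Proof.
apply: (@cmeas_cint _ _ _ _ R sumZ (fun z => (a z.2)%:C%C * cis (2 * pi * dot (zvec z.2) z.1))).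
have H k : cmeas (fun t : E => (a k)%:C%C * cis (2 * pi * dot (zvec k) t)).
  apply: cmeasM; [exact: cmeas_cst|apply: cmeas_cis].
  by apply: measurable_funM => //; exact: measurable_dot.
split; apply: cnt_fubini_measurable2 => k; [exact: (H k).1|exact: (H k).2].
Qed.

Lemma cintegrable_icube : cintegrable mu (fun x => (icube x)%:C%C).
Proof. by apply: cintegrable_real; exact: rintegrable_icube. Qed.

(** Exchange of the sum with the integral, then orthogonality of the characters on the cube. *)
Lemma trig_coef a m : l1 a ->
  cint mu (fun x => (trig a x * cis (- (2 * pi * dot (zvec m) x))) * (icube x)%:C%C) = (a m)%:C%C.
Proof.
move=> Ia.
pose h (z : discrete Zn * E) : R[i] := cis (2 * pi * dot (zvec z.1) z.2 - 2 * pi * dot (zvec m) z.2).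
have mh : cmeas h.
  have H k : cmeas (fun t : E => h (k, t)).
    rewrite /h /=; apply: cmeas_cis; apply: measurable_funB.
      by apply: measurable_funM => //; exact: measurable_dot.
    by apply: measurable_funM => //; exact: measurable_dot.
  split; apply: cnt_fubini_measurable => k; [exact: (H k).1|exact: (H k).2].
have [|_ H] := cint_exchange (B := 1) (cintegrable_real Ia) cintegrable_icube mh.
  by move=> z; rewrite normc_cis.
have E1 x : cint sumZ (fun k => (a k)%:C%C * h (k, x)) = trig a x * cis (- (2 * pi * dot (zvec m) x)).
  rewrite /trig -cintZr; last exact: trig_integrand.
  by apply: eq_cint => k; rewrite /h cisD mulrA.
rewrite -(eq_cint _ (fun x => congr1 (fun u => u * (icube x)%:C%C) (E1 x))) -H.
have E2 k : cint mu (fun x => h (k, x) * (icube x)%:C%C) = (k == m)%:R.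
  rewrite -(subr_eq0 k m) -(cube_character (k - m)).2; apply: eq_cint => x.
  by rewrite mulrC /h /= zvecB dotBl mulrBr.
rewrite -[in RHS](Rint_indic1 (m : discrete Zn) (a m)) -cint_real.
apply: eq_cint => k; rewrite E2; case: eqP => [->|_]; first by rewrite mulr1.
by rewrite mulr0.
Qed.

Lemma Rint_icube : (\int[mu]_x icube x = 1)%R.
Proof.
have H := (cube_character (R := R) (0 : Zn)).2; rewrite eqxx in H.
transitivity (Re (1 : R[i])); last by [].
rewrite -[X in Re X]H; apply: eq_Rint => x.
by rewrite zvec0 dot0l mulr0 cis0 mulr1.
Qed.

(** A coefficient is a mean over a cube of volume 1. In Wiener's lemma this is how a sup norm bound
    on the symbol enters. *)
Lemma trig_coef_le a (M : R) m : l1 a -> (forall x, normc (trig a x) <= M) -> `|a m| <= M.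
Proof.
move=> Ia aM; rewrite -normc_real -(trig_coef m Ia).
have I : cintegrable mu (fun x => (trig a x * cis (- (2 * pi * dot (zvec m) x))) * (icube x)%:C%C).
  apply: (cintegrableMr (B := M)); first exact: cintegrable_icube.
    apply: cmeasM; first exact: cmeas_trig.
    apply: cmeas_cis; apply: measurableT_comp => //; apply: measurable_funM => //.
    exact: measurable_dot.
  by move=> x; rewrite normcM normc_cis mulr1.
apply: le_trans (normc_cint_le I) _; have -> : M = (\int[mu]_x (M * icube x))%R.
  by rewrite RintZl ?Rint_icube ?mulr1//; exact: rintegrable_icube.
apply: Rint_le; first exact: cintegrable_normc.
  by apply: rintegrableZl; exact: rintegrable_icube.
move=> x; case/andP: (icube_itv x) => i0 _.
by rewrite !normcM normc_cis mulr1 normc_real ger0_norm// ler_wpM2r.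
Qed.

(** It replaces the algebra of convolutions: identities between sequences are checked on their
    symbols, where [conv] is a product. *)
Lemma trig_inj a b : l1 a -> l1 b -> (forall x, trig a x = trig b x) -> forall k, a k = b k.
Proof.
move=> Ia Ib ab k.
have H : (a k)%:C%C = (b k)%:C%C :> R[i].
  by rewrite -(trig_coef k Ia) -(trig_coef k Ib); apply: eq_cint => x; rewrite ab.
by move/(congr1 (@complex.Re R)) : H.
Qed.

Lemma fourier_coef_trig (u : 'rV[R[i]]_n -> R[i]) a k : l1 a ->
  (forall x, u (torus_pt x) = trig a x) -> fourier_coef u k = (a k)%:C%C.
Proof.
move=> Ia ua; rewrite -(trig_coef k Ia) /fourier_coef.
have E1 (f : E -> R) : (\int[mu]_(x in @unit_cube R n) f x)%R = (\int[mu]_x (f x * icube x))%R.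
  rewrite Rintegral_mkcond; apply: eq_Rint => x; rewrite patchE /icube indicE.
  by case: ifP => _ /=; rewrite ?mulr1 ?mulr0.
congr (_ +i* _)%C; rewrite E1; apply: eq_Rint => x; rewrite ua.
  by rewrite Re_mulr_real.
by rewrite Im_mulr_real.
Qed.

Let conv_int2 a b k : l1 a -> l1 b -> rintegrable sumZ (fun l => a l * b (k - l)).
Proof.
move=> Ia Ib; apply: (rintegrableMl (B := l1norm b)) => // l; exact: l1_term.
Qed.

Let conv_int1 a b l : l1 b -> rintegrable sumZ (fun k => a l * b (k - l)).
Proof.
move=> Ib; apply: rintegrableZl; exact: (rintegrable_reindex (subr_bij l) Ib).
Qed.

Let conv_fin a b : l1 a -> l1 b ->
  (\int[sumZ]_k \int[sumZ]_l `|a l * b (k - l)|%:E = (l1norm a * l1norm b)%:E)%E.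
Proof.
move=> Ia Ib; pose f (z : discrete Zn * discrete Zn) : \bar R := `|a z.2 * b (z.1 - z.2)|%:E.
have mf : measurable_fun setT f.
  by apply: cnt_fubini_measurable => k; exact: measurable_fun_discrete.
have f0 z : (0 <= f z)%E by rewrite lee_fin.
transitivity (\int[sumZ]_l \int[sumZ]_k f (k, l))%E.
  exact: (fubini_tonelli (m1 := sumZ) (m2 := sumZ) f mf f0).
have nb := rintegrable_norm Ib; have na := rintegrable_norm Ia.
have E1 l : (\int[sumZ]_k f (k, l))%E = (`|a l| * l1norm b)%:E.
  rewrite -[l1norm b](Rint_reindex (subr_bij l) nb) -RintZl; last first.
    exact: (rintegrable_reindex (subr_bij l) nb).
  rewrite EFin_Rint; last by apply: rintegrableZl; exact: (rintegrable_reindex (subr_bij l) nb).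
  by apply: eq_integral => k _; rewrite /f normrM.
under eq_integral do rewrite E1.
rewrite -EFin_Rint; last exact: rintegrableZr.
by rewrite RintZr.
Qed.

Lemma l1_conv a b : l1 a -> l1 b -> l1 (conv a b).
Proof.
move=> Ia Ib.
have [||||H _] := @Rint_fubini _ _ _ _ R sumZ sumZ (fun z => a z.2 * b (z.1 - z.2)).
- by apply: cnt_fubini_measurable => k; exact: measurable_fun_discrete.
- by apply: le_lt_trans (ltry (l1norm a * l1norm b)); rewrite -(conv_fin Ia Ib).
- by move=> k; exact: conv_int2.
- by move=> l; exact: conv_int1.
exact: H.
Qed.

Lemma l1norm_conv a b : l1 a -> l1 b -> l1norm (conv a b) <= l1norm a * l1norm b.
Proof.
move=> Ia Ib; have Ic := rintegrable_norm (l1_conv Ia Ib).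
rewrite -lee_fin -conv_fin// EFin_Rint//; apply: ge0_le_integral => //.
move=> k _; rewrite -EFin_Rint; last by apply: rintegrable_norm; exact: conv_int2.
by rewrite lee_fin Rint_norm//; exact: conv_int2.
Qed.

Lemma trig_conv a b x : l1 a -> l1 b -> trig (conv a b) x = trig a x * trig b x.
Proof.
move=> Ia Ib.
pose f (z : discrete Zn * discrete Zn) : R[i] :=
  (a z.2 * b (z.1 - z.2))%:C%C * cis (2 * pi * dot (zvec z.1) x).
have mf : cmeas f.
  by split; apply: cnt_fubini_measurable => k; exact: measurable_fun_discrete.
have nf k l : normc (f (k, l)) = `|a l * b (k - l)|.
  by rewrite /f normcM normc_cis mulr1 normc_real.
have [|||_ H] := @cint_fubini _ _ _ _ R sumZ sumZ f mf.
- rewrite (_ : (\int[_]_x _)%E = (l1norm a * l1norm b)%:E) ?ltry//.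
  rewrite -(conv_fin Ia Ib); apply: eq_integral => k _; apply: eq_integral => l _.
  by rewrite nf.
- move=> k; rewrite /f /=; under [X in cintegrable _ X]funext do rewrite mulrC.
  by apply: cintegrableZ; apply: cintegrable_real; exact: conv_int2.
- move=> l; apply: (cintegrable_le (u := fun k : discrete Zn => `|a l * b (k - l)|)).
  + by split.
  + by move=> k; rewrite nf.
  + by apply: rintegrable_norm; exact: conv_int1.
transitivity (cint sumZ (fun k => cint sumZ (fun l => f (k, l)))).
  apply: eq_cint => k; rewrite /conv -cint_real.
  by rewrite -cintZr; last by apply: cintegrable_real; exact: conv_int2.
rewrite H /trig -cintZr; last exact: trig_integrand.
apply: eq_cint => l; rewrite -(cint_reindex (subr_bij l) (trig_integrand x Ib)) -cintZ; last first.
  exact: (cintegrable_reindex (subr_bij l) (trig_integrand x Ib)).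
apply: eq_cint => k; rewrite /f /= real_complexM mulrACA -cisD zvecB dotBl mulrBr.
by congr (_ * cis _); ring.
Qed.

Lemma conv_eq0 a b k : (forall l, a l = 0 \/ b (k - l) = 0) -> conv a b k = 0.
Proof.
move=> ab; transitivity (\int[sumZ]_l (0 : R))%R; last by rewrite Rintegral_cst// mul0r.
by apply: eq_Rint => l; case: (ab l) => ->; rewrite ?mul0r ?mulr0.
Qed.

End trigonometric_series.

(** * Exponential and logarithm series *)

Section series_nat.
Context {R : realType}.
Local Notation sumN := (cnt nat R).
Implicit Types (u v : discrete nat -> R).

Lemma partial_sumE u N :
  \sum_(m < N) u m = (\int[sumN]_m (if (m < N)%N then u m else 0))%R.
Proof.
rewrite (@Rint_finsupp _ _ (iota 0 N)) ?iota_uniq//; last first.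
  by move=> m; rewrite mem_iota add0n => /negbTE/= ->.
transitivity (\sum_(0 <= m < N) (if (m < N)%N then u m else 0)); last first.
  by rewrite /index_iota subn0.
by rewrite big_mkord; apply: eq_bigr => i _; rewrite ltn_ord.
Qed.

Lemma Rint_nat_cvg u : rintegrable sumN u ->
  (\sum_(m < N) u m)%R @[N --> \oo] --> (\int[sumN]_m u m)%R.
Proof.
move=> Iu; pose f (N : nat) (m : discrete nat) : R := if (m < N)%N then u m else 0.
have [||||_ H] := @Rint_dct _ _ R sumN f u (fun m => `|u m|).
- by move=> N.
- move=> m; apply: (@cvg_near_cst _ R^o); near=> N.
  by rewrite /f ifT//; near: N; exact: nbhs_infty_gt.
- exact: rintegrable_norm.
- by move=> N m; rewrite /f; case: ifP => // _; rewrite normr0.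
by under eq_fun do rewrite partial_sumE.
Unshelve. all: by end_near. Qed.

Lemma Rint_nat_eq u (l : R) : rintegrable sumN u ->
  (\sum_(m < N) u m)%R @[N --> \oo] --> l -> (\int[sumN]_m u m = l)%R.
Proof. by move=> /Rint_nat_cvg H; apply: cvg_unique H. Qed.

Lemma partial_sum_le u N : (forall m, 0 <= u m) -> rintegrable sumN u ->
  \sum_(m < N) u m <= (\int[sumN]_m u m)%R.
Proof.
move=> u0 Iu; rewrite partial_sumE; apply: Rint_le => //.
  apply: rintegrable_le (rintegrable_norm Iu) => // m.
  by case: ifP => // _; rewrite normr0.
by move=> m; case: ifP.
Qed.

Lemma rintegrable_nat u (B : R) : (forall N, \sum_(m < N) `|u m| <= B) -> rintegrable sumN u.
Proof.
move=> uB; apply/rintegrable_cntP; rewrite -nneseries_esumT//.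
apply: (@le_lt_trans _ _ B%:E); last exact: ltry.
apply: lime_le; first exact: is_cvg_nneseries.
by near=> N; rewrite sumEFin lee_fin big_mkord.
Unshelve. all: by end_near. Qed.

Lemma rintegrable_geometric (q : R) : 0 <= q < 1 -> rintegrable sumN (fun m => q ^+ m).
Proof.
move=> /andP[q0 q1]; apply: (@rintegrable_nat _ (1 - q)^-1) => N.
have p : 0 < 1 - q by rewrite subr_gt0.
under eq_bigr do rewrite ger0_norm ?exprn_ge0//.
rewrite -[leLHS](mulKf (lt0r_neq0 p)) ler_piMr ?invr_ge0 ?(ltW p)//.
by rewrite -(opprB q) mulNr -subrX1 opprB lerBlDr lerDl exprn_ge0.
Qed.

Lemma Rint_geometric (q : R) : 0 <= q < 1 -> (\int[sumN]_m q ^+ m)%R = (1 - q)^-1.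
Proof.
move=> q01; apply: Rint_nat_eq; first exact: rintegrable_geometric.
have /andP[q0 q1] := q01.
rewrite (_ : (fun N => _) = series (geometric 1 q)).
  by rewrite -[X in _ --> X]mul1r; apply: cvg_geometric_series; rewrite ger0_norm.
apply/funext => N; rewrite /series /= big_mkord; apply: eq_bigr => i _.
by rewrite mul1r.
Qed.

Lemma Rint_nat_recl u : rintegrable sumN (fun m => u m.+1) ->
  rintegrable sumN u /\ (\int[sumN]_m u m = u 0%N + \int[sumN]_m u m.+1)%R.
Proof.
move=> Iu.
have I : rintegrable sumN u.
  apply: (@rintegrable_nat _ (`|u 0%N| + \int[sumN]_m `|u m.+1|)%R) => -[|N].
    by rewrite big_ord0 addr_ge0// Rint_ge0.
  rewrite big_ord_recl lerD2l.
  exact: (partial_sum_le (u := fun m => `|u m.+1|) _ (fun=> normr_ge0 _) (rintegrable_norm Iu)).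
split=> //; apply: Rint_nat_eq => //; rewrite -(cvg_shiftn 1).
apply: cvg_trans (cvgD (cvg_cst (u 0%N)) (Rint_nat_cvg Iu)).
by apply: near_eq_cvg; near=> N; rewrite /= addn1 big_ord_recl.
Unshelve. all: by end_near. Qed.

Lemma Rint_nat_shift u i : rintegrable sumN u ->
  rintegrable sumN (fun m => if (i <= m)%N then u (m - i)%N else 0) /\
  (\int[sumN]_m (if (i <= m)%N then u (m - i)%N else 0) = \int[sumN]_m u m)%R.
Proof.
move=> Iu; elim: i => [|i [I1 E1]].
  by split; [apply: eq_rintegrable Iu => m|apply: eq_Rint => m]; rewrite subn0.
have [] := @Rint_nat_recl (fun m => if (i.+1 <= m)%N then u (m - i.+1)%N else 0).
  by apply: eq_rintegrable I1 => m; rewrite ltnS subSS.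
move=> I2 ->; split=> //; rewrite ltn0 add0r -E1; apply: eq_Rint => m.
by rewrite ltnS subSS.
Qed.

End series_nat.

Section exponential_series.
Context {R : realType}.
Local Notation sumN := (cnt nat R).
Implicit Types (z w : R[i]) (r : R).

Lemma normcX z m : normc (z ^+ m) = normc z ^+ m.
Proof.
elim: m => [|m IH]; first by rewrite !expr0 (normc_real 1) normr1.
by rewrite !exprS normcM IH.
Qed.

Lemma partial_csumE (u : discrete nat -> R[i]) N :
  \sum_(m < N) u m = cint sumN (fun m => if (m < N)%N then u m else 0).
Proof.
apply: complex_eqP.
  rewrite (big_morph (@complex.Re R) (@ReD R) (erefl _)) (partial_sumE (fun m => Re (u m))).
  by apply: eq_Rint => m; case: ifP.
rewrite (big_morph (@complex.Im R) (@ImD R) (erefl _)) (partial_sumE (fun m => Im (u m))).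
by apply: eq_Rint => m; case: ifP.
Qed.

Lemma rintegrable_exp r : rintegrable sumN (fun m => r ^+ m / m`!%:R).
Proof.
apply: (@rintegrable_nat _ _ (expR `|r|)) => N.
under eq_bigr do rewrite normrM normrX (ger0_norm (x := _^-1)) ?invr_ge0//.
have -> : \sum_(m < N) `|r| ^+ m / m`!%:R = series (exp_coeff `|r|) N.
  by rewrite /series /= big_mkord.
apply: nondecreasing_cvgn_le; last exact: is_cvg_series_exp_coeff.
by apply: nondecreasing_series => m _ _; exact: exp_coeff_ge0.
Qed.

Lemma Rint_exp r : (\int[sumN]_m (r ^+ m / m`!%:R) = expR r)%R.
Proof.
apply: Rint_nat_eq; first exact: rintegrable_exp.
rewrite (_ : (fun N => _) = series (exp_coeff r)); first exact: is_cvg_series_exp_coeff.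
by apply/funext => N; rewrite /series /= big_mkord.
Qed.

Definition exp_term z (m : discrete nat) : R[i] := z ^+ m * (m`!%:R^-1)%:C%C.

Lemma normc_exp_term z m : normc (exp_term z m) = normc z ^+ m / m`!%:R.
Proof. by rewrite normcM normcX normc_real ger0_norm// invr_ge0. Qed.

Lemma exp_term_integrable z : cintegrable sumN (exp_term z).
Proof.
apply: (cintegrable_le (u := fun m : discrete nat => normc z ^+ m / m`!%:R)).
- by split.
- by move=> m; rewrite normc_exp_term.
- exact: rintegrable_exp.
Qed.

Let cshift z (i : nat) (m : discrete nat) : R[i] := if (i <= m)%N then exp_term z (m - i)%N else 0.

Let cshift_Re z i m : Re (cshift z i m) = if (i <= m)%N then Re (exp_term z (m - i)%N) else 0.
Proof. by rewrite /cshift; case: ifP. Qed.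

Let cshift_Im z i m : Im (cshift z i m) = if (i <= m)%N then Im (exp_term z (m - i)%N) else 0.
Proof. by rewrite /cshift; case: ifP. Qed.

Let cshift_int z i : cintegrable sumN (cshift z i).
Proof.
have [Ir Ii] := exp_term_integrable z; split.
  exact: eq_rintegrable (fun m => esym (cshift_Re z i m)) (Rint_nat_shift i Ir).1.
exact: eq_rintegrable (fun m => esym (cshift_Im z i m)) (Rint_nat_shift i Ii).1.
Qed.

Let cint_shift z i : cint sumN (cshift z i) = cint sumN (exp_term z).
Proof.
have [Ir Ii] := exp_term_integrable z; congr (_ +i* _)%C.
  by rewrite -(Rint_nat_shift i Ir).2; apply: eq_Rint => m; exact: cshift_Re.
by rewrite -(Rint_nat_shift i Ii).2; apply: eq_Rint => m; exact: cshift_Im.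
Qed.

(* Cauchy product: exchange the sums over [i] and [m] in the double series of
   [z^i w^(m-i) / (i! (m-i)!)]. *)
Lemma cint_exp_termD z w :
  cint sumN (exp_term (z + w)) = cint sumN (exp_term z) * cint sumN (exp_term w).
Proof.
pose f (p : discrete nat * discrete nat) : R[i] := exp_term z p.1 * cshift w p.1 p.2.
have mf : cmeas f.
  by split; apply: cnt_fubini_measurable => k; exact: measurable_fun_discrete.
have Iz := exp_term_integrable z; have Iw := exp_term_integrable w.
have cn i m : normc (cshift w i m) = if (i <= m)%N then normc (exp_term w (m - i)%N) else 0.
  by rewrite /cshift; case: ifP => // _; rewrite normc0.
set W := (\int[sumN]_m normc (exp_term w m))%R.
have EW i : (\int[sumN]_m normc (cshift w i m))%R = W.
  rewrite /W -(Rint_nat_shift i (cintegrable_normc Iw)).2.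
  by apply: eq_Rint => m; rewrite cn.
have [|||_ H] := @cint_fubini _ _ _ _ R sumN sumN f mf.
- rewrite (_ : (\int[_]_x _)%E = (\int[sumN]_i (normc (exp_term z i) * W)%:E)%E).
    rewrite -EFin_Rint ?ltry//; apply: rintegrableZr; exact: cintegrable_normc.
  apply: eq_integral => i _; rewrite -(EW i) -RintZl; last exact: cintegrable_normc.
  rewrite EFin_Rint; last by apply: rintegrableZl; exact: cintegrable_normc.
  by apply: eq_integral => m _; rewrite /f normcM.
- by move=> i; rewrite /f /=; apply: cintegrableZ; exact: cshift_int.
- move=> m; apply: (cintegrableMl (B := \sum_(i < m.+1) normc (exp_term w (m - i)%N))).
  + exact: Iz.
  + by split.
  move=> i; rewrite cn; case: ifP => im; last by apply: sumr_ge0 => k _; exact: normc_ge0.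
  have im' : (i < m.+1)%N by rewrite ltnS.
  rewrite (bigD1 (Ordinal im'))//= lerDl; apply: sumr_ge0 => k _; exact: normc_ge0.
transitivity (cint sumN (fun i => cint sumN (fun m => f (i, m)))); last first.
  rewrite -(cintZr _ Iz); apply: eq_cint => i; rewrite /f /= cintZ; last exact: cshift_int.
  by rewrite cint_shift.
rewrite H; apply: eq_cint => m.
have E1 i : f (i, m) = if (i < m.+1)%N then exp_term z i * exp_term w (m - i)%N else 0.
  rewrite /f /cshift /= ltnS; case: ifP => _; [by []|exact: mulr0].
have E2 : exp_term (z + w) m = \sum_(i < m.+1) (exp_term z i * exp_term w (m - i)%N).
  rewrite /exp_term addrC exprDn mulr_suml; apply: eq_bigr => i _.
  have im : (i <= m)%N by rewrite -ltnS.
  rewrite -mulr_natr mulrACA [w ^+ _ * _]mulrC -!mulrA; congr (_ * (_ * _)).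
  rewrite (_ : ('C(m, i)%:R : R[i]) = ('C(m, i)%:R : R)%:C%C); last by rewrite rmorph_nat.
  rewrite -!real_complexM; congr (_%:C%C).
  rewrite -(bin_fact im) !natrM; field.
  by rewrite !pnatr_eq0 -!lt0n !fact_gt0 bin_gt0 im.
rewrite E2 (partial_csumE (fun i : discrete nat => exp_term z i * exp_term w (m - i)%N)).
exact: eq_cint.
Qed.

Let imag r : R[i] := (0 +i* r)%C.

Let imagX r m : imag r ^+ m =
  if odd m then imag ((-1) ^+ m./2 * r ^+ m) else ((-1) ^+ m./2 * r ^+ m)%:C%C.
Proof.
elim: m => [|m IH]; first by rewrite expr0 mulr1.
rewrite exprS IH /= uphalf_half; case: (odd m) => /=.
  by apply: complex_eqP; rewrite ?ReM ?ImM /= ?exprS; ring.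
by apply: complex_eqP; rewrite ?ReM ?ImM /= ?exprS; ring.
Qed.

Let cint_exp_term_imag r : cint sumN (exp_term (imag r)) = cis r.
Proof.
have [Ir Ii] := exp_term_integrable (imag r); congr (_ +i* _)%C; apply: Rint_nat_eq => //.
  rewrite cos.unlock (_ : (fun N => _) = series (cos_coeff r)).
    exact: is_cvg_series_cos_coeff.
  apply/funext => N; rewrite /series /= big_mkord; apply: eq_bigr => i _.
  rewrite cos_coeffE /exp_term Re_mulr_real imagX /=.
  by case: (odd i); rewrite ?mul0r ?mul1r//= mulrAC.
rewrite sin.unlock (_ : (fun N => _) = series (sin_coeff r)).
  exact: is_cvg_series_sin_coeff.
apply/funext => N; rewrite /series /= big_mkord; apply: eq_bigr => i _.
rewrite sin_coeffE /exp_term Im_mulr_real imagX /=.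
case: (nat_of_ord i) => [|k]; first by rewrite !mul0r.
rewrite /= uphalf_half; case: (odd k); rewrite ?mul0r ?mul1r//= mulrAC//.
Qed.

(** [cexp] is defined from the real exponential and [cis]. Additivity of the series separates the
    real and imaginary parts of [z], for which it reduces to the exponential, cosine and sine
    series. *)
Lemma cint_exp_term z : cint sumN (exp_term z) = cexp z.
Proof.
have {1}-> : z = (Re z)%:C%C + imag (Im z).
  by apply: complex_eqP; rewrite ?ReD ?ImD /= ?addr0 ?add0r.
rewrite cint_exp_termD cint_exp_term_imag; congr (_ * _).
rewrite -Rint_exp -cint_real; apply: eq_cint => m.
by rewrite /exp_term -rmorphXn -real_complexM.
Qed.

Lemma cexpD z w : cexp (z + w) = cexp z * cexp w.
Proof. by rewrite -!cint_exp_term cint_exp_termD. Qed.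

End exponential_series.

Section logarithm_series.
Context {R : realType}.
Local Notation sumN := (cnt nat R).
Implicit Types t : R.

Let log_part (N : nat) t : R := \sum_(m < N) t ^+ m.+1 / m.+1%:R.

Let derive_log_part N t : is_derive t 1 (log_part N) (\sum_(m < N) t ^+ m).
Proof.
elim: N => [|N IH].
  rewrite big_ord0 (_ : log_part 0 = cst 0); last by apply/funext => s; rewrite /log_part big_ord0.
  exact: is_derive_cst.
have H := is_deriveD IH (is_deriveZ (N.+1%:R^-1) (is_deriveX N.+1 (is_derive_id t (1 : R)))).
have -> : log_part N.+1 = (log_part N + (N.+1%:R^-1 \*: (id ^+ N.+1)))%R.
  apply/funext => s; rewrite /log_part big_ord_recr /= mulrC; congr (_ + _).
  by rewrite exprfctE.
apply: (is_derive_eq H).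
by rewrite big_ord_recr /= /GRing.scale /= mulr1 mulrA mulVf ?mul1r// pnatr_eq0.
Qed.

Let derive_ln1B t : t < 1 -> is_derive t 1 (fun s => ln (1 - s)) (- (1 - t)^-1).
Proof.
move=> t1; have p : 0 < 1 - t by rewrite subr_gt0.
have := @is_derive1_comp R (@ln R) (fun s => 1 - s) t (1 - t)^-1 (-1) (is_derive1_ln p).
rewrite mulrN1; apply.
by apply: (is_derive_eq (is_deriveB (is_derive_cst (1 : R) t 1) (is_derive_id t 1))); rewrite sub0r.
Qed.

Lemma rintegrable_log t : 0 <= t < 1 -> rintegrable sumN (fun m => t ^+ m.+1 / m.+1%:R).
Proof.
move=> t01; have /andP[t0 t1] := t01; apply: rintegrable_le (rintegrable_geometric t01) => // m.
rewrite ger0_norm ?mulr_ge0 ?exprn_ge0// exprS mulrAC ler_piMl ?exprn_ge0//.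
by rewrite ler_pdivrMr// mul1r (le_trans (ltW t1))// ler1n.
Qed.

(** The error [log_part N t + ln (1 - t)] vanishes at 0 and has derivative -t^N/(1 - t). By the mean
    value theorem its modulus is at most t^N/(1 - t), which tends to 0. *)
Lemma Rint_log t : 0 <= t < 1 -> (\int[sumN]_m (t ^+ m.+1 / m.+1%:R) = - ln (1 - t))%R.
Proof.
move=> t01; have /andP[t0 t1] := t01; have p : 0 < 1 - t by rewrite subr_gt0.
apply: Rint_nat_eq; first exact: rintegrable_log.
have D (N : nat) (s : R) : s < 1 -> is_derive s 1 (fun u => log_part N u + ln (1 - u)) (- (s ^+ N / (1 - s))).
  move=> s1; have q : 1 - s != 0 by rewrite subr_eq0 gt_eqF.
  apply: (is_derive_eq (is_deriveD (derive_log_part N s) (derive_ln1B s1))).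
  apply: (mulIf q); rewrite mulrBl mulVf// mulNr divfK//.
  by rewrite mulrC -(opprB s) mulNr -subrX1; ring.
have bound (N : nat) : `|log_part N t + ln (1 - t)| <= t ^+ N / (1 - t).
  move: t0; rewrite le_eqVlt => /predU1P[<-|t0].
    rewrite subr0 ln1 addr0 /log_part big1 ?normr0 ?mulr_ge0 ?exprn_ge0 ?invr_ge0//.
    by move=> i _; rewrite expr0n mul0r.
  have [||c /andP[c0 ct]] := @MVT R (fun u => log_part N u + ln (1 - u)) (fun s => - (s ^+ N / (1 - s))) 0 t t0.
  - by move=> s; rewrite in_itv/= => /andP[_ st]; apply: D; exact: lt_trans t1.
  - apply: derivable_within_continuous => s; rewrite in_itv/= => /andP[_ st].
    by have [] := D N s (le_lt_trans st t1).
  rewrite !subr0 ln1 addr0 [log_part N 0]big1 ?subr0; last by move=> i _; rewrite expr0n mul0r.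
  move=> ->; have c1 := lt_trans ct t1; have pc : 0 < 1 - c by rewrite subr_gt0.
  have h0 : 0 <= c ^+ N / (1 - c) by rewrite divr_ge0 ?exprn_ge0// ltW.
  rewrite normrM normrN !ger0_norm ?(ltW t0)//.
  apply: (@le_trans _ _ (c ^+ N / (1 - c))); first by rewrite ler_piMr// ltW.
  apply: ler_pM; rewrite ?exprn_ge0 ?invr_ge0 ?(ltW c0) ?(ltW pc)//.
    by rewrite lerXn2r ?nnegrE ?(ltW c0) ?(ltW t0) ?(ltW ct).
  by rewrite lef_pV2 ?posrE// lerD2l lerN2 ltW.
have lim0 : (t ^+ N / (1 - t)) @[N --> \oo] --> 0.
  rewrite -[X in _ --> X](mul0r (1 - t)^-1); apply: cvgMl.
  by apply: cvg_expr; rewrite ger0_norm.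
apply/cvgrPdist_le => e e0; near=> N.
rewrite -opprD normrN addrC; apply: le_trans (bound N) _; rewrite -[leLHS]ger0_norm ?divr_ge0 ?exprn_ge0 ?(ltW p)// -normrN -sub0r.
by near: N; move/cvgrPdist_le: lim0; apply.
Unshelve. all: by end_near. Qed.

End logarithm_series.

(** * Wiener's lemma *)

Section polynomial_growth.
Context {R : realType}.
Implicit Types x q : R.

Lemma bernoulli_ineq x m : -1 <= x -> 1 + m%:R * x <= (1 + x) ^+ m.
Proof.
move=> x1; elim: m => [|m IH]; first by rewrite mul0r addr0.
have x0 : 0 <= 1 + x by rewrite addrC -lerBlDr sub0r.
rewrite exprSr; apply: le_trans (ler_wpM2r x0 IH).
have -> : (1 + m%:R * x) * (1 + x) = 1 + m.+1%:R * x + m%:R * x ^+ 2 by rewrite -natr1; ring.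
by rewrite lerDl (mulr_ge0 _ (sqr_ge0 _)).
Qed.

(* [t] is an approximate (n+1)-st root of [q]: one factor [t^m] absorbs each
   factor [m c + 1], by Bernoulli's inequality. *)
Lemma polynomial_geometric (n : nat) (c q : R) : 0 <= c -> 0 <= q < 1 ->
  exists K t, [/\ 0 <= t < 1, 0 <= K & forall m : nat, (m%:R * c + 1) ^+ n * q ^+ m <= K * t ^+ m].
Proof.
move=> c0 /andP[q0 q1]; pose d := (1 - q) / n.+1%:R.
have d0 : 0 < d by rewrite divr_gt0// subr_gt0.
have d1 : d <= 1.
  by rewrite ler_pdivrMr// mul1r (@le_trans _ _ 1)// ?ler1n// gerBl.
pose t := 1 - d; have t0 : 0 <= t by rewrite subr_ge0.
have t1 : t < 1 by rewrite gtrBl.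
have qt : q <= t ^+ n.+1.
  apply: le_trans (bernoulli_ineq _ _); last by rewrite lerN2.
  by rewrite mulrN mulrC divfK// subKr.
have tm (m : nat) : t ^+ m * (1 + m%:R * d) <= 1.
  apply: (@le_trans _ _ (t ^+ m * (1 + d) ^+ m)).
    apply: ler_wpM2l; first exact: exprn_ge0.
    by apply: bernoulli_ineq; apply: le_trans (ltW d0); rewrite oppr_le0.
  rewrite -exprMn exprn_ile1//; first by rewrite mulr_ge0// addr_ge0// ltW.
  have -> : t * (1 + d) = 1 - d ^+ 2 by rewrite /t; ring.
  by rewrite gerBl sqr_ge0.
(* K is chosen so that m c + 1 <= K (1 + m d), while t^m (1 + m d) <= 1. *)
pose K := c / d + 1; have K0 : 0 <= K by rewrite addr_ge0// divr_ge0// ltW.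
have km (m : nat) : (m%:R * c + 1) * t ^+ m <= K.
  apply: (@le_trans _ _ (K * (t ^+ m * (1 + m%:R * d)))); last by rewrite ler_piMr.
  rewrite [in leRHS]mulrCA mulrC ler_wpM2l ?exprn_ge0//.
  have -> : K * (1 + m%:R * d) = m%:R * c + 1 + (c / d + m%:R * d).
    by rewrite /K; field; exact: lt0r_neq0.
  by rewrite lerDl; apply: addr_ge0; [exact: divr_ge0 c0 (ltW d0)|exact: mulr_ge0 (ler0n _ _) (ltW d0)].
exists (K ^+ n), t; split; [by rewrite t0|exact: exprn_ge0|] => m.
apply: (@le_trans _ _ ((m%:R * c + 1) ^+ n * (t ^+ n.+1) ^+ m)).
  rewrite ler_wpM2l ?exprn_ge0// ?addr_ge0 ?mulr_ge0//.
  by rewrite lerXn2r ?nnegrE ?exprn_ge0.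
rewrite exprSr exprMn -exprM mulnC exprM mulrA -exprMn ler_wpM2r ?exprn_ge0//.
rewrite lerXn2r ?nnegrE//; apply: mulr_ge0; last exact: exprn_ge0.
by apply: addr_ge0 => //; exact: mulr_ge0.
Qed.

End polynomial_growth.

Section lattice_boxes.
Context {R : realType} (n : nat).
Local Notation Zn := 'rV[int]_n.
Local Notation sumZ := (cnt Zn R).

Definition lattice_box (D : nat) (k : Zn) : bool := [forall i, (absz (k ord0 i) <= D)%N].

Lemma lattice_box0 : lattice_box 0 (0 : Zn).
Proof. by apply/forallP => i; rewrite mxE. Qed.

Lemma lattice_boxD D1 D2 k l : lattice_box D1 k -> lattice_box D2 l ->
  lattice_box (D1 + D2) (k + l).
Proof.
move=> /forallP h1 /forallP h2; apply/forallP => i; rewrite mxE.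
by apply: leq_trans (leq_add (h1 i) (h2 i)); rewrite -lez_nat abszE !PoszD !abszE ler_normD.
Qed.

Lemma lattice_box_large (k : Zn) : lattice_box (\sum_i absz (k ord0 i)) k.
Proof. by apply/forallP => i; rewrite (bigD1 i)//= leq_addr. Qed.

Lemma lattice_box_le D1 D2 k : (D1 <= D2)%N -> lattice_box D1 k -> lattice_box D2 k.
Proof. by move=> D12 /forallP h; apply/forallP => i; apply: leq_trans (h i) D12. Qed.

Lemma lattice_box_seq (D : nat) : exists s : seq Zn,
  [/\ uniq s, (size s <= (2 * D + 1) ^ n)%N & forall k, lattice_box D k -> k \in s].
Proof.
pose f (v : 'rV['I_(2 * D + 1)]_n) : Zn := map_mx (fun i : 'I__ => (i : nat)%:Z - D%:Z) v.
exists (undup (map f (enum 'rV['I_(2 * D + 1)]_n))); split; first exact: undup_uniq.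
  by rewrite (leq_trans (size_undup _))// size_map -cardE card_mx card_ord mul1n.
move=> k /forallP kD; rewrite mem_undup; apply/mapP.
have lt i : (absz (k ord0 i + D%:Z)%R < 2 * D + 1)%N.
  rewrite addn1 ltnS mul2n -addnn -lez_nat PoszD abszE.
  by apply: le_trans (ler_normD _ _) _; rewrite lerD// -abszE lez_nat.
exists (\row_i Ordinal (lt i)); first by rewrite mem_enum.
apply/matrixP => u i; rewrite !mxE !ord1 /= gez0_abs ?addrK//.
have := kD i; rewrite -lez_nat abszE ler_norml => /andP[kDl _].
by rewrite -lerBlDr sub0r.
Qed.

Lemma box_l1norm_le (a : discrete Zn -> R) D M : 0 <= M ->
  (forall k, ~~ lattice_box D k -> a k = 0) -> (forall k, `|a k| <= M) ->
  l1norm a <= (D%:R * 2 + 1) ^+ n * M.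
Proof.
move=> M0 a0 aM; have [s [us ss sD]] := lattice_box_seq D.
rewrite /l1norm (Rint_finsupp us); last first.
  by move=> k ks; rewrite a0 ?normr0//; apply: contra ks; exact: sD.
apply: (@le_trans _ _ (\sum_(k <- s) M)); first exact: ler_sum.
have -> : \sum_(k <- s) M = (size s)%:R * M by rewrite big_const_seq count_predT iter_addr addr0 mulr_natl.
have -> : D%:R * 2 + 1 = (2 * D + 1)%:R :> R by rewrite natrD natrM mulrC.
by rewrite ler_wpM2r// -natrX ler_nat.
Qed.

End lattice_boxes.

Section wiener.
Context {R : realType} (n : nat).
Local Notation Zn := 'rV[int]_n.
Local Notation sumZ := (cnt Zn R).
Local Notation sumN := (cnt nat R).
Implicit Types (a b : discrete Zn -> R) (A : discrete nat -> discrete Zn -> R).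

Definition lsum A (k : discrete Zn) : R := (\int[sumN]_m A m k)%R.

Lemma lsum_term A k : (forall m, l1 (A m)) -> rintegrable sumN (fun m => l1norm (A m)) ->
  rintegrable sumN (fun m => A m k).
Proof. by move=> IA; apply: rintegrable_le => // m; exact: l1_term. Qed.

Let lsum_fin A : (forall m, l1 (A m)) -> rintegrable sumN (fun m => l1norm (A m)) ->
  (\int[sumZ]_k \int[sumN]_m `|A m k|%:E < +oo)%E.
Proof.
move=> IA I; pose f (z : discrete Zn * discrete nat) : \bar R := `|A z.2 z.1|%:E.
have mf : measurable_fun setT f.
  by apply: cnt_fubini_measurable => k; exact: measurable_fun_discrete.
have f0 z : (0 <= f z)%E by rewrite lee_fin.
rewrite (_ : (\int[_]_k _)%E = (\int[sumN]_m (l1norm (A m))%:E)%E).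
  by rewrite -EFin_Rint ?ltry.
transitivity (\int[sumN]_m \int[sumZ]_k f (k, m))%E.
  exact: (fubini_tonelli (m1 := sumZ) (m2 := sumN) f mf f0).
by apply: eq_integral => m _; rewrite EFin_Rint//; exact: rintegrable_norm (IA m).
Qed.

Lemma l1_lsum A : (forall m, l1 (A m)) -> rintegrable sumN (fun m => l1norm (A m)) ->
  l1 (lsum A).
Proof.
move=> IA I.
have [||||H _] := @Rint_fubini _ _ _ _ R sumZ sumN (fun z => A z.2 z.1).
- by apply: cnt_fubini_measurable => k; exact: measurable_fun_discrete.
- exact: lsum_fin IA I.
- by move=> k; exact: lsum_term.
- by move=> m; exact: IA.
exact: H.
Qed.

Lemma trig_lsum A x : (forall m, l1 (A m)) -> rintegrable sumN (fun m => l1norm (A m)) ->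
  trig (lsum A) x = cint sumN (fun m => trig (A m) x).
Proof.
move=> IA I.
pose f (z : discrete Zn * discrete nat) : R[i] :=
  (A z.2 z.1)%:C%C * cis (2 * pi * dot (zvec z.1) x).
have mf : cmeas f.
  by split; apply: cnt_fubini_measurable => k; exact: measurable_fun_discrete.
have [|||_ H] := @cint_fubini _ _ _ _ R sumZ sumN f mf.
- apply: le_lt_trans (lsum_fin IA I); rewrite le_eqVlt; apply/orP; left; apply/eqP.
  apply: eq_integral => k _; apply: eq_integral => m _.
  by rewrite /f normcM normc_cis mulr1 normc_real.
- move=> k; rewrite /f /=; apply: (cintegrableMl (B := 1)).
  + by apply: cintegrable_real; exact: lsum_term.
  + by split.
  + by move=> m; rewrite normc_cis.
- by move=> m; exact: (trig_integrand x (IA m)).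
transitivity (cint sumZ (fun k => cint sumN (fun m => f (k, m)))); last exact: H.
apply: eq_cint => k; rewrite /lsum -cint_real /f /= cintZr//.
by apply: cintegrable_real; exact: lsum_term.
Qed.

Fixpoint pow a (m : nat) : discrete Zn -> R :=
  if m is m'.+1 then conv a (pow a m') else delta 0.

Lemma l1_pow a m : l1 a -> l1 (pow a m).
Proof. by move=> Ia; elim: m => [|m IH]; [exact: l1_delta|exact: l1_conv]. Qed.

Lemma trig_pow a m x : l1 a -> trig (pow a m) x = trig a x ^+ m.
Proof.
move=> Ia; elim: m => [|m IH]; first by rewrite trig_delta0.
by rewrite trig_conv ?IH ?exprS//; exact: l1_pow.
Qed.

Lemma l1norm_pow a m : l1 a -> l1norm (pow a m) <= l1norm a ^+ m.
Proof.
move=> Ia; elim: m => [|m IH]; first by rewrite l1norm_delta.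
rewrite exprS; apply: le_trans (l1norm_conv Ia (l1_pow m Ia)) _.
by apply: ler_wpM2l => //; exact: l1norm_ge0.
Qed.

(** This is how an exponential series inherits support in a half-space. *)
Lemma pow_support (S : set Zn) a m : S 0 -> (forall k l, S k -> S l -> S (k + l)) ->
  (forall k, ~ S k -> a k = 0) -> forall k, ~ S k -> pow a m k = 0.
Proof.
move=> S0 SD a0; elim: m => [|m IH] k Sk.
  by rewrite /= /delta; case: eqP => // k0; case: Sk; rewrite k0.
apply: conv_eq0 => l; have [Sl|] := pselect (S l); last by left; exact: a0.
right; apply: IH => Skl; apply: Sk; rewrite -(subrK l k); exact: SD.
Qed.

Lemma pow_box a D m : (forall k, ~~ lattice_box D k -> a k = 0) ->
  forall k, ~~ lattice_box (m * D) k -> pow a m k = 0.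
Proof.
move=> a0; elim: m => [|m IH] k kD.
  by rewrite /= /delta; case: eqP => // k0; move: kD; rewrite mul0n k0 lattice_box0.
apply: conv_eq0 => l; have [lD|] := boolP (lattice_box D l); last by left; exact: a0.
right; apply: IH; apply: contra kD => kl; rewrite mulSn -(subrK l k) addrC.
exact: lattice_boxD.
Qed.

Lemma truncation a (e : R) : l1 a -> 0 < e -> exists D,
  l1norm (fun k => if lattice_box D k then 0 else a k) <= e.
Proof.
move=> Ia e0.
pose f (D : nat) (k : discrete Zn) : R := if lattice_box D k then 0 else `|a k|.
have [||||_ H] := @Rint_dct _ _ R sumZ f (fun=> 0) (fun k => `|a k|).
- by move=> D.
- move=> k; apply: (@cvg_near_cst _ R^o); near=> D.
  rewrite /f ifT//; apply: (lattice_box_le _ (lattice_box_large k)).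
  by near: D; exact: nbhs_infty_ge.
- exact: rintegrable_norm.
- by move=> D k; rewrite /f; case: ifP => // _; rewrite ?normr0 ?normr_id.
rewrite Rintegral_cst// mul0r in H.
have /cvgrPdist_le/(_ e e0)[D _ /(_ D (leqnn D)) HD] := H.
exists D; apply: le_trans HD; rewrite sub0r normrN; apply: le_trans (ler_norm _).
rewrite le_eqVlt; apply/orP; left; apply/eqP; apply: eq_Rint => k.
by rewrite /f; case: ifP => _ //; rewrite normr0.
Unshelve. all: by end_near. Qed.

End wiener.

Section wiener_lemma.
Context {R : realType} (n : nat).
Local Notation Zn := 'rV[int]_n.
Local Notation sumN := (cnt nat R).
Variables (a : discrete Zn -> R) (rho : R).
Hypotheses (Ia : l1 a) (rho01 : 0 <= rho < 1) (a_rho : forall x, normc (trig a x) <= rho).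

(** [eta] bounds the tail cut off by truncation, [theta] the symbol of the truncation, and q = theta
    + eta = rho + 2 eta, which is still below 1, is the rate that results for the powers of [a]. *)
Let eta := (1 - rho) / 4.
Let q := (1 + rho) / 2.
Let theta := rho + eta.

Let rho0 : 0 <= rho. Proof. by case/andP: rho01. Qed.
Let eta0 : 0 < eta. Proof. by rewrite divr_gt0// subr_gt0; case/andP: rho01. Qed.
Let theta0 : 0 <= theta. Proof. by rewrite addr_ge0// ltW. Qed.
Let qE : q = theta + eta. Proof. by rewrite /q /theta /eta; field. Qed.
Let q01 : 0 <= q < 1. Proof. by rewrite /q; case/andP: rho01 => h0 h1; apply/andP; split; lra. Qed.

Section truncated.
Variable D : nat.
(** a = p + r, with [p] finitely supported and [r] small in l1 norm. *)
Let r (k : discrete Zn) : R := if lattice_box D k then 0 else a k.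
Let p (k : discrete Zn) : R := if lattice_box D k then a k else 0.
Hypothesis r_eta : l1norm r <= eta.

Let Ir : l1 r.
Proof. by apply: l1_le Ia _ => k; rewrite /r; case: ifP => //; rewrite normr0. Qed.

Let Ip : l1 p.
Proof. by apply: l1_le Ia _ => k; rewrite /p; case: ifP => //; rewrite normr0. Qed.

Let trig_ap x : trig a x = trig p x + trig r x.
Proof.
rewrite -trigD//; apply: eq_trig => k.
by rewrite /p /r; case: ifP; rewrite ?addr0 ?add0r.
Qed.

Let trig_p x : normc (trig p x) <= theta.
Proof.
have -> : trig p x = trig a x - trig r x by rewrite trig_ap addrK.
apply: le_trans (normcB _ _) (lerD (a_rho x) _).
exact: le_trans (normc_trig x Ir) r_eta.
Qed.

Let N (l : nat) : R := (l%:R * (D%:R * 2) + 1) ^+ n.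

Let N0 l : 0 <= N l.
Proof. by rewrite exprn_ge0// addr_ge0// mulr_ge0// mulr_ge0. Qed.

Let N_le l : N l <= N l.+1.
Proof.
rewrite lerXn2r ?nnegrE ?addr_ge0 ?mulr_ge0//.
by rewrite lerD2r ler_wpM2r ?mulr_ge0// ler_nat.
Qed.

(** The l-th power of [p] lives on a box with (2 l D + 1)^n points, and each coefficient is at most
    the supremum of its symbol, that is theta^l. *)
Let norm_pow_p l : l1norm (pow p l) <= N l * theta ^+ l.
Proof.
have -> : N l = ((l * D)%:R * 2 + 1) ^+ n by rewrite /N natrM mulrA.
apply: box_l1norm_le; first exact: exprn_ge0.
  by apply: pow_box => k kD; rewrite /p (negbTE kD).
move=> k; apply: trig_coef_le; first exact: l1_pow.
move=> x; rewrite trig_pow// normcX lerXn2r ?nnegrE ?normc_ge0//.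
Qed.

(* Interpolates between the power [l] of the truncation, controlled by the
   size of its support, and the power [m] of [a]. *)
Let norm_mixed m l : l1norm (conv (pow a m) (pow p l)) <= N (m + l) * theta ^+ l * q ^+ m.
Proof.
have [q0 _] := andP q01.
have Iap m' l' : l1 (conv (pow a m') (pow p l')) by apply: l1_conv; exact: l1_pow.
elim: m l => [|m IH] l.
  rewrite expr0 mulr1 add0n; apply: le_trans (norm_pow_p l).
  rewrite le_eqVlt; apply/orP; left; apply/eqP; apply: eq_Rint => k; congr `|_|.
  apply: trig_inj k; [exact: Iap|exact: l1_pow|] => x.
  by rewrite trig_conv ?trig_delta0 ?mul1r//; [exact: l1_delta|exact: l1_pow].
have E : conv (pow a m.+1) (pow p l) =1
    fun k => conv (pow a m) (pow p l.+1) k + conv r (conv (pow a m) (pow p l)) k.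
  apply: trig_inj => [||x]; [exact: Iap|by apply: l1D => //; exact: l1_conv|].
  rewrite trigD//; last exact: l1_conv.
  have Im := l1_pow m Ia; have Il := l1_pow l Ip; have Im1 := l1_pow m.+1 Ia; have Il1 := l1_pow l.+1 Ip.
  rewrite (trig_conv x Im1 Il) (trig_conv x Im Il1) (trig_conv x Ir (Iap _ _)) (trig_conv x Im Il).
  rewrite (trig_pow m.+1 x Ia) (trig_pow l.+1 x Ip) (trig_pow m x Ia) (trig_pow l x Ip) !exprS trig_ap.
  by ring.
rewrite (_ : l1norm _ = l1norm (fun k => conv (pow a m) (pow p l.+1) k + conv r (conv (pow a m) (pow p l)) k)); last first.
  by apply: eq_Rint => k; rewrite E.
apply: le_trans (l1normD (Iap _ _) (l1_conv Ir (Iap _ _))) _.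
apply: (@le_trans _ _ (N (m + l.+1) * theta ^+ l.+1 * q ^+ m + eta * (N (m + l.+1) * theta ^+ l * q ^+ m))).
  apply: lerD; first exact: IH.
  apply: le_trans (l1norm_conv Ir (Iap _ _)) _.
  apply: ler_pM; rewrite ?l1norm_ge0//; apply: le_trans (IH l) _.
  by rewrite -!mulrA ler_wpM2r ?mulr_ge0 ?exprn_ge0// addnS.
rewrite addnS addSn le_eqVlt; apply/orP; left; apply/eqP.
by rewrite !exprS qE; ring.
Qed.

(** The mixed bound at l = 0 is a polynomial in m times q^m, which a convergent geometric series
    dominates. *)
Lemma wiener_summable_truncated : rintegrable sumN (fun m => l1norm (pow a m)).
Proof.
have [|K [t [t01 K0 Kt]]] := @polynomial_geometric R n (D%:R * 2) q _ q01.
  by rewrite mulr_ge0.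
apply: rintegrable_le (rintegrableZl K (rintegrable_geometric t01)) => // m.
rewrite ger0_norm ?l1norm_ge0//; apply: le_trans (Kt m).
have := norm_mixed m 0; rewrite expr0 mulr1 addn0; apply: le_trans.
rewrite le_eqVlt; apply/orP; left; apply/eqP; apply: eq_Rint => k; congr `|_|.
apply: trig_inj k => [||x]; [exact: l1_pow|by apply: l1_conv; [exact: l1_pow|exact: l1_delta]|].
by rewrite trig_conv ?trig_delta0 ?mulr1//; [exact: l1_pow|exact: l1_delta].
Qed.

End truncated.

(* The spectral radius of [a] in the Wiener algebra is at most the supremum of
   the modulus of its trigonometric series. *)
Lemma wiener_summable : rintegrable sumN (fun m => l1norm (pow a m)).
Proof. by have [D] := truncation Ia eta0; exact: wiener_summable_truncated. Qed.

End wiener_lemma.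

(** * Reciprocal and logarithm of a positive symbol *)

Section positive_symbols.
Context {R : realType} (n : nat).
Local Notation Zn := 'rV[int]_n.
Local Notation E := 'rV[R]_n.
Local Notation sumZ := (cnt Zn R).
Local Notation sumN := (cnt nat R).
Implicit Types (a b : discrete Zn -> R) (x y : E).

Lemma continuous_dot y : continuous (fun x => dot y x).
Proof.
move=> x; apply: (@cvg_big _ _ _ _ _ _ _ (nbhs x)) => [|i _]; first exact: add_continuous.
apply: cvgM; first exact: cvg_cst.
exact: coord_continuous.
Qed.

Lemma continuous_trig a : l1 a -> continuous (fun x => Re (trig a x)).
Proof.
move=> Ia x; apply: sequential_continuous_rV => u ux.
have cont (f : R -> R) k : continuous f ->
    f (2 * pi * dot (zvec k) (u m)) @[m --> \oo] --> f (2 * pi * dot (zvec k) x).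
  move=> cf; have cg : {for x, continuous (fun y => f (2 * pi * dot (zvec k) y))}.
    apply: continuous_comp; last exact: cf.
    exact: (cvgM (cvg_cst (2 * pi : R)) (continuous_dot (y := zvec k) (x := x))).
  exact: cvg_comp ux cg.
have [|||||//] := @cint_dct _ _ R sumZ
  (fun m k => (a k)%:C%C * cis (2 * pi * dot (zvec k) (u m)))
  (fun k => (a k)%:C%C * cis (2 * pi * dot (zvec k) x)) (fun k => `|a k|).
- by split.
- move=> k; under eq_fun do rewrite mulrC Re_mulr_real.
  rewrite mulrC Re_mulr_real; apply: cvgM; last exact: cvg_cst.
  by apply: (cont (@cos R)); exact: continuous_cos.
- move=> k; under eq_fun do rewrite mulrC Im_mulr_real.
  rewrite mulrC Im_mulr_real; apply: cvgM; last exact: cvg_cst.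
  by apply: (cont (@sin R)); exact: continuous_sin.
- exact: rintegrable_norm.
- by move=> m k; rewrite normcM normc_cis mulr1 normc_real.
Qed.

(** The minimum over the compact unit cube, extended to the whole space by periodicity. *)
Lemma trig_lower_bound a : l1 a -> (forall x, 0 < Re (trig a x)) ->
  exists2 m, 0 < m & forall x, m <= Re (trig a x).
Proof.
move=> Ia apos.
have cK : compact (@unit_cube R n).
  rewrite (_ : @unit_cube R n = [set v : E | forall i, `[0, 1]%classic (v ord0 i)]).
    apply: (@rV_compact R n (fun=> `[0, 1]%classic)) => i; exact: segment_compact.
  by apply/seteqP; split => v h i; have := h i; rewrite /= in_itv.
have [||c _ cmin] := EVT_min_rV (f := fun x => Re (trig a x)) _ cK.
- by exists 0 => i; rewrite mxE lexx ler01.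
- by apply: continuous_subspaceT; exact: continuous_trig.
exists (Re (trig a c)) => // x; have [k xk] := cube_fract x.
by rewrite -(trig_periodic a x k); apply: cmin; apply/mem_set.
Qed.

Variable a : discrete Zn -> R.
Hypotheses (Ia : l1 a) (a_real : forall x, Im (trig a x) = 0)
  (a_pos : forall x, 0 < Re (trig a x)).

Let s x := Re (trig a x).
(** The added 1 makes [M] positive and strictly larger than the symbol [s]. Then 1 - s/M, the symbol
    of [g], is at most 1 - m/M < 1 by the lower bound m of [s], as Wiener's lemma requires. *)
Let M := l1norm a + 1.
Let g (k : discrete Zn) : R := delta 0 k - M^-1 * a k.

Let M0 : 0 < M. Proof. by rewrite ltr_wpDl// l1norm_ge0. Qed.

Let trigE x : trig a x = (s x)%:C%C.
Proof. exact: complex_eqP. Qed.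

Let Ig : l1 g.
Proof. by apply: l1B; [exact: l1_delta|exact: l1Z]. Qed.

Let trig_g x : trig g x = (1 - s x / M)%:C%C.
Proof.
rewrite trigB ?trig_delta0; [|exact: l1_delta|exact: l1Z].
by rewrite trigZ// trigE -real_complexM mulrC [RHS]rmorphB.
Qed.

Let t x := 1 - s x / M.

Let s_lt x : s x < M.
Proof.
apply: (@le_lt_trans _ _ (l1norm a)); last by rewrite ltrDl.
by apply: le_trans (normc_trig x Ia); apply: le_trans (Re_le_normc _); exact: ler_norm.
Qed.

Let t01 x : 0 <= t x < 1.
Proof.
rewrite /t subr_ge0 ler_pdivrMr// mul1r (ltW (s_lt x)) ltrBlDr ltrDl.
by rewrite divr_gt0//; exact: a_pos.
Qed.

Let summable_pow : rintegrable sumN (fun m => l1norm (pow g m)).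
Proof.
have [m m0 ms] := trig_lower_bound Ia a_pos.
apply: (@wiener_summable _ _ _ (1 - m / M)) => // [|x].
  rewrite subr_ge0 ler_pdivrMr// mul1r (le_trans (ms 0) (ltW (s_lt 0))).
  by rewrite ltrBlDr ltrDl divr_gt0.
rewrite trig_g normc_real ger0_norm; last by case/andP: (t01 x).
by rewrite lerD2l lerN2 ler_pM2r ?invr_gt0//; exact: ms.
Qed.

Let trig_pow_g m x : trig (pow g m) x = (t x ^+ m)%:C%C.
Proof. by rewrite trig_pow// trig_g -rmorphXn. Qed.

(** With t = 1 - s/M, 1/s = M^(-1) sum_m t^m, realized by convolution powers of [g]. *)
Lemma wiener_inverse : exists2 w, l1 w & forall x, trig w x = ((Re (trig a x))^-1)%:C%C.
Proof.
have Ip m : l1 (pow g m) by exact: l1_pow.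
have Il := l1_lsum Ip summable_pow.
exists (fun k => M^-1 * lsum (pow g) k); first exact: l1Z.
move=> x; rewrite trigZ// (trig_lsum _ Ip summable_pow).
rewrite (eq_cint _ (fun m => trig_pow_g m x)) cint_real Rint_geometric// -real_complexM.
congr (_%:C%C); rewrite /t opprB addrC subrK invf_div mulKf//; exact: lt0r_neq0.
Qed.

(** ln(1/s) = -ln M - ln(1 - t) with t = 1 - s/M, expanded as -ln M + sum_m t^(m+1)/(m+1). The norms
    of the terms are dominated by those of the powers of [g]. *)
Lemma wiener_log : exists2 w, l1 w & forall x, trig w x = (ln (Re (trig a x))^-1)%:C%C.
Proof.
pose A (m : discrete nat) (k : discrete Zn) : R := m.+1%:R^-1 * pow g m.+1 k.
have IA m : l1 (A m) by apply: l1Z; exact: l1_pow.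
have SA : rintegrable sumN (fun m => l1norm (A m)).
  apply: rintegrable_le (rintegrableZl (l1norm g) summable_pow) => // m.
  have Ip := l1_pow m.+1 Ig.
  rewrite ger0_norm ?l1norm_ge0// l1normZ// ger0_norm ?invr_ge0//.
  apply: le_trans (l1norm_conv Ig (l1_pow m Ig)).
  by rewrite ler_piMl ?l1norm_ge0// invf_le1// ler1n.
have Il := l1_lsum IA SA; have Id : l1 (fun k : discrete Zn => - ln M * delta 0 k) by apply: l1Z; exact: l1_delta.
exists (fun k : discrete Zn => - ln M * delta 0 k + lsum A k); first exact: l1D.
move=> x; rewrite trigD// (trig_lsum _ IA SA) trigZ; last exact: l1_delta.
rewrite trig_delta0 mulr1.
have E1 (m : discrete nat) : trig (A m) x = (t x ^+ m.+1 / m.+1%:R)%:C%C.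
  by rewrite trigZ ?trig_pow_g -?real_complexM 1?mulrC//; exact: l1_pow.
rewrite (eq_cint _ E1) cint_real Rint_log// -real_complexD; congr (_%:C%C).
rewrite /t subKr lnV ?posrE ?a_pos// lnM ?posrE ?invr_gt0 ?a_pos//.
rewrite lnV ?posrE//; ring.
Qed.

End positive_symbols.

(** * Symbols on the torus *)

Section torus_series.
Context {R : realType} (n : nat).
Local Notation Zn := 'rV[int]_n.
Local Notation E := 'rV[R]_n.
Local Notation sumZ := (cnt Zn R).
Implicit Types (a : discrete Zn -> R) (x : E) (k : Zn).

Lemma cis_exprz (t : R) (k : int) : cis t ^ k = cis (k%:~R * t).
Proof.
have cisX m : cis t ^+ m = cis (m%:R * t).
  elim: m => [|m IH]; first by rewrite expr0 mul0r cis0.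
  by rewrite exprS IH -cisD -natr1 mulrDl mul1r addrC.
case: k => m; first exact: cisX.
rewrite NegzE -exprnN cisX rmorphN mulNr.
have E1 s : cis s * cis (- s) = 1 :> R[i] by rewrite -cisD subrr cis0.
have s0 s : cis s != 0 :> R[i].
  by apply/eqP => c0; have := E1 s; rewrite c0 mul0r => /esym/eqP; rewrite oner_eq0.
by apply: (mulfI (s0 (m.+1%:R * t))); rewrite E1 mulfV.
Qed.

Lemma zpow_torus_pt x k : zpow (torus_pt x) k = cis (2 * pi * dot (zvec k) x).
Proof.
rewrite /zpow /dot mulr_sumr cis_sum; apply: eq_bigr => i _.
by rewrite !mxE cis_exprz; congr cis; ring.
Qed.

Lemma torus_torus_pt x : torus (torus_pt x).
Proof. by move=> i; rewrite mxE normc_def -normcE normc_cis. Qed.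

Lemma zinv_torus_pt x : zinv (torus_pt x) = torus_pt (- x).
Proof.
apply/rowP => i; rewrite !mxE -exprN1 cis_exprz; congr cis.
by rewrite rmorphN mulN1r mulrN.
Qed.

Lemma l1_restrict (D : set Zn) a : l1 a -> l1 (fun k => if k \in D then a k else 0).
Proof. by move=> Ia; apply: l1_le Ia _ => k; case: ifP => //; rewrite normr0. Qed.

Lemma csum_trig (D : set Zn) a x : l1 a ->
  csum D (fun k => (a k)%:C%C * zpow (torus_pt x) k) =
  trig (fun k => if k \in D then a k else 0) x.
Proof.
move=> Ia.
have E1 (k : discrete Zn) : (if k \in D then a k else 0)%:C%C * cis (2 * pi * dot (zvec k) x) =
    if k \in D then (a k)%:C%C * zpow (torus_pt x) k else 0.
  by rewrite zpow_torus_pt; case: ifP => // _; rewrite mul0r.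
rewrite csum_cint; last exact: eq_cintegrable E1 (trig_integrand x (l1_restrict D Ia)).
by apply: eq_cint => k; rewrite -E1.
Qed.

Lemma trig_reflect a (j : Zn) x : l1 a ->
  trig (fun k => a (j - k)) x = cis (2 * pi * dot (zvec j) x) * trig a (- x).
Proof.
move=> Ia; have I := cintegrableZ (cis (2 * pi * dot (zvec j) x)) (trig_integrand (- x) Ia).
rewrite /trig -cintZ; last exact: trig_integrand.
rewrite -(cint_reindex (subl_bij j) I); apply: eq_cint => k.
rewrite mulrCA -cisD zvecB dotBl !dotNr; congr (_ * cis _); ring.
Qed.

Lemma l1_reflect a (j : Zn) : l1 a -> l1 (fun k => a (j - k)).
Proof. by move=> Ia; exact: (rintegrable_reindex (subl_bij j) Ia). Qed.

(** The exponential series converges for convolution powers of any summable sequence, by comparison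
    with the exponential of the l1 norm. Every additive submonoid containing the support of [a] also
    contains that of [b]. *)
Lemma exp_trig a : l1 a -> exists b, [/\ l1 b, forall x, trig b x = cexp (trig a x) &
  forall S : set Zn, S 0 -> (forall k l, S k -> S l -> S (k + l)) ->
    (forall k, ~ S k -> a k = 0) -> forall k, ~ S k -> b k = 0].
Proof.
move=> Ia; pose A (m : discrete nat) (k : discrete Zn) : R := m`!%:R^-1 * pow a m k.
have IA m : l1 (A m) by apply: l1Z; exact: l1_pow.
have SA : rintegrable (cnt nat R) (fun m => l1norm (A m)).
  apply: rintegrable_le (rintegrable_exp (l1norm a)) => // m.
  rewrite ger0_norm ?l1norm_ge0// l1normZ; last exact: l1_pow.
  by rewrite ger0_norm ?invr_ge0// mulrC ler_wpM2r ?invr_ge0// l1norm_pow.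
exists (lsum A); split; first exact: l1_lsum.
  move=> x; rewrite trig_lsum// -cint_exp_term; apply: eq_cint => m.
  by rewrite trigZ ?trig_pow 1?mulrC//; exact: l1_pow.
move=> S S0 SD aS k Sk; transitivity (\int[cnt nat R]_m (0 : R))%R.
  by apply: eq_Rint => m; rewrite /A (pow_support _ S0 SD aS Sk) mulr0.
by rewrite Rintegral_cst// mul0r.
Qed.

End torus_series.

Section lattice_symbol.
Context {R : realType} (n : nat) (phi : 'rV[R]_n -> R).
Local Notation Zn := 'rV[int]_n.
Hypotheses (phi_sym : forall x, phi (- x) = phi x)
  (phi_fin : (amalgam_norm phi < +oo)%E) (phi_symbol : forall z, torus z -> 0 < symbol phi z).

Definition lattice_values (k : discrete Zn) : R := phi (zvec k).
Local Notation phiZ := lattice_values.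
Let s x : R := Re (trig phiZ x).

Lemma l1_lattice_values : l1 phiZ.
Proof. exact: summable_phi. Qed.

Let Iphi := l1_lattice_values.

Lemma symbol_trig x : symbol phi (torus_pt x) = trig phiZ x.
Proof.
rewrite /symbol (csum_trig _ x Iphi); apply: eq_trig => k.
by rewrite in_setT.
Qed.

Let phiZ_pos x : 0 < trig phiZ x.
Proof. by rewrite -symbol_trig; apply: phi_symbol; exact: torus_torus_pt. Qed.

Let s_pos x : 0 < s x.
Proof. by have := phiZ_pos x; rewrite ltcE => /andP[_]. Qed.

Let s_real x : Im (trig phiZ x) = 0.
Proof. by have := phiZ_pos x; rewrite ltcE => /andP[/eqP]. Qed.

Lemma trig_lattice_values x : trig phiZ x = (s x)%:C%C.
Proof. exact: complex_eqP. Qed.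

Let s_even x : s (- x) = s x.
Proof. by rewrite /s -conj_trig// ReJ. Qed.

Let omega_torus x : omega phi (torus_pt x) = ((s x)^-1)%:C%C.
Proof. by rewrite /omega symbol_trig trig_lattice_values -fmorphV. Qed.

(** The identity omega sigma = 1, read on coefficients, is the set of interpolation conditions for
    chi. *)
Lemma cardinal_coefficients : exists w : discrete Zn -> R,
  [/\ l1 w, forall k, cardinal_coef phi k = (w k)%:C%C & forall k, conv w phiZ k = delta 0 k].
Proof.
have [w Iw wE] := wiener_inverse Iphi s_real s_pos.
exists w; split=> // [k|].
  by apply: fourier_coef_trig => // x; rewrite omega_torus wE.
apply: trig_inj => [||x]; [exact: l1_conv|exact: l1_delta|].
by rewrite trig_conv// wE trig_lattice_values -real_complexM (mulVf (lt0r_neq0 (s_pos x))) trig_delta0.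
Qed.

(** The coefficients of sigma are real, so its real part is invariant under z -> 1/z. This gives
    lambda_(-k) = lambda_k, on which the factorization of omega rests. *)
Lemma log_coefficients : exists w : discrete Zn -> R,
  [/\ l1 w, forall k, log_coef phi k = (w k)%:C%C, forall k, w (- k) = w k &
      forall x, cexp (trig w x) * trig phiZ x = 1].
Proof.
have [w Iw wE] := wiener_log Iphi s_real s_pos.
exists w; split=> // [k||x].
- by apply: fourier_coef_trig => // x; rewrite /log_omega omega_torus wE.
- apply: (trig_inj (l1_refl Iw) Iw) => x.
  by rewrite trig_refl// !wE -/(s _) -/(s _) s_even.
rewrite wE trig_lattice_values /cexp /= cis0 mulr1 lnK ?posrE ?invr_gt0 ?s_pos//.
by rewrite -real_complexM (mulVf (lt0r_neq0 (s_pos x))).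
Qed.

Lemma shift_series_lattice (c : discrete Zn -> R) l :
  shift_series phi c (zvec l) = (conv c phiZ l)%:C%C.
Proof.
rewrite /shift_series; congr (_%:C%C); apply: eq_Rint => k.
by rewrite /lattice_values zvecB.
Qed.

End lattice_symbol.

(** * Wiener-Hopf factorization *)

Section wiener_hopf.
Context {R : realType} (n : nat).
Local Notation Zn := 'rV[int]_n.
Implicit Types (a b c lam : discrete Zn -> R) (k l j : Zn).
(** [a] stands for the coefficients of sigma, [lamp] for those of Lambda_+, [b] for those of omega_+
    and [b'] for those of 1/omega_+. *)
Variables (H : set Zn) (a lamp b b' : discrete Zn -> R).
Hypotheses (H0 : H 0) (HD : forall k l, H k -> H l -> H (k + l)).
Hypotheses (Ia : l1 a) (Ilamp : l1 lamp) (Ib : l1 b) (Ib' : l1 b').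
Hypotheses (bE : forall x, trig b x = cexp (trig lamp x))
  (b'E : forall x, trig b' x = cexp (- trig lamp x))
  (bH : forall k, ~ H k -> b k = 0) (b'H : forall k, ~ H k -> b' k = 0).
Hypothesis factor : forall x, trig b x * trig b (- x) * trig a x = 1.

Variable j : Zn.

(** The coefficients of P_+(z^j omega_+(1/z)); [reflect_minus] holds those of the complementary
    part, off [H]. *)
Definition reflect_plus k : R := if k \in H then b (j - k) else 0.
Let reflect_minus k : R := b (j - k) - reflect_plus k.

Definition semi_coef_real : discrete Zn -> R := conv b reflect_plus.

Let Ir : l1 (fun k => b (j - k)) := l1_reflect j Ib.
Let Ip : l1 reflect_plus := l1_restrict H Ir.
Let Im : l1 reflect_minus := l1B Ir Ip.

Lemma l1_semi_coef : l1 semi_coef_real.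
Proof. exact: l1_conv. Qed.

Lemma semi_coef_support k : ~ H k -> semi_coef_real k = 0.
Proof.
move=> Hk; apply: conv_eq0 => l; have [Hl|] := pselect (H l); last by left; exact: bH.
right; rewrite /reflect_plus; case: ifPn => // /set_mem Hkl; case: Hk.
by rewrite -(subrK l k); exact: HD.
Qed.

(* The error term is the anti-analytic symbol [1 / omega_+(1/z)] times the
   part of [z^j omega_+(1/z)] off [H]; its coefficients vanish on [H]. *)
Let conv_semi k : conv semi_coef_real a k = delta j k - conv (refl b') reflect_minus k.
Proof.
have Irb' := l1_refl Ib'; have Is := l1_semi_coef.
apply: (trig_inj (b := fun k => delta j k - conv (refl b') reflect_minus k)) => [||x].
- exact: l1_conv.
- by apply: l1B; [exact: l1_delta|exact: l1_conv].
rewrite (trig_conv x Is Ia) (trig_conv x Ib Ip) (trigB x (l1_delta j) (l1_conv Irb' Im)).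
rewrite (trig_conv x Irb' Im) (trigB x Ir Ip) trig_reflect// trig_delta (trig_refl x Ib').
set e := cis _; set p := trig reflect_plus x.
have bb' y : trig b y * trig b' y = 1.
  by rewrite bE b'E -cexpD subrr /cexp /= expR0 mul1r cis0.
have := factor x; have := bb' (- x); set u := trig b (- x); set u' := trig b' (- x).
set B := trig b x; set A := trig a x => uu' BuA.
have BA : B * A = u'.
  by rewrite -[LHS]mulr1 -uu' mulrA [B * A * u]mulrAC BuA mul1r.
rewrite mulrAC BA mulrBr (_ : u' * (e * u) = e); first by rewrite subKr.
by rewrite mulrCA [u' * u]mulrC uu' mulr1.
Qed.

(** A nonzero term of the error would need -l in H and k - l off H, but k - l = k + (-l) lies in H
    when k does. *)
Lemma semi_coef_interpolates k : H k -> conv semi_coef_real a k = delta j k.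
Proof.
move=> Hk; rewrite conv_semi [conv (refl b') _ _]conv_eq0 ?subr0// => l.
have [Hl|] := pselect (H (- l)); last by left; exact: b'H.
by right; rewrite /reflect_minus /reflect_plus mem_set ?subrr//; exact: HD.
Qed.

End wiener_hopf.

(** * Half-space lattices *)

Section half_spaces.
Context {R : realType} (d : nat).
Local Notation Zd := 'rV[int]_d.+1.
Implicit Types (H : half_space d) (k l : Zd).

(** The intersection of H with -H, whose coefficients Lambda_+ shares equally between omega_+(z) and
    omega_+(1/z). *)
Definition half_mid H : set Zd :=
  match H with
  | FlatHalfSpace => [set k : Zd | k ord0 ord_max = 0]
  | OrderHalfSpace le => [set 0]
  end.

Definition half_pos H : set Zd :=
  match H with
  | FlatHalfSpace => [set k : Zd | 0 < k ord0 ord_max]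
  | OrderHalfSpace le => [set k : Zd | le 0 k /\ k <> 0]
  end.

Lemma half_set0 H : half_set H 0.
Proof. by case: H => [|le] /=; [rewrite mxE|exact: lo_refl]. Qed.

Lemma half_setD H k l : half_set H k -> half_set H l -> half_set H (k + l).
Proof.
case: H => [|le] /=; first by rewrite mxE; exact: addr_ge0.
move=> hk hl; apply: (lo_trans (y := l)) => //.
by have := lo_add l hk; rewrite add0r.
Qed.

Lemma half_mid_sub H k : half_mid H k -> half_set H k.
Proof. by case: H => [|le] /= ->//; exact: lo_refl. Qed.

Lemma half_pos_sub H k : half_pos H k -> half_set H k.
Proof. by case: H => [|le] /=; [exact: ltW|case]. Qed.

(** The multiplier from log omega to Lambda_+. Its values at k and -k add up to 1, so with even
    coefficients Lambda_+(z) + Lambda_+(1/z) = log omega(z), for both kinds of half-spaces. *)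
Definition half_weight H k : R :=
  2^-1 * (k \in half_mid H)%:R + (k \in half_pos H)%:R.

Lemma half_weightN H k : half_weight H k + half_weight H (- k) = 1.
Proof.
have in_bool (S : set Zd) (l : Zd) (b : bool) : (S l <-> b) -> (l \in S) = b.
  by move=> Sb; apply/idP/idP => [/set_mem/Sb|/Sb/mem_set].
rewrite /half_weight; case: H => [|le].
  have mid l : (l \in half_mid FlatHalfSpace) = (l ord0 ord_max == 0).
    by apply: in_bool => /=; split=> /eqP.
  have pos l : (l \in half_pos FlatHalfSpace) = (0 < l ord0 ord_max) by apply: in_bool.
  rewrite !mid !pos mxE oppr_eq0 oppr_gt0.
  by case: ltgtP => _; rewrite /= ?mulr1 ?mulr0 ?addr0 ?add0r//; field.
have mid l : (l \in half_mid (OrderHalfSpace le)) = (l == 0).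
  by apply: in_bool => /=; split=> /eqP.
have pos l : (l \in half_pos (OrderHalfSpace le)) = le 0 l && (l != 0).
  by apply: in_bool => /=; split=> [[h /eqP]|/andP[h /eqP]//]; rewrite h.
rewrite !mid !pos oppr_eq0; have [->|k0] := eqVneq k 0.
  by rewrite !andbF /=; field.
rewrite !andbT mulr0 !add0r.
have leN l : le 0 (- l) = le l 0.
  apply/idP/idP => h; first by have := lo_add l h; rewrite add0r addNr.
  by have := lo_add (- l) h; rewrite addrN add0r.
(* For k nonzero exactly one of 0 <= k and k <= 0 holds: antisymmetry excludes both, totality
   excludes neither. *)
rewrite leN; case k1: (le 0 k); case k2: (le k 0); rewrite ?addr0 ?add0r//.
  by move/eqP: k0; case; apply: (@lo_anti _ le); rewrite k2 k1.
by have := lo_total le 0 k; rewrite k1 k2.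
Qed.

Lemma half_weight_out H k : ~ half_set H k -> half_weight H k = 0.
Proof.
move=> Hk; rewrite /half_weight !memNset ?mulr0 ?addr0//.
  by move/half_pos_sub.
by move/half_mid_sub.
Qed.

End half_spaces.

(** * Coefficients of semi-cardinal interpolation *)

Section semi_cardinal_coefficients.
Context {R : realType} (d : nat) (phi : 'rV[R]_d.+1 -> R).
Local Notation Zd := 'rV[int]_d.+1.
Hypotheses (phi_sym : forall x, phi (- x) = phi x)
  (phi_fin : (amalgam_norm phi < +oo)%E) (phi_symbol : forall z, torus z -> 0 < symbol phi z).
Variables (H : half_space d) (j : Zd).
Local Notation phiZ := (lattice_values phi).

Lemma Lambda_plus_trig (lam : discrete Zd -> R) x : l1 lam ->
  (forall k, log_coef phi k = (lam k)%:C%C) ->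
  Lambda_plus phi H (torus_pt x) = trig (fun k => half_weight H k * lam k) x.
Proof.
move=> Ilam lamE.
have half : (2^-1 : R[i]) = (2^-1)%:C%C by rewrite fmorphV rmorph_nat.
have IM := l1_restrict (half_mid H) Ilam; have IP := l1_restrict (half_pos H) Ilam.
transitivity (2^-1 * trig (fun k => if k \in half_mid H then lam k else 0) x +
    trig (fun k => if k \in half_pos H then lam k else 0) x).
  have termE : (fun k => log_coef phi k * zpow (torus_pt x) k) =
      fun k => (lam k)%:C%C * zpow (torus_pt x) k by apply/funext => k; rewrite lamE.
  rewrite -!csum_trig// /Lambda_plus termE; case: H => [//|le]; congr (_ * _ + _).
  (* For an order the middle set is {0}, so its sum is the single term lambda_0. *)
  rewrite csum_trig//.
  rewrite (eq_trig (b := fun k => lam 0 * delta 0 k)) ?trigZ ?trig_delta0 ?mulr1 ?lamE//.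
    exact: l1_delta.
  move=> k; rewrite /delta; case: eqP => [->|k0]; first by rewrite mem_set ?mulr1.
  by rewrite memNset ?mulr0.
rewrite half -trigZ// -trigD//; last exact: l1Z.
apply: eq_trig => k; rewrite /half_weight.
by case: (k \in half_mid H); case: (k \in half_pos H); rewrite /= ?mulr1 ?mulr0 ?add0r ?addr0 ?mulrDl ?mul1r ?mul0r.
Qed.

Lemma semi_coefficients : half_set H j -> exists c : discrete Zd -> R,
  [/\ l1 c, forall k, semi_coef phi H j k = (c k)%:C%C, forall k, ~ half_set H k -> c k = 0 &
      forall k, half_set H k -> conv c phiZ k = delta j k].
Proof.
move=> Hj; have [lam [Ilam lamE lam_even lam_inv]] := log_coefficients phi_sym phi_fin phi_symbol.
pose lamp (k : discrete Zd) : R := half_weight H k * lam k.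
have w1 k : `|half_weight H k : R| <= 2.
  rewrite /half_weight; apply: le_trans (ler_normD _ _) _.
  rewrite normrM !normr_nat ger0_norm ?invr_ge0//.
  by case: (_ \in _); case: (_ \in _); rewrite /= ?mulr1 ?mulr0; lra.
have Ilamp : l1 lamp.
  apply: (l1_le (l1Z 2 Ilam)) => k; rewrite !normrM (ger0_norm (x := 2))//.
  by apply: ler_wpM2r; [exact: normr_ge0|exact: w1].
have [b [Ib bE bH]] := exp_trig Ilamp.
(* 1/omega_+ = exp(-Lambda_+) is again an exponential, hence also has summable coefficients
   supported on H. *)
have [b' [Ib' b'E b'H]] := exp_trig (l1Z (-1) Ilamp).
have H0 := half_set0 H; have HD := @half_setD d H.
have lampH k : ~ half_set H k -> lamp k = 0.
  by move=> Hk; rewrite /lamp half_weight_out// mul0r.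
have {}bH := bH _ H0 HD lampH.
have {}b'H : forall k, ~ half_set H k -> b' k = 0.
  by apply: b'H => // k Hk; rewrite lampH// mulr0.
have {}b'E x : trig b' x = cexp (- trig lamp x).
  by rewrite b'E trigZ// rmorphN1 mulN1r.
have factor x : trig b x * trig b (- x) * trig phiZ x = 1.
  rewrite -(lam_inv x) !bE -cexpD -trig_refl// -trigD//; last exact: l1_refl.
  congr (cexp _ * _); apply: eq_trig => k.
  by rewrite /refl /lamp lam_even -mulrDl half_weightN mul1r.
have Iphi := l1_lattice_values phi_sym phi_fin.
exists (semi_coef_real (half_set H) b j); split.
- exact: l1_semi_coef.
- have omega_plusE x : omega_plus phi H (torus_pt x) = trig b x.
    by rewrite /omega_plus (Lambda_plus_trig x Ilam lamE) bE.
  move=> k; apply: fourier_coef_trig => [|x]; first exact: l1_semi_coef.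
  rewrite /semi_symbol omega_plusE trig_conv//; last exact: (l1_restrict _ (l1_reflect j Ib)).
  congr (_ * _); rewrite /proj_plus -(csum_trig _ _ (l1_reflect j Ib)).
  congr csum; apply/funext => l; congr (_ * _).
  apply: (fourier_coef_trig (a := fun k : discrete Zd => b (j - k))) => [|y]; first exact: l1_reflect.
  by rewrite zinv_torus_pt omega_plusE zpow_torus_pt trig_reflect.
- by move=> k Hk; apply: semi_coef_support.
- by move=> k Hk; apply: (semi_coef_interpolates HD Iphi Ib Ib' bE b'E).
Qed.

End semi_cardinal_coefficients.

(* The dimension is d.+1. *)
Theorem theorem4p3 (R : realType) (d : nat) (phi : 'rV[R]_d.+1 -> R)
    (phi_pd : positive_definite phi)
    (phi_cont : continuous phi)
    (phi_sym : forall x, phi (- x) = phi x)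
    (phi_fin : (amalgam_norm phi < +oo)%E)
    (phi_symbol : forall z, torus z -> 0 < symbol phi z) :
  [/\ native phi (cardinal_lagrange phi),
      forall f, native phi f ->
        has_csum setT (fun k => cardinal_coef phi k * f (zvec k))
          (native_ip phi f (cardinal_lagrange phi)) &
      unique_min_norm_interpolant phi setT 0 (cardinal_lagrange phi)] /\
  (forall (H : half_space d) (j : 'rV[int]_d.+1), half_set H j ->
    [/\ native phi (semi_lagrange phi H j),
        forall f, native phi f ->
          has_csum (half_set H) (fun k => semi_coef phi H j k * f (zvec k))
            (native_ip phi f (semi_lagrange phi H j)) &
        unique_min_norm_interpolant phi (half_set H) j
          (semi_lagrange phi H j)]).
Proof.
(* Both parts of the theorem reduce to real summable coefficients supported on [D] whose convolution
   with the values of phi on the lattice is a delta on [D]. *)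
have main (D : set 'rV[int]_d.+1) (j : 'rV[int]_d.+1) (coef : 'rV[int]_d.+1 -> R[i])
    (c : discrete 'rV[int]_d.+1 -> R) : D j -> l1 c -> (forall k, coef k = (c k)%:C%C) ->
    (forall k, ~ D k -> c k = 0) ->
    (forall k, D k -> conv c (lattice_values phi) k = delta j k) ->
    let g x := csum D (fun k => coef k * (phi (x - zvec k))%:C%C) in
    [/\ native phi g, forall f, native phi f ->
        has_csum D (fun k => coef k * f (zvec k)) (native_ip phi f g) &
      unique_min_norm_interpolant phi D j g].
  move=> Dj Ic cE cD cint g.
  have gE : g = shift_series phi c.
    apply/funext => x; rewrite /g; under eq_fun do rewrite cE.
    exact: series_csum.
  rewrite gE; split.
  - exact: native_series.
  - move=> f nf; under eq_fun do rewrite cE.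
    exact: has_csum_series.
  - apply: series_min_norm => // l Dl.
    have := shift_series_lattice phi c l; rewrite cint// => /(congr1 (@complex.Re R)) /= ->.
    by rewrite /delta eq_sym; case: (j == l).
split.
  have [w [Iw wE wI]] := cardinal_coefficients phi_sym phi_fin phi_symbol.
  by apply: (main setT 0 _ w) => // k [].
move=> H j Hj.
have [c [Ic cE cH cI]] := semi_coefficients phi_sym phi_fin phi_symbol Hj.
exact: (main (half_set H) j _ c).
Qed.
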